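(* Let $D$ be a double vector bundle with side bundles $A\to M$ and $B\to M$ and core $C\to M$. Let $D^{*A}$ be the dual of $D\to A$, let $D^{*B}$ be the dual of $D\to B$, and let $(D^{*B})^{*C^*}$ be the dual of $D^{*B}\to C^*$. Let $\mathcal{B}\in (D^{*B})^{*C^*}$ lie over $m\in M$. Then there is a unique $\Phi\in D^{*A}$ lying over the same $m\in M$ such that $$\langle \mathcal{B},\Psi\rangle_{C^*}+\langle \Phi,d\rangle_A=\langle\Psi,d\rangle_B$$ for all compatible $\Psi\in D^{*B}$ and $d\in D$. Here ''compatible'' means that all three pairings are defined: $\Psi$ and $\mathcal{B}$ project to the same element of $C^*$, $d$ and $\Phi$ project to the same element of $A$, and $d$ and $\Psi$ project to the same element of $B$. Moreover, this condition defines the graph of an isomorphism of double vector bundles $$R^D_A\colon (D^{*B})^{*C^*}\to D^{*A},\qquad \mathcal{B}\mapsto\Phi,$$ which preserves $A$ and $C^*$ (that is, it induces the identity maps $A\to A$ and $C^*\to C^*$ on the side bundles) and induces $-\mathrm{id}$ on the cores $B^*\to B^*$. That is, $$\langle \mathcal{B},\Psi\rangle_{C^*}+\langle R^D_A(\mathcal{B}),d\rangle_A=\langle\Psi,d\rangle_B$$ for all $\mathcal{B}\in (D^{*B})^{*C^*}$ and all compatible $\Psi\in D^{*B}$ and $d\in D$.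
   Context: **Double vector bundles.** A double vector bundle $D$ with side bundles $A\to M$ and $B\to M$ (smooth vector bundles over a manifold $M$) is a manifold $D$ with two vector bundle structures $D\to A$ and $D\to B$, such that each of the four structure maps (bundle projection, addition, scalar multiplication, zero section) of either structure is a morphism of vector bundles with respect to the other structure, and such that $D\to A\times_M B$ is a surjective submersion. Write $+_A$ for addition in the fibres of $D\to A$ and $+_B$ for addition in the fibres of $D\to B$. Write $\tilde 0^A_a$ for the zero of $D\to A$ over $a\in A$ and $\tilde 0^B_b$ for the zero of $D\to B$ over $b\in B$. The core $C$ is the set of elements of $D$ that project to zeros in both $A$ and $B$; the two additions coincide on $C$ and make it a vector bundle over $M$. An isomorphism of double vector bundles is a diffeomorphism of the total spaces which is an isomorphism of vector bundles with respect to both structures, covering vector bundle isomorphisms of the side bundles. It restricts to a vector bundle isomorphism of the cores. Double vector bundles are identified with those obtained by interchanging the positions of the two side bundles. **Duals.** $D^{*A}$ is the usual dual of the vector bundle $D\to A$, with pairing $\langle\ ,\ \rangle_A$. It is a double vector bundle with side bundles $A$ and $C^*$ and core $B^*$, as follows. - Projection to $C^*$: an element $\Phi\in D^{*A}$ over $a\in A_m$ projects to $\kappa\in C^*_m$, where $\langle\kappa,c\rangle=\langle\Phi,\tilde 0^A_a+_B c\rangle_A$ for $c\in C_m$. - Addition over $C^*$: if $\Phi,\Phi'$ lie over $a,a'$ and the same $\kappa$, then $\langle\Phi+_{C^*}\Phi',\,d+_B d'\rangle_A=\langle\Phi,d\rangle_A+\langle\Phi',d'\rangle_A$ for all $d,d'\in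 D$ over $a,a'$ respectively and over a common $b\in B$. Scalar multiplication over $C^*$ is defined analogously, and the zero over $\kappa\in C^*_m$ lies over $0\in A_m$ and is given by $\tilde 0^B_b+_A c\mapsto\langle\kappa,c\rangle$. - Core: $\beta\in B^*_m$ corresponds to the element of $D^{*A}$ over $0\in A_m$ given by $\tilde 0^B_b+_A c\mapsto\langle\beta,b\rangle$, for $b\in B_m$, $c\in C_m$. Interchanging the roles of $A$ and $B$, the dual $D^{*B}$ of $D\to B$, with pairing $\langle\ ,\ \rangle_B$, is a double vector bundle with side bundles $B$ and $C^*$ and core $A^*$. Applying the same construction to the double vector bundle $D^{*B}$ (sides $C^*$ and $B$, core $A^*$) and its structure over $C^*$ gives the iterated dual $(D^{*B})^{*C^*}$, with pairing $\langle\ ,\ \rangle_{C^*}$ with $D^{*B}$ over $C^*$. It is a double vector bundle with side bundles $C^*$ and $(A^* )^*=A$ and core $B^*$. *)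

(* Defs.v *)
From mathcomp Require Import all_boot all_order all_algebra.
From mathcomp Require Import boolp classical_sets functions reals topology normedtype.
From mathcomp Require Import derive.
Set Implicit Arguments.
Unset Strict Implicit.
Unset Printing Implicit Defensive.
Import Order.TTheory GRing.Theory Num.Theory.
Import numFieldNormedType.Exports.
Local Open Scope classical_set_scope.
Local Open Scope ring_scope.

(* Structures are given as bare data (records [mfd], [vb], [dvb]) together with
   predicates [is_mfd], [is_vb], [is_dvb] stating the axioms.  The algebraic
   operations of a vector bundle are total functions on the total space which
   are only meaningful for arguments in a common fibre. *)

(** * Smooth maps between Euclidean spaces *)

Fixpoint Ck (R : realType) (n p k : nat) (W : set 'rV[R]_n)
    (f : 'rV[R]_n -> 'rV[R]_p) : Prop :=
  match k with
  | 0 => forall x, W x -> {for x, continuous f}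
  | k'.+1 => (forall x, W x -> differentiable f x) /\
             (forall v, Ck k' W (fun x => 'D_v f x))
  end.

(* Used for open W only. *)
Definition Cinfty (R : realType) (n p : nat) (W : set 'rV[R]_n)
    (f : 'rV[R]_n -> 'rV[R]_p) : Prop := forall k, Ck k W f.

(** * Smooth manifolds *)

(* A chart takes values in R^n; the values of [cmap] outside [cdom] are
   irrelevant. *)
Record chart (R : realType) (X : Type) := Chart {
  cdim : nat;
  cdom : set X;
  cmap : X -> 'rV[R]_cdim
}.

(* The topology is the one induced by the atlas.  Charts of different dimensions
   are allowed: the dimension of a manifold, like the rank of a vector bundle, is
   only locally constant. *)
Record mfd (R : realType) := Mfd {
  carrier :> Type;
  atlas : set (chart R carrier)
}.

(* On the open set W around c x, g is smooth and represents f in the charts c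
   and c': g = c' \o f \o c^-1. *)
Definition local_rep (R : realType) (X Y : Type) (f : X -> Y)
    (c : chart R X) (c' : chart R Y) (x : X)
    (W : set 'rV[R]_(cdim c)) (g : 'rV[R]_(cdim c) -> 'rV[R]_(cdim c')) : Prop :=
  [/\ cdom c x,
      open W /\ W (cmap c x),
      W `<=` cmap c @` cdom c,
      Cinfty W g &
      forall y, cdom c y -> W (cmap c y) ->
        cdom c' (f y) /\ cmap c' (f y) = g (cmap c y)].

Definition smooth_in_charts (R : realType) (X Y : Type) (f : X -> Y)
    (c : chart R X) (c' : chart R Y) (x : X) : Prop :=
  exists W g, @local_rep R X Y f c c' x W g.

Definition valid_chart (R : realType) (X : Type) (c : chart R X) : Prop :=
  set_inj (cdom c) (cmap c) /\ open (cmap c @` cdom c).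

Definition compatible_charts (R : realType) (X : Type) (c c' : chart R X) : Prop :=
  forall x, cdom c x -> cdom c' x ->
    smooth_in_charts id c c' x /\ smooth_in_charts id c' c x.

(* The charts of the maximal atlas. *)
Definition smooth_chart (R : realType) (X : mfd R) (c : chart R X) : Prop :=
  valid_chart c /\ forall c', atlas c' -> compatible_charts c c'.

Definition mfd_open (R : realType) (X : mfd R) (O : set X) : Prop :=
  forall c : chart R X, atlas c -> open (cmap c @` (cdom c `&` O)).

Record is_mfd (R : realType) (X : mfd R) : Prop := IsMfd {
  mfd_cover : forall x : X, exists2 c : chart R X, atlas c & cdom c x;
  mfd_charts : forall c : chart R X, atlas c -> smooth_chart c;
  mfd_hausdorff : forall x y : X, x <> y -> exists O O' : set X,
    [/\ mfd_open O, mfd_open O', O x, O' y & O `&` O' = set0];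
  mfd_second_countable : exists U : nat -> set X,
    (forall i, mfd_open (U i)) /\
    (forall (O : set X) x, mfd_open O -> O x -> exists2 i, U i x & U i `<=` O)
}.

Definition smooth (R : realType) (X Y : mfd R) (f : X -> Y) : Prop :=
  forall x, exists c c', [/\ atlas c, atlas c' & smooth_in_charts f c c' x].

Definition diffeo (R : realType) (X Y : mfd R) (f : X -> Y) : Prop :=
  smooth f /\ exists g : Y -> X, [/\ cancel f g, cancel g f & smooth g].

(* T_x f maps u to w, where tangent vectors at x and at f x are given by their
   components in the charts c and c'. *)
Definition tangent_map (R : realType) (X Y : Type) (f : X -> Y)
    (c : chart R X) (c' : chart R Y) (x : X)
    (u : 'rV[R]_(cdim c)) (w : 'rV[R]_(cdim c')) : Prop :=
  exists W g, @local_rep R X Y f c c' x W g /\ 'D_u g (cmap c x) = w.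

(** * Vector bundles *)

Record vb (R : realType) (E M : mfd R) := VB {
  vproj : E -> M;
  vzero : M -> E;
  vadd : E -> E -> E;
  vscale : R -> E -> E
}.

(* The chart e |-> (c (vproj e), tau e) of the total space. *)
Definition vb_chart (R : realType) (E M : Type) (q : E -> M) (c : chart R M)
    (k : nat) (tau : E -> 'rV[R]_k) : chart R E :=
  @Chart R E (cdim c + k) [set e | cdom c (q e)]
    (fun e => row_mx (cmap c (q e)) (tau e)).

(* e |-> (vproj e, tau e) is a local trivialisation over the domain of c: it is a
   diffeomorphism onto (cdom c) x R^k which is a linear isomorphism on each
   fibre.  The diffeomorphism condition is stated on the chart it induces. *)
Record is_triv (R : realType) (E M : mfd R) (v : vb E M) (c : chart R M)
    (k : nat) (tau : E -> 'rV[R]_k) : Prop := IsTriv {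
  triv_base : smooth_chart c;
  triv_add : forall e e', cdom c (vproj v e) -> vproj v e = vproj v e' ->
    tau (vadd v e e') = tau e + tau e';
  triv_scale : forall t e, cdom c (vproj v e) ->
    tau (vscale v t e) = t *: tau e;
  triv_bij : forall m y, cdom c m -> exists! e, vproj v e = m /\ tau e = y;
  triv_chart : smooth_chart (vb_chart (vproj v) c tau)
}.

Record is_vb (R : realType) (E M : mfd R) (v : vb E M) : Prop := IsVB {
  vproj_smooth : smooth (vproj v);
  vproj_zero : forall m, vproj v (vzero v m) = m;
  vproj_add : forall e e', vproj v e = vproj v e' ->
    vproj v (vadd v e e') = vproj v e;
  vproj_scale : forall t e, vproj v (vscale v t e) = vproj v e;
  vadd_assoc : forall e e' e'', vproj v e = vproj v e' ->
    vproj v e = vproj v e'' ->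
    vadd v e (vadd v e' e'') = vadd v (vadd v e e') e'';
  vadd_comm : forall e e', vproj v e = vproj v e' -> vadd v e e' = vadd v e' e;
  vadd_zero : forall e, vadd v (vzero v (vproj v e)) e = e;
  vadd_opp : forall e, vadd v (vscale v (-1) e) e = vzero v (vproj v e);
  vscale_one : forall e, vscale v 1 e = e;
  vscale_scale : forall s t e, vscale v s (vscale v t e) = vscale v (s * t) e;
  vscale_addl : forall s t e,
    vscale v (s + t) e = vadd v (vscale v s e) (vscale v t e);
  vscale_addr : forall t e e', vproj v e = vproj v e' ->
    vscale v t (vadd v e e') = vadd v (vscale v t e) (vscale v t e');
  vb_locally_trivial : forall m, exists (c : chart R M) (k : nat)
    (tau : E -> 'rV[R]_k), cdom c m /\ is_triv v c tau
}.

(* f : E -> E' covers g : M -> M' and is linear on fibres. *)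
Record is_vb_morphism (R : realType) (E M E' M' : mfd R) (v : vb E M)
    (v' : vb E' M') (f : E -> E') (g : M -> M') : Prop := IsVBMorphism {
  vbm_smooth : smooth f;
  vbm_smooth_base : smooth g;
  vbm_proj : forall e, vproj v' (f e) = g (vproj v e);
  vbm_add : forall e e', vproj v e = vproj v e' ->
    f (vadd v e e') = vadd v' (f e) (f e');
  vbm_scale : forall t e, f (vscale v t e) = vscale v' t (f e)
}.

Definition is_vb_iso (R : realType) (E M E' M' : mfd R) (v : vb E M)
    (v' : vb E' M') (f : E -> E') (g : M -> M') : Prop :=
  [/\ is_vb_morphism v v' f g, diffeo f & diffeo g].

(** * Dual vector bundles *)

(* A linear functional on the fibre over m, extended by 0 to the other fibres. *)
Definition is_functional (R : realType) (E M : mfd R) (v : vb E M)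
    (m : M) (phi : E -> R) : Prop :=
  [/\ forall e e', vproj v e = m -> vproj v e' = m ->
        phi (vadd v e e') = phi e + phi e',
      forall t e, vproj v e = m -> phi (vscale v t e) = t * phi e &
      forall e, vproj v e <> m -> phi e = 0].

Record dual_pt (R : realType) (E M : mfd R) (v : vb E M) := DualPt {
  dbase : M;
  pairing : E -> R;
  pairing_functional : is_functional v dbase pairing
}.

Lemma zero_functional (R : realType) (E M : mfd R) (v : vb E M) (m : M) :
  is_functional v m (fun=> 0).
Proof. by split=> [e e' _ _|t e _|//]; rewrite ?addr0 ?mulr0. Qed.

(* rho is the coordinate map of the dual bundle dual to the trivialisation tau *)
Definition is_dual_coord (R : realType) (E M : mfd R) (v : vb E M)
    (c : chart R M) (k : nat) (tau : E -> 'rV[R]_k)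
    (rho : dual_pt v -> 'rV[R]_k) : Prop :=
  forall (eps : dual_pt v) e, cdom c (dbase eps) -> vproj v e = dbase eps ->
    pairing eps e = \sum_(i < k) rho eps ord0 i * tau e ord0 i.

Definition dual_mfd (R : realType) (E M : mfd R) (v : vb E M) : mfd R :=
  @Mfd R (dual_pt v) [set ch | exists (c : chart R M) (k : nat)
    (tau : E -> 'rV[R]_k) (rho : dual_pt v -> 'rV[R]_k),
    [/\ is_triv v c tau, is_dual_coord c tau rho &
        ch = vb_chart (@dbase R E M v) c rho]].

(* [the x0 P] is an element satisfying P, and x0 if there is none.  In each use
   below, the condition P characterises the intended element uniquely whenever
   the operation being defined is meaningful. *)
Definition the (T : Type) (x0 : T) (P : set T) : T :=
  @xget {classic T} x0 P.

Definition dual_zero (R : realType) (E M : mfd R) (v : vb E M) (m : M) :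
    dual_pt v := DualPt (zero_functional v m).

Definition dual_vb (R : realType) (E M : mfd R) (v : vb E M) :
    vb (dual_mfd v) M :=
  @VB R (dual_mfd v) M
    (@dbase R E M v)
    (dual_zero v)
    (fun eps eps' => the eps [set eta : dual_pt v | dbase eta = dbase eps /\
       forall e, vproj v e = dbase eps ->
         pairing eta e = pairing eps e + pairing eps' e])
    (fun t eps => the eps [set eta : dual_pt v | dbase eta = dbase eps /\
       forall e, vproj v e = dbase eps -> pairing eta e = t * pairing eps e]).

(* The canonical identification of E with its double dual, by evaluation. *)
Definition bidual (R : realType) (E M : mfd R) (v : vb E M) (e : E) :
    dual_mfd (dual_vb v) :=
  the (dual_zero (dual_vb v) (vproj v e))
    [set xi : dual_pt (dual_vb v) | dbase xi = vproj v e /\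
       forall eps : dual_pt v, dbase eps = vproj v e ->
         pairing xi eps = pairing eps e].

(** * Double vector bundles *)

(*        D ----> B
          |       |
          v       v
          A ----> M      with core C, included in D by [core]. *)
Record dvb (R : realType) := DVB {
  dM : mfd R; dA : mfd R; dB : mfd R; dC : mfd R; dD : mfd R;
  bA : vb dA dM;
  bB : vb dB dM;
  bC : vb dC dM;
  tA : vb dD dA;
  tB : vb dD dB;
  core : dC -> dD
}.

Definition flip (R : realType) (D : dvb R) : dvb R :=
  DVB (bB D) (bA D) (bC D) (tB D) (tA D) (@core R D).

(* The structure maps of D -> A are vector bundle morphisms with respect to the
   structures over B.  For the addition, a map from D x_A D -> B x_M B to D -> B,
   the conditions are spelled out; its smoothness follows from the local
   triviality of D -> A. *)
Record is_half_dvb (R : realType) (D : dvb R) : Prop := IsHalfDVB {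
  dvb_proj_mor : is_vb_morphism (tB D) (bA D) (vproj (tA D)) (vproj (bB D));
  dvb_zero_mor : is_vb_morphism (bA D) (tB D) (vzero (tA D)) (vzero (bB D));
  dvb_scale_mor : forall t,
    is_vb_morphism (tB D) (tB D) (vscale (tA D) t) (vscale (bB D) t);
  dvb_add_proj : forall d d', vproj (tA D) d = vproj (tA D) d' ->
    vproj (tB D) (vadd (tA D) d d') =
    vadd (bB D) (vproj (tB D) d) (vproj (tB D) d');
  dvb_add_add : forall d1 d2 d3 d4,
    vproj (tA D) d1 = vproj (tA D) d2 -> vproj (tA D) d3 = vproj (tA D) d4 ->
    vproj (tB D) d1 = vproj (tB D) d3 -> vproj (tB D) d2 = vproj (tB D) d4 ->
    vadd (tA D) (vadd (tB D) d1 d3) (vadd (tB D) d2 d4) =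
    vadd (tB D) (vadd (tA D) d1 d2) (vadd (tA D) d3 d4);
  dvb_add_scale : forall t d d', vproj (tA D) d = vproj (tA D) d' ->
    vadd (tA D) (vscale (tB D) t d) (vscale (tB D) t d') =
    vscale (tB D) t (vadd (tA D) d d')
}.

(* D -> A x_M B is a surjective submersion.  The tangent space of A x_M B at
   (a, b) is the fibre product of T_a A and T_b B over T_m M. *)
Definition dvb_surjective (R : realType) (D : dvb R) : Prop :=
  forall a b, vproj (bA D) a = vproj (bB D) b ->
    exists d, vproj (tA D) d = a /\ vproj (tB D) d = b.

Definition dvb_submersive (R : realType) (D : dvb R) : Prop :=
  forall (d : dD D) (cD : chart R (dD D)) (cA : chart R (dA D))
      (cB : chart R (dB D)) (cM : chart R (dM D)),
    smooth_chart cD -> smooth_chart cA -> smooth_chart cB -> smooth_chart cM ->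
    let a := vproj (tA D) d in let b := vproj (tB D) d in
    cdom cD d -> cdom cA a -> cdom cB b -> cdom cM (vproj (bA D) a) ->
    forall u w z,
      @tangent_map R _ _ (vproj (bA D)) cA cM a u z ->
      @tangent_map R _ _ (vproj (bB D)) cB cM b w z ->
      exists s, @tangent_map R _ _ (vproj (tA D)) cD cA d s u /\
                @tangent_map R _ _ (vproj (tB D)) cD cB d s w.

(* [core] identifies C with the set of elements of D which project to zeros in A
   and in B, with the vector bundle structure given by the (coinciding)
   operations of D.  The smooth structure of C is then that of the submanifold
   core(C) of D, since a smooth bijective morphism of vector bundles over the
   identity is an isomorphism. *)
Record is_core (R : realType) (D : dvb R) : Prop := IsCore {
  core_smooth : smooth (@core R D);
  core_inj : injective (@core R D);
  core_projA : forall c,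
    vproj (tA D) (core c) = vzero (bA D) (vproj (bC D) c);
  core_projB : forall c,
    vproj (tB D) (core c) = vzero (bB D) (vproj (bC D) c);
  core_onto : forall d m, vproj (tA D) d = vzero (bA D) m ->
    vproj (tB D) d = vzero (bB D) m -> exists c, core c = d;
  core_addA : forall c c', vproj (bC D) c = vproj (bC D) c' ->
    core (vadd (bC D) c c') = vadd (tA D) (core c) (core c');
  core_addB : forall c c', vproj (bC D) c = vproj (bC D) c' ->
    core (vadd (bC D) c c') = vadd (tB D) (core c) (core c');
  core_scaleA : forall t c,
    core (vscale (bC D) t c) = vscale (tA D) t (core c);
  core_scaleB : forall t c,
    core (vscale (bC D) t c) = vscale (tB D) t (core c)
}.

Record is_dvb (R : realType) (D : dvb R) : Prop := IsDVB {
  dvb_mfdM : is_mfd (dM D);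
  dvb_mfdA : is_mfd (dA D);
  dvb_mfdB : is_mfd (dB D);
  dvb_mfdC : is_mfd (dC D);
  dvb_mfdD : is_mfd (dD D);
  dvb_bA : is_vb (bA D);
  dvb_bB : is_vb (bB D);
  dvb_bC : is_vb (bC D);
  dvb_tA : is_vb (tA D);
  dvb_tB : is_vb (tB D);
  dvb_halfA : is_half_dvb D;
  dvb_halfB : is_half_dvb (flip D);
  dvb_surj : dvb_surjective D;
  dvb_subm : dvb_submersive D;
  dvb_core : is_core D
}.

Record is_dvb_iso (R : realType) (D D' : dvb R) (f : dD D -> dD D')
    (fA : dA D -> dA D') (fB : dB D -> dB D') (fM : dM D -> dM D') : Prop :=
  IsDVBIso {
  iso_tA : is_vb_iso (tA D) (tA D') f fA;
  iso_tB : is_vb_iso (tB D) (tB D') f fB;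
  iso_bA : is_vb_iso (bA D) (bA D') fA fM;
  iso_bB : is_vb_iso (bB D) (bB D') fB fM
}.

(** * Duals of double vector bundles *)

Section DualA.
Context (R : realType) (D : dvb R).

Let q (a : dA D) : dM D := vproj (bA D) a.

Definition dualA_proj (Phi : dual_mfd (tA D)) : dual_mfd (bC D) :=
  the (dual_zero (bC D) (q (dbase Phi)))
    [set kappa : dual_pt (bC D) | dbase kappa = q (dbase Phi) /\
       forall c, vproj (bC D) c = q (dbase Phi) ->
         pairing kappa c =
         pairing Phi (vadd (tB D) (vzero (tA D) (dbase Phi)) (core c))].

Definition dualA_zero (kappa : dual_mfd (bC D)) : dual_mfd (tA D) :=
  the (dual_zero (tA D) (vzero (bA D) (dbase kappa)))
    [set Phi : dual_pt (tA D) | dbase Phi = vzero (bA D) (dbase kappa) /\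
       forall b c, vproj (bB D) b = dbase kappa -> vproj (bC D) c = dbase kappa ->
         pairing Phi (vadd (tA D) (vzero (tB D) b) (core c)) = pairing kappa c].

Definition dualA_add (Phi Phi' : dual_mfd (tA D)) : dual_mfd (tA D) :=
  the Phi
    [set Phi2 : dual_pt (tA D) |
      [/\ dbase Phi2 = vadd (bA D) (dbase Phi) (dbase Phi'),
          dualA_proj Phi2 = dualA_proj Phi &
          forall d d', vproj (tA D) d = dbase Phi ->
            vproj (tA D) d' = dbase Phi' -> vproj (tB D) d = vproj (tB D) d' ->
            pairing Phi2 (vadd (tB D) d d') = pairing Phi d + pairing Phi' d']].

(* For t = 0 the last condition alone does not determine the element, whence the
   explicit requirement that it lie over the same kappa. *)
Definition dualA_scale (t : R) (Phi : dual_mfd (tA D)) : dual_mfd (tA D) :=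
  the Phi
    [set Phi2 : dual_pt (tA D) |
      [/\ dbase Phi2 = vscale (bA D) t (dbase Phi),
          dualA_proj Phi2 = dualA_proj Phi &
          forall d, vproj (tA D) d = dbase Phi ->
            pairing Phi2 (vscale (tB D) t d) = t * pairing Phi d]].

Definition dualA_core (beta : dual_mfd (bB D)) : dual_mfd (tA D) :=
  the (dual_zero (tA D) (vzero (bA D) (dbase beta)))
    [set Phi : dual_pt (tA D) | dbase Phi = vzero (bA D) (dbase beta) /\
       forall b c, vproj (bB D) b = dbase beta -> vproj (bC D) c = dbase beta ->
         pairing Phi (vadd (tA D) (vzero (tB D) b) (core c)) = pairing beta b].

(* D^{*A}: sides A and C^*, core B^*. *)
Definition dualA : dvb R :=
  @DVB R (dM D) (dA D) (dual_mfd (bC D)) (dual_mfd (bB D)) (dual_mfd (tA D))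
    (bA D) (dual_vb (bC D)) (dual_vb (bB D)) (dual_vb (tA D))
    (@VB R (dual_mfd (tA D)) (dual_mfd (bC D))
       dualA_proj dualA_zero dualA_add dualA_scale)
    dualA_core.

End DualA.

(* D^{*B}, with sides listed as C^* and B; its core is A^*. *)
Definition dualB (R : realType) (D : dvb R) : dvb R := flip (dualA (flip D)).

(* (D^{*B})^{*C^*}, with sides listed as (A^* )^* and C^*; its core is B^*. *)
Definition dualBC (R : realType) (D : dvb R) : dvb R := flip (dualA (dualB D)).

(* All three pairings <calB, Psi>_{C^*}, <Phi, d>_A and <Psi, d>_B are defined. *)
Definition compatible (R : realType) (D : dvb R) (calB : dD (dualBC D))
    (Phi : dD (dualA D)) (Psi : dD (dualB D)) (d : dD D) : Prop :=
  [/\ vproj (tA (dualB D)) Psi = vproj (tB (dualBC D)) calB,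
      vproj (tA D) d = vproj (tA (dualA D)) Phi &
      vproj (tB D) d = vproj (tB (dualB D)) Psi].

(* Phi lies over the same point of M as calB and satisfies the equation. *)
Definition reversal_graph (R : realType) (D : dvb R) (calB : dD (dualBC D))
    (Phi : dD (dualA D)) : Prop :=
  vproj (bA D) (vproj (tA (dualA D)) Phi) =
    vproj (bB (dualBC D)) (vproj (tB (dualBC D)) calB) /\
  forall (Psi : dD (dualB D)) (d : dD D), compatible calB Phi Psi d ->
    pairing calB Psi + pairing Phi d = pairing Psi d.

(* Main.v *)
(* Locally over M the double vector bundle D splits: besides fibre coordinates al, be, ga of
   A, B, C there is a map de from D to R^r which extends ga from the core and is linear on the
   fibres of both D -> A and D -> B.  To find it, take a frame b_i of B.  Over b_i the
   surjective linear map D_b -> A has a smooth right inverse, which gives elements h_i a of D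
   over (a, b_i), linear in a.  With the translates of the core, the h_i a span the fibre of
   D -> A over a, and de is the core component.

   A splitting of D induces one of D^{*A}, with de^ given by
   <Phi, d>_A = de^(Phi) . be(d) + kappa . de(d), where kappa is the projection of Phi to C^*;
   hence it induces splittings of D^{*B} and of its dual over C^*.  If an element of the latter
   has coordinates (kappa, t, s) and Phi has coordinates (a, kappa', phi), the equation reads
   (s . y + t . w) + (phi . y + kappa' . z) = w . al(a) + kappa . z for all w, y, z, so
   al(a) = t, kappa' = kappa and phi = - s.  Thus Phi exists and is unique, and the reversal
   map is linear in smooth charts. *)
Require Import Defs.
From mathcomp Require Import all_boot all_order all_algebra.
From mathcomp Require Import boolp classical_sets functions reals topology normedtype.
From mathcomp Require Import landau derive.
Set Implicit Arguments.
Unset Strict Implicit.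
Unset Printing Implicit Defensive.
Import Order.TTheory GRing.Theory Num.Theory.
Import numFieldNormedType.Exports.
Local Open Scope classical_set_scope.
Local Open Scope ring_scope.

(** * Smooth functions on open subsets of R^n *)

(** Splittings are needed for D, for D^{*B} and for the dual of the latter over C^*. What is carried
    from one bundle to the next is not [is_dvb] but the pair [dvb_laws], [locally_split]: both pass
    to [flip D] and to [dualA D], and once they are known for D the rest is derived from them alone.
    Splittings also give access to the operations of the duals, which are selected by [the]: it is
    in coordinates that the elements they describe are seen to exist.

    The analytic difficulty is that fibre coordinates found by linear algebra must be shown to give
    charts of the maximal atlas. This rests on two facts: the matrix of a smooth bundle morphism is
    smooth, because it can be read off near the zero section ([vbm_matrix]), and matrix inversion is
    smooth. The charts of a total space that come from its two projections differ by a permutation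
    of coordinate blocks, so smoothness has to be proved over one side only. *)

Lemma near_eq_differentiable (K : realFieldType) (V W : normedModType K)
    (f g : V -> W) (x : V) :
  {near x, f =1 g} -> differentiable f x -> differentiable g x.
Proof.
move=> fg df.
(* g inherits the first-order expansion of f at x, so [diff_unique] identifies its differential with
   that of f. *)
have H : g \o shift x = cst (g x) + 'd f x +o_ 0 id.
  apply/eqaddoP => e e0.
  have /eqaddoP/(_ e e0) := diff_locally df.
  have : \forall y \near (0 : V), f (y + x) = g (y + x).
    have : \forall y \near x, f y = g y by [].
    by rewrite (near_shift 0) /= subr0.
  apply: filterS2 => y fgy; rewrite /= !fctE /= fgy.
  by rewrite (nbhs_singleton fg).
have cf : continuous ('d f x) by exact: diff_continuous.
by apply/diff_locallyP; rewrite (diff_unique cf H).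
Qed.

Section SmoothFunctions.
Context (R : realType).

(** Scalar counterpart of [Ck]: products, quotients and determinants are treated for real functions,
    and [Ck_coordP] carries the results over to rows. *)
Fixpoint Cks (n k : nat) (W : set 'rV[R]_n) (f : 'rV[R]_n -> R) : Prop :=
  match k with
  | 0 => forall x, W x -> {for x, continuous f}
  | k'.+1 => (forall x, W x -> differentiable f x) /\
             (forall v, Cks k' W (fun x => 'D_v f x))
  end.

Definition csmooth (n : nat) (W : set 'rV[R]_n) (f : 'rV[R]_n -> R) : Prop :=
  forall k, Cks k W f.

Lemma rV_sum_delta (T : Type) (p : nat) (f : T -> 'rV[R]_p) :
  f = \sum_(j < p) (fun x => f x ord0 j *: (delta_mx ord0 j : 'rV[R]_p)).
Proof. by apply/funext => x; rewrite fct_sumE [LHS]row_sum_delta. Qed.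

Lemma continuous_coordP (V : normedModType R) (p : nat) (f : V -> 'rV[R]_p) x :
  {for x, continuous f} <-> forall j, {for x, continuous (fun x => f x ord0 j)}.
Proof.
split=> [cf j|cf].
  exact: (continuous_comp cf (@coord_continuous _ _ _ _ _ _)).
rewrite (rV_sum_delta f).
elim/big_ind: _ => [|g h cg ch|j _]; first exact: cst_continuous.
- exact: continuousD.
- by apply: (@continuousZr_tmp R _ V (fun x => f x ord0 j) (delta_mx ord0 j)); exact: cf.
Qed.

Lemma differentiable_coordP (n p : nat) (f : 'rV[R]_n -> 'rV[R]_p) x :
  differentiable f x <-> forall j, differentiable (fun x => f x ord0 j) x.
Proof.
split=> [df j|df].
  exact: (differentiable_comp df (differentiable_coord _ _ _)).
rewrite (rV_sum_delta f); apply: differentiable_sum => j.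
exact: differentiableZl.
Qed.

Lemma derive_coord (n p : nat) (f : 'rV[R]_n -> 'rV[R]_p) x v j :
  differentiable f x -> 'D_v f x ord0 j = 'D_v (fun x => f x ord0 j) x.
Proof.
by move=> df; rewrite derive_mx ?mxE //; apply: diff_derivable.
Qed.

(** As W is open, equality on W is equality near each of its points, which is what derivatives
    depend on. *)
Lemma Cks_ext n k (W : set 'rV[R]_n) f g : open W ->
  (forall x, W x -> f x = g x) -> Cks k W f -> Cks k W g.
Proof.
move=> oW; elim: k f g => [|k IH] f g fg /= => [cf|[df Df]].
  move=> x Wx; have nfg : {near x, f =1 g}.
    by apply: filterS (open_nbhs_nbhs (conj oW Wx)) => y /fg ->.
  by rewrite /prop_for /continuous_at -fg //; exact: (cvg_trans (near_eq_cvg nfg) (cf x Wx)).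
have nfg x : W x -> {near x, f =1 g}.
  by move=> Wx; apply: filterS (open_nbhs_nbhs (conj oW Wx)) => y /fg.
split=> [x Wx|v].
  exact: (near_eq_differentiable (nfg x Wx) (df x Wx)).
by apply: IH (Df v) => x Wx; apply: near_eq_derive; exact: nfg.
Qed.

Lemma Cks_S n k (W : set 'rV[R]_n) f : Cks k.+1 W f -> Cks k W f.
Proof.
elim: k f => [|k IH] f [df Df].
  by move=> x Wx; apply: differentiable_continuous; exact: df.
by split=> // v; apply: IH; exact: Df.
Qed.

Lemma Cks_subset n k (W W' : set 'rV[R]_n) f : W' `<=` W -> Cks k W f -> Cks k W' f.
Proof.
move=> sW; elim: k f => [|k IH] f /= => [cf x /sW|[df Df]]; first exact: cf.
by split=> [x /sW|v]; [exact: df|apply: IH; exact: Df].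
Qed.

Lemma Cks_cst n k (W : set 'rV[R]_n) a : Cks k W (fun=> a).
Proof.
elim: k a => [|k IH] a /=; first by move=> x _; exact: cst_continuous.
split=> [x _|v]; first exact: differentiable_cst.
have -> : (fun x => 'D_v (fun=> a : R) x) = fun=> 0 by apply/funext => x; rewrite derive_cst.
exact: IH.
Qed.

Lemma Cks_coord n k (W : set 'rV[R]_n) (j : 'I_n) : Cks k W (fun x => x ord0 j).
Proof.
case: k => [|k] /=; first by move=> x _; exact: coord_continuous.
split=> [x _|v]; first exact: differentiable_coord.
have -> : (fun x => 'D_v (fun x : 'rV[R]_n => x ord0 j) x) = fun=> v ord0 j.
  apply/funext => x; rewrite -(@derive_coord _ _ id x v j); first by rewrite derive_id.
  exact: ex_diff.
exact: Cks_cst.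
Qed.

Lemma CksD n k (W : set 'rV[R]_n) f g : open W ->
  Cks k W f -> Cks k W g -> Cks k W (fun x => f x + g x).
Proof.
move=> oW; elim: k f g => [|k IH] f g /= => [cf cg x Wx|[df Df] [dg Dg]].
  by apply: continuousD; [exact: cf|exact: cg].
split=> [x Wx|v]; first by apply: differentiableD; [exact: df|exact: dg].
apply: (Cks_ext (f := fun x => 'D_v f x + 'D_v g x) oW) => [x Wx|].
  by rewrite -deriveD //; apply: diff_derivable; [exact: df|exact: dg].
by apply: IH; [exact: Df|exact: Dg].
Qed.

Lemma CksM n k (W : set 'rV[R]_n) f g : open W ->
  Cks k W f -> Cks k W g -> Cks k W (fun x => f x * g x).
Proof.
move=> oW; elim: k f g => [|k IH] f g => [cf cg x Wx|Cf Cg].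
  by apply: continuousM; [exact: cf|exact: cg].
have [df Df] := Cf; have [dg Dg] := Cg.
split=> [x Wx|v]; first by apply: differentiableM; [exact: df|exact: dg].
apply: (Cks_ext (f := fun x => f x * 'D_v g x + g x * 'D_v f x) oW) => [x Wx|].
  by rewrite deriveM //; apply: diff_derivable; [exact: df|exact: dg].
by apply: CksD => //; apply: IH; [exact: Cks_S Cf|exact: Dg|exact: Cks_S Cg|exact: Df].
Qed.

Lemma Cks_sum n k (W : set 'rV[R]_n) (I : Type) (r : seq I) (P : pred I)
    (f : I -> 'rV[R]_n -> R) : open W ->
  (forall i, P i -> Cks k W (f i)) -> Cks k W (fun x => \sum_(i <- r | P i) f i x).
Proof.
move=> oW Cf; elim: r => [|i r IH].
  by apply: (Cks_ext (f := fun=> 0)) => // [x _|]; [rewrite big_nil|exact: Cks_cst].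
have [Pi|Pi] := boolP (P i).
  apply: (Cks_ext (f := fun x => f i x + \sum_(i <- r | P i) f i x)) => //.
    by move=> x _; rewrite big_cons Pi.
  by apply: CksD => //; exact: Cf.
by apply: (Cks_ext oW _ IH) => x _; rewrite big_cons (negbTE Pi).
Qed.

Lemma Cks_prod n k (W : set 'rV[R]_n) (I : Type) (r : seq I) (P : pred I)
    (f : I -> 'rV[R]_n -> R) : open W ->
  (forall i, P i -> Cks k W (f i)) -> Cks k W (fun x => \prod_(i <- r | P i) f i x).
Proof.
move=> oW Cf; elim: r => [|i r IH].
  by apply: (Cks_ext (f := fun=> 1)) => // [x _|]; [rewrite big_nil|exact: Cks_cst].
have [Pi|Pi] := boolP (P i).
  apply: (Cks_ext (f := fun x => f i x * \prod_(i <- r | P i) f i x)) => //.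
    by move=> x _; rewrite big_cons Pi.
  by apply: CksM => //; exact: Cf.
by apply: (Cks_ext oW _ IH) => x _; rewrite big_cons (negbTE Pi).
Qed.

(** The derivative of 1/f is a product of two factors 1/f, a constant and a derivative of f, so the
    induction on k closes on 1/f itself. *)
Lemma CksV n k (W : set 'rV[R]_n) f : open W -> (forall x, W x -> f x != 0) ->
  Cks k W f -> Cks k W (fun x => (f x)^-1).
Proof.
move=> oW f0; elim: k f f0 => [|k IH] f f0 => [cf x Wx|Cf].
  by apply: continuousV; [exact: f0|exact: cf].
have [df Df] := Cf; split=> [x Wx|v].
  by apply: differentiableV; [exact: df|exact: f0].
apply: (Cks_ext (f := fun x => (-1 * ((f x)^-1 * (f x)^-1)) * 'D_v f x) oW) => [x Wx|].
  rewrite (deriveV (f := f)) ?f0 //; last by apply: diff_derivable; exact: df.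
  by rewrite -invfM mulN1r expr2.
apply: CksM => //; last exact: Df.
apply: CksM => //; first exact: Cks_cst.
by apply: CksM => //; apply: IH => //; exact: Cks_S Cf.
Qed.

Lemma Cks_comp n p k (W : set 'rV[R]_n) (W' : set 'rV[R]_p)
    (f : 'rV[R]_n -> 'rV[R]_p) (g : 'rV[R]_p -> R) : open W ->
  (forall j, Cks k W (fun x => f x ord0 j)) -> (forall x, W x -> W' (f x)) ->
  Cks k W' g -> Cks k W (g \o f).
Proof.
move=> oW; elim: k f g => [|k IH] f g Cf fW Cg.
  move=> x Wx; apply: continuous_comp; last by apply: Cg; exact: fW.
  by apply/continuous_coordP => j; exact: Cf.
have [dg Dg] := Cg.
have df x : W x -> differentiable f x.
  by move=> Wx; apply/differentiable_coordP => j; exact: (Cf j).1.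
split=> [x Wx|v].
  by apply: differentiable_comp; [exact: df|apply: dg; exact: fW].
(* Chain rule along the standard basis: each summand is a derivative of a component of f times a
   partial derivative of g composed with f, and the induction hypothesis applies to the latter. *)
apply: (Cks_ext (f := fun x => \sum_(j < p) 'D_v (fun x => f x ord0 j) x *
    ('D_(delta_mx ord0 j) g \o f) x) oW) => [x Wx|].
  have dgx := dg _ (fW _ Wx); have dfx := df _ Wx.
  rewrite deriveE; last exact: differentiable_comp.
  rewrite diff_comp //= -(deriveE _ dfx) [in RHS](row_sum_delta ('D_v f x)) linear_sum.
  by apply: eq_bigr => j _; rewrite linearZ /= -(deriveE _ dgx) derive_coord.
apply: Cks_sum => // j _; apply: CksM => //; first exact: (Cf j).2.
by apply: IH => // [i|]; [exact: Cks_S|exact: Dg].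
Qed.

Lemma Ck_coordP n p k (W : set 'rV[R]_n) (f : 'rV[R]_n -> 'rV[R]_p) : open W ->
  Ck k W f <-> forall j, Cks k W (fun x => f x ord0 j).
Proof.
move=> oW; elim: k f => [|k IH] f /=.
  split=> [cf j x Wx|cf x Wx]; first by move: j; apply/continuous_coordP; exact: cf.
  by apply/continuous_coordP => j; exact: cf.
split=> [[df Df] j|Cf].
  split=> [x Wx|v]; first by move: j; apply/differentiable_coordP; exact: df.
  apply: (Cks_ext oW _ ((IH _).1 (Df v) j)) => x Wx.
  by rewrite derive_coord //; exact: df.
have df x : W x -> differentiable f x.
  by move=> Wx; apply/differentiable_coordP => j; exact: (Cf j).1.
split=> // v; apply/IH => j; apply: (Cks_ext oW _ ((Cf j).2 v)) => x Wx.
by rewrite derive_coord //; exact: df.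
Qed.

Lemma Cinfty_coordP n p (W : set 'rV[R]_n) (f : 'rV[R]_n -> 'rV[R]_p) : open W ->
  Cinfty W f <-> forall j, csmooth W (fun x => f x ord0 j).
Proof.
move=> oW; split=> [Cf j k|Cf k]; first by move: j; apply/(Ck_coordP _ _ oW); exact: Cf.
by apply/(Ck_coordP _ _ oW) => j; exact: Cf.
Qed.

Lemma Cinfty_continuous n p (W : set 'rV[R]_n) (f : 'rV[R]_n -> 'rV[R]_p) x :
  Cinfty W f -> W x -> {for x, continuous f}.
Proof. by move=> Cf Wx; exact: (Cf 0). Qed.

Lemma open_preimage n (p : topologicalType) (W : set 'rV[R]_n) (f : 'rV[R]_n -> p) (W' : set p) :
  open W -> (forall x, W x -> {for x, continuous f}) -> open W' ->
  open (W `&` f @^-1` W').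
Proof.
move=> oW cf oW'; rewrite openE => x [Wx W'x]; rewrite /interior /=.
apply: filterI; first exact: (open_nbhs_nbhs (conj oW Wx)).
by apply: (cf x Wx); exact: (open_nbhs_nbhs (conj oW' W'x)).
Qed.

Lemma Cinfty_comp n p q (W : set 'rV[R]_n) (W' : set 'rV[R]_p)
    (f : 'rV[R]_n -> 'rV[R]_p) (g : 'rV[R]_p -> 'rV[R]_q) : open W -> open W' ->
  Cinfty W f -> (forall x, W x -> W' (f x)) -> Cinfty W' g -> Cinfty W (g \o f).
Proof.
move=> oW oW' /(Cinfty_coordP _ oW) Cf fW /(Cinfty_coordP _ oW') Cg.
apply/(Cinfty_coordP _ oW) => j k.
apply: (Cks_comp (W' := W') (g := fun y => g y ord0 j)) => //; last exact: Cg.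
by move=> i; exact: Cf.
Qed.

Lemma Cinfty_subset n p (W W' : set 'rV[R]_n) (f : 'rV[R]_n -> 'rV[R]_p) :
  open W -> open W' -> W' `<=` W -> Cinfty W f -> Cinfty W' f.
Proof.
move=> oW oW' sW /(Cinfty_coordP _ oW) Cf; apply/(Cinfty_coordP _ oW') => j k.
exact: (Cks_subset sW (Cf j k)).
Qed.

(** * Matrix-valued smooth functions *)

Definition mxsmooth n p q (W : set 'rV[R]_n) (F : 'rV[R]_n -> 'M[R]_(p, q)) : Prop :=
  forall i j, csmooth W (fun x => F x i j).

Lemma mxsmooth_cst n p q (W : set 'rV[R]_n) (A : 'M[R]_(p, q)) :
  mxsmooth W (fun=> A).
Proof. by move=> i j k; exact: Cks_cst. Qed.

Lemma mxsmooth_subset n p q (W W' : set 'rV[R]_n) (F : 'rV[R]_n -> 'M[R]_(p, q)) :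
  W' `<=` W -> mxsmooth W F -> mxsmooth W' F.
Proof. by move=> sW sF i j k; exact: (Cks_subset sW (sF i j k)). Qed.

Lemma mxsmooth_mul n p q r (W : set 'rV[R]_n) (F : 'rV[R]_n -> 'M[R]_(p, q))
    (G : 'rV[R]_n -> 'M[R]_(q, r)) : open W ->
  mxsmooth W F -> mxsmooth W G -> mxsmooth W (fun x => F x *m G x).
Proof.
move=> oW sF sG i j k.
apply: (Cks_ext (f := fun x => \sum_l F x i l * G x l j)) => // [x _|].
  by rewrite mxE.
apply: Cks_sum => // l _; apply: CksM => //; [exact: sF|exact: sG].
Qed.

Lemma csmooth_det n p (W : set 'rV[R]_n) (F : 'rV[R]_n -> 'M[R]_p) : open W ->
  mxsmooth W F -> csmooth W (fun x => \det (F x)).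
Proof.
move=> oW sF k; apply: Cks_sum => // s _; apply: CksM => //; first exact: Cks_cst.
by apply: Cks_prod => // i _; exact: sF.
Qed.

(** By Cramer's rule the entries of the inverse are cofactors divided by the determinant. *)
Lemma mxsmooth_inv n p (W : set 'rV[R]_n) (F : 'rV[R]_n -> 'M[R]_p) : open W ->
  (forall x, W x -> F x \in unitmx) -> mxsmooth W F ->
  mxsmooth W (fun x => invmx (F x)).
Proof.
move=> oW uF sF i j k.
apply: (Cks_ext (f := fun x => (\det (F x))^-1 * cofactor (F x) j i)) => // [x Wx|].
  by rewrite /invmx uF // !mxE.
apply: CksM => //.
  apply: CksV => // [x Wx|]; last exact: csmooth_det.
  by have := uF x Wx; rewrite unitmxE unitfE.
apply: CksM => //; first exact: Cks_cst.
apply: csmooth_det => // i' j' k'.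
apply: (Cks_ext (f := fun x => F x (lift j i') (lift i j'))) => // [x Wx|].
  by rewrite !mxE.
exact: sF.
Qed.

Lemma csmooth_continuous n (W : set 'rV[R]_n) (f : 'rV[R]_n -> R) x :
  csmooth W f -> W x -> {for x, continuous f}.
Proof. by move=> Cf Wx; exact: (Cf 0). Qed.

End SmoothFunctions.

(** * Closure properties of smooth row-valued maps *)

Section SmoothClosure.
Context (R : realType).
Implicit Types n p q : nat.

Lemma Cinfty_mxsmooth n p (W : set 'rV[R]_n) (f : 'rV[R]_n -> 'rV[R]_p) : open W ->
  Cinfty W f <-> mxsmooth W f.
Proof.
move=> oW; rewrite Cinfty_coordP //; split=> [sf i j|sf j]; last exact: sf.
by rewrite (ord1 i); exact: sf.
Qed.

Lemma mxsmooth_comp n p q r (W : set 'rV[R]_n) (W' : set 'rV[R]_r)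
    (f : 'rV[R]_n -> 'rV[R]_r) (F : 'rV[R]_r -> 'M[R]_(p, q)) : open W ->
  Cinfty W f -> (forall x, W x -> W' (f x)) -> mxsmooth W' F -> mxsmooth W (F \o f).
Proof.
move=> oW /(Cinfty_coordP _ oW) sf fW sF i j k.
apply: (Cks_comp (g := fun y => F y i j) oW _ fW); last exact: sF.
by move=> l; exact: sf.
Qed.

Lemma mxsmooth_tr n p q (W : set 'rV[R]_n) (F : 'rV[R]_n -> 'M[R]_(p, q)) : open W ->
  mxsmooth W F -> mxsmooth W (fun x => (F x)^T).
Proof.
move=> oW sF i j k; apply: (Cks_ext (f := fun x => F x j i)) => // [x _|].
  by rewrite mxE.
exact: sF.
Qed.

Lemma Cinfty_cst n p (W : set 'rV[R]_n) (a : 'rV[R]_p) : open W -> Cinfty W (fun=> a).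
Proof. by move=> oW; apply/(Cinfty_mxsmooth _ oW); exact: mxsmooth_cst. Qed.

Lemma Cinfty_id n (W : set 'rV[R]_n) : open W -> Cinfty W (fun x => x).
Proof. by move=> oW; apply/(Cinfty_coordP _ oW) => j k; exact: Cks_coord. Qed.

Lemma Cinfty_row n p q (W : set 'rV[R]_n) (f : 'rV[R]_n -> 'rV[R]_p)
    (g : 'rV[R]_n -> 'rV[R]_q) : open W ->
  Cinfty W f -> Cinfty W g -> Cinfty W (fun x => row_mx (f x) (g x)).
Proof.
move=> oW /(Cinfty_coordP _ oW) sf /(Cinfty_coordP _ oW) sg.
apply/(Cinfty_coordP _ oW) => j k; case: (split_ordP j) => i ->.
  by apply: (Cks_ext (f := fun x => f x ord0 i)) => // [x _|]; rewrite ?row_mxEl //; exact: sf.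
by apply: (Cks_ext (f := fun x => g x ord0 i)) => // [x _|]; rewrite ?row_mxEr //; exact: sg.
Qed.

Lemma Cinfty_lsub n p q (W : set 'rV[R]_n) (f : 'rV[R]_n -> 'rV[R]_(p + q)) : open W ->
  Cinfty W f -> Cinfty W (fun x => lsubmx (f x)).
Proof.
move=> oW /(Cinfty_coordP _ oW) sf; apply/(Cinfty_coordP _ oW) => j k.
by apply: (Cks_ext (f := fun x => f x ord0 (lshift q j))) => // [x _|]; rewrite ?mxE //; exact: sf.
Qed.

Lemma Cinfty_rsub n p q (W : set 'rV[R]_n) (f : 'rV[R]_n -> 'rV[R]_(p + q)) : open W ->
  Cinfty W f -> Cinfty W (fun x => rsubmx (f x)).
Proof.
move=> oW /(Cinfty_coordP _ oW) sf; apply/(Cinfty_coordP _ oW) => j k.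
by apply: (Cks_ext (f := fun x => f x ord0 (rshift p j))) => // [x _|]; rewrite ?mxE //; exact: sf.
Qed.

Lemma Cinfty_mulmx n p q (W : set 'rV[R]_n) (f : 'rV[R]_n -> 'rV[R]_p)
    (F : 'rV[R]_n -> 'M[R]_(p, q)) : open W ->
  Cinfty W f -> mxsmooth W F -> Cinfty W (fun x => f x *m F x).
Proof.
move=> oW /(Cinfty_mxsmooth _ oW) sf sF; apply/(Cinfty_mxsmooth _ oW).
exact: mxsmooth_mul.
Qed.

Lemma CinftyD n p (W : set 'rV[R]_n) (f g : 'rV[R]_n -> 'rV[R]_p) : open W ->
  Cinfty W f -> Cinfty W g -> Cinfty W (fun x => f x + g x).
Proof.
move=> oW /(Cinfty_coordP _ oW) sf /(Cinfty_coordP _ oW) sg.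
apply/(Cinfty_coordP _ oW) => j k.
apply: (Cks_ext (f := fun x => f x ord0 j + g x ord0 j)) => // [x _|]; first by rewrite mxE.
by apply: CksD => //; [exact: sf|exact: sg].
Qed.

Lemma CinftyN n p (W : set 'rV[R]_n) (f : 'rV[R]_n -> 'rV[R]_p) : open W ->
  Cinfty W f -> Cinfty W (fun x => - f x).
Proof.
move=> oW /(Cinfty_coordP _ oW) sf; apply/(Cinfty_coordP _ oW) => j k.
apply: (Cks_ext (f := fun x => -1 * f x ord0 j)) => // [x _|]; first by rewrite mxE mulN1r.
by apply: CksM => //; [exact: Cks_cst|exact: sf].
Qed.

End SmoothClosure.

(** * Charts *)

Section Charts.
Context (R : realType).

Lemma sic_dom (X Y : Type) (f : X -> Y) (c : chart R X) (c' : chart R Y) x :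
  smooth_in_charts f c c' x -> cdom c x /\ cdom c' (f x).
Proof. by move=> [W [g [cx [oW Wx] _ _ gP]]]; split=> //; have [] := gP x cx Wx. Qed.

Lemma sic_open (X Y : Type) (f : X -> Y) (c : chart R X) (c' : chart R Y) x :
  smooth_in_charts f c c' x -> exists W : set 'rV[R]_(cdim c),
    [/\ open W, W (cmap c x), W `<=` cmap c @` cdom c &
        forall y, cdom c y -> W (cmap c y) -> cdom c' (f y)].
Proof.
move=> [W [g [cx [oW Wx] sW _ gP]]]; exists W; split=> // y cy Wy.
by have [] := gP y cy Wy.
Qed.

Lemma sic_comp (X Y Z : Type) (f : X -> Y) (h : Y -> Z) (c1 : chart R X)
    (c2 : chart R Y) (c3 : chart R Z) x :
  smooth_in_charts f c1 c2 x -> smooth_in_charts h c2 c3 (f x) ->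
  smooth_in_charts (h \o f) c1 c3 x.
Proof.
move=> [W [g [cx [oW Wx] sW Cg gP]]] [W' [g' [cx' [oW' Wx'] sW' Cg' gP']]].
have oW2 : open (W `&` g @^-1` W').
  by apply: open_preimage => // y Wy; exact: (Cinfty_continuous Cg).
exists (W `&` g @^-1` W'), (g' \o g); split=> //.
- by split=> //; split=> //=; have [_ <-] := gP x cx Wx.
- by move=> y [Wy _]; exact: sW.
- apply: (Cinfty_comp oW2 oW' _ _ Cg') => [|y []//].
  by apply: Cinfty_subset Cg => // y [].
- move=> y cy [Wy W'y]; have [cfy efy] := gP y cy Wy.
  by have [] := gP' (f y) cfy; rewrite efy //= => ? ->.
Qed.

Lemma sic_ext (X Y : Type) (f f' : X -> Y) (c : chart R X) (c' : chart R Y) x :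
  (forall y, cdom c y -> f y = f' y) ->
  smooth_in_charts f c c' x -> smooth_in_charts f' c c' x.
Proof.
move=> ff' [W [g [cx oW sW Cg gP]]]; exists W, g; split=> // y cy Wy.
by rewrite -ff' //; exact: gP.
Qed.

Lemma sic_of (X Y : Type) (f : X -> Y) (c : chart R X) (c' : chart R Y) g x :
  open (cmap c @` cdom c) -> cdom c x -> Cinfty (cmap c @` cdom c) g ->
  (forall y, cdom c y -> cdom c' (f y) /\ cmap c' (f y) = g (cmap c y)) ->
  smooth_in_charts f c c' x.
Proof.
move=> oc cx Cg gP; by exists (cmap c @` cdom c), g; split=> // y cy _; exact: gP.
Qed.

(** The part of [is_mfd] on which the comparison of charts rests; total spaces of duals inherit it
    ([covered_dual]). *)
Definition covered (X : mfd R) : Prop :=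
  forall x : X, exists2 c : chart R X, atlas c & cdom c x.

(** [smooth_chart] only asserts compatibility with charts of the atlas, so two charts of the maximal
    atlas are compared through an atlas chart around the point. *)
Lemma sic_smooth_charts (X : mfd R) (c c' : chart R X) x : covered X ->
  smooth_chart c -> smooth_chart c' -> cdom c x -> cdom c' x ->
  smooth_in_charts id c c' x.
Proof.
move=> coX [_ sc] [_ sc'] cx cx'; have [c0 ac0 c0x] := coX x.
have [h _] := sc _ ac0 _ cx c0x; have [_ h'] := sc' _ ac0 _ cx' c0x.
exact: (sic_comp h h').
Qed.

(** Near each point one conveniently chosen smooth chart is enough for the comparison; transitivity
    extends it to the whole atlas. *)
Lemma smooth_chart_of (X : mfd R) (c : chart R X) : valid_chart c ->
  (forall x, cdom c x -> exists c1, [/\ smooth_chart c1, cdom c1 x,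
     smooth_in_charts id c c1 x & smooth_in_charts id c1 c x]) ->
  smooth_chart c.
Proof.
move=> vc H; split=> // c' ac' x cx cx'.
have [c1 [[_ sc1] c1x h1 h2]] := H x cx.
have [h3 h4] := sc1 _ ac' _ c1x cx'.
by split; [exact: (sic_comp h1 h3)|exact: (sic_comp h4 h2)].
Qed.

Lemma smooth_sic (X Y : mfd R) (f : X -> Y) (c : chart R X) (c' : chart R Y) x :
  smooth f -> smooth_chart c -> smooth_chart c' -> cdom c x -> cdom c' (f x) ->
  smooth_in_charts f c c' x.
Proof.
move=> sf [_ sc] [_ sc'] cx cx'; have [c0 [c0' [ac0 ac0' h]]] := sf x.
have [c0x c0x'] := sic_dom h.
have [h1 _] := sc _ ac0 _ cx c0x; have [_ h2] := sc' _ ac0' _ cx' c0x'.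
exact: (sic_comp (sic_comp h1 h) h2).
Qed.

Lemma smooth_of_sic (X Y : mfd R) (f : X -> Y) : covered X -> covered Y ->
  (forall x, exists c c', [/\ smooth_chart c, smooth_chart c' &
     smooth_in_charts f c c' x]) -> smooth f.
Proof.
move=> coX coY H x; have [c [c' [[_ sc] [_ sc'] h]]] := H x.
have [cx cx'] := sic_dom h.
have [c0 ac0 c0x] := coX x; have [c0' ac0' c0x'] := coY (f x).
have [_ h1] := sc _ ac0 _ cx c0x; have [h2 _] := sc' _ ac0' _ cx' c0x'.
exists c0, c0'; split=> //; exact: (sic_comp (sic_comp h1 h) h2).
Qed.

Definition chart_restr (X : Type) (c : chart R X) (O : set X) : chart R X :=
  Chart (cdom c `&` O) (@cmap _ _ c).

Lemma smooth_chart_restr (X : mfd R) (c : chart R X) (O : set X) :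
  smooth_chart c -> open (cmap c @` (cdom c `&` O)) ->
  smooth_chart (chart_restr c O).
Proof.
move=> sc oO; have [[ic oc] _] := sc.
apply: smooth_chart_of; first split=> //.
  by move=> x y; rewrite !inE => -[cx _] [cy _]; apply: ic; rewrite inE.
move=> x [cx Ox]; exists c; split=> //.
  exists (cmap c @` (cdom c `&` O)), id; split=> //; last by move=> y [].
    by split=> //; exists x.
  exact: Cinfty_id.
exists (cmap c @` (cdom c `&` O)), id; split=> //.
- by split=> //; exists x.
- by move=> _ [y [cy _] <-]; exists y.
- exact: Cinfty_id.
- move=> y cy [z [cz Oz] ezy]; split=> //; split=> //.
  by have <- : z = y by apply: ic; rewrite ?inE.
Qed.

Lemma smooth_chart_restr_pt (X : mfd R) (c : chart R X) (O : set X) :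
  smooth_chart c ->
  (forall x, cdom c x -> O x -> exists W, [/\ open W, W (cmap c x) &
     forall y, cdom c y -> W (cmap c y) -> O y]) ->
  smooth_chart (chart_restr c O).
Proof.
move=> sc HO; have [[ic oc] _] := sc.
apply: smooth_chart_restr => //; rewrite openE => _ [x [cx Ox] <-].
have [W [oW Wx WO]] := HO x cx Ox.
have := open_nbhs_nbhs (conj (openI oW oc) (conj Wx (ex_intro2 _ _ x cx erefl))).
by apply: filterS => z [Wz [y cy ey]]; exists y => //; split=> //; apply: WO; rewrite ?ey.
Qed.

Lemma smooth_chart_cap (X : mfd R) (c c' : chart R X) : covered X ->
  smooth_chart c -> smooth_chart c' -> smooth_chart (chart_restr c (cdom c')).
Proof.
move=> coX sc sc'; apply: smooth_chart_restr_pt => // x cx cx'.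
have [W [oW Wx _ WP]] := sic_open (sic_smooth_charts coX sc sc' cx cx').
by exists W.
Qed.

(** Meant for a block permutation [l] such as [shuffle], where the dimensions of the two charts
    agree only after rearranging a sum; hence the pair [l], [l'] between differently typed
    spaces. *)
Lemma smooth_chart_repar (X : mfd R) (c c' : chart R X)
    (l : 'rV[R]_(cdim c) -> 'rV[R]_(cdim c')) (l' : 'rV[R]_(cdim c') -> 'rV[R]_(cdim c)) :
  smooth_chart c -> Cinfty setT l -> Cinfty setT l' -> cancel l l' -> cancel l' l ->
  (forall x, cdom c' x <-> cdom c x) ->
  (forall x, cdom c x -> cmap c' x = l (cmap c x)) -> smooth_chart c'.
Proof.
move=> sc Cl Cl' lK l'K dcc' lE; have [[ic oc] _] := sc.
have imE : cmap c' @` cdom c' = setT `&` l' @^-1` (cmap c @` cdom c).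
  apply/seteqP; split=> [_ [x /dcc' cx <-]|y [_ [x cx exy]]].
    by split=> //; exists x => //; rewrite lE // lK.
  by exists x; [exact/dcc'|rewrite lE // exy l'K].
have oc' : open (cmap c' @` cdom c').
  rewrite imE; apply: open_preimage oc; first exact: openT.
  by move=> y _; exact: (Cinfty_continuous Cl').
apply: smooth_chart_of.
  split=> // x y; rewrite !inE => /dcc' cx /dcc' cy; rewrite !lE // => /(can_inj lK).
  by apply: ic; rewrite inE.
move=> x /dcc' cx; exists c; split=> //.
  apply: (sic_of (g := l')) => //; first exact/dcc'.
    by apply: Cinfty_subset Cl' => //; exact: openT.
  by move=> y /dcc' cy; rewrite lE // lK.
apply: (sic_of (g := l)) => //.
  by apply: Cinfty_subset Cl => //; exact: openT.
by move=> y cy; rewrite lE //; split=> //; exact/dcc'.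
Qed.

End Charts.

(** * Local trivialisations of vector bundles *)

Section Trivialisations.
Context (R : realType).

Lemma theP (T : Type) (x0 : T) (P : set T) : (exists x, P x) -> P (the x0 P).
Proof. by move=> exP; rewrite /the; exact: (@xgetPex {classic T} x0 P exP). Qed.

(** The default value is covered as well, so properties such as lying over a given point follow
    without any existence statement. *)
Lemma the_ind (T : Type) (x0 : T) (P Q : set T) :
  Q x0 -> P `<=` Q -> Q (the x0 P).
Proof.
move=> Q0 PQ; rewrite /the; case: (@xgetP {classic T} x0 P) => [x -> Px|//].
exact: PQ.
Qed.

Lemma open_lsub n p (W : set 'rV[R]_n) : open W ->
  open ((@lsubmx R 1 n p) @^-1` W).
Proof.
move=> oW; rewrite -[X in open X]setTI.
apply: open_preimage oW; first exact: openT.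
move=> x _; apply: (@Cinfty_continuous R _ _ setT) => //.
by apply: Cinfty_lsub; [exact: openT|apply: Cinfty_id; exact: openT].
Qed.

Lemma vb_chart_image (E M : Type) (q : E -> M) (c : chart R M) k (tau : E -> 'rV[R]_k) :
  (forall m y, cdom c m -> exists e, q e = m /\ tau e = y) ->
  cmap (vb_chart q c tau) @` cdom (vb_chart q c tau) =
  (@lsubmx R 1 (cdim c) k) @^-1` (cmap c @` cdom c).
Proof.
move=> ex; apply/seteqP; split=> [_ [e ce <-]|z [m cm exy]] /=.
  by exists (q e) => //; rewrite row_mxKl.
have [e [qe te]] := ex m (rsubmx z) cm.
exists e; rewrite /= ?qe // te exy; exact: hsubmxK.
Qed.

(** In the charts the map is (x, y) |-> (h x, y *m F x), where h represents g; F need only be smooth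
    near the given base point. *)
Lemma vb_sic (E M E' M' : Type) (q : E -> M) (q' : E' -> M') (f : E -> E') (g : M -> M')
    (c : chart R M) k (tau : E -> 'rV[R]_k) (c' : chart R M') k' (tau' : E' -> 'rV[R]_k')
    (e : E) (W : set 'rV[R]_(cdim c)) (F : 'rV[R]_(cdim c) -> 'M[R]_(k, k')) :
  (forall m y, cdom c m -> exists e, q e = m /\ tau e = y) ->
  (forall e, cdom c (q e) -> q' (f e) = g (q e)) ->
  smooth_in_charts g c c' (q e) ->
  open W -> W (cmap c (q e)) -> mxsmooth W F ->
  (forall e', cdom c (q e') -> W (cmap c (q e')) -> cdom c' (g (q e')) ->
     tau' (f e') = tau e' *m F (cmap c (q e'))) ->
  smooth_in_charts f (vb_chart q c tau) (vb_chart q' c' tau') e.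
Proof.
move=> ex qf [W0 [h [cx [oW0 W0x] sW0 Ch hP]]] oW Wx sF FE.
have oW1 : open (W0 `&` W) by exact: openI.
have oW2 := @open_lsub _ k _ oW1.
exists ((@lsubmx R 1 (cdim c) k) @^-1` (W0 `&` W)).
exists (fun z => row_mx (h (lsubmx z)) (rsubmx z *m F (lsubmx z))); split=> //.
- by split=> //=; rewrite row_mxKl.
- by rewrite vb_chart_image // => z [/sW0].
- apply: Cinfty_row => //.
    apply: (@Cinfty_comp R _ _ _ _ W0 (fun z => lsubmx z) h) => // [|z []//].
    by apply: Cinfty_lsub => //; exact: Cinfty_id.
  apply: Cinfty_mulmx => //; first by apply: Cinfty_rsub => //; exact: Cinfty_id.
  apply: (@mxsmooth_comp R _ _ _ _ _ W (fun z => lsubmx z) F) => // [|z []//].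
  by apply: Cinfty_lsub => //; exact: Cinfty_id.
- move=> e' ce' /=; rewrite row_mxKl row_mxKr => -[W0e' We'].
  have [cge' ege'] := hP _ ce' W0e'.
  by rewrite qf // ege' FE.
Qed.

(** Together with local trivialisations this stands in for [is_vb] on the duals: the trivialisations
    supply linearity, these two clauses keep the operations inside the fibres. *)
Definition fibrewise (E M : mfd R) (v : vb E M) : Prop :=
  (forall e e', vproj v e = vproj v e' -> vproj v (vadd v e e') = vproj v e) /\
  (forall t e, vproj v (vscale v t e) = vproj v e).

(** The local section with constant coordinates y; when y runs through the standard basis, these
    sections are the frame belonging to [tau]. *)
Definition tsec (E M : mfd R) (v : vb E M) k (tau : E -> 'rV[R]_k) (y : 'rV[R]_k) (m : M) : E :=
  the (vzero v m) [set e | vproj v e = m /\ tau e = y].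

Lemma tsecP (E M : mfd R) (v : vb E M) k (tau : E -> 'rV[R]_k) y m :
  (exists e, vproj v e = m /\ tau e = y) ->
  vproj v (tsec v tau y m) = m /\ tau (tsec v tau y m) = y.
Proof. exact: theP. Qed.

Section OneTriv.
Context (E M : mfd R) (v : vb E M) (c : chart R M) (k : nat) (tau : E -> 'rV[R]_k).
Hypothesis (tv : is_triv v c tau).

Lemma triv_ex m y : cdom c m -> exists e, vproj v e = m /\ tau e = y.
Proof. by move=> cm; have [e [? _]] := triv_bij tv y cm; exists e. Qed.

Lemma triv_inj e e' : cdom c (vproj v e) -> vproj v e = vproj v e' ->
  tau e = tau e' -> e = e'.
Proof.
move=> ce ee' te; have [e0 [_ u]] := triv_bij tv (tau e) ce.
by rewrite -(u e) // -(u e').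
Qed.

Lemma triv_tsec y m : cdom c m ->
  vproj v (tsec v tau y m) = m /\ tau (tsec v tau y m) = y.
Proof. by move=> cm; apply: tsecP; exact: triv_ex. Qed.

Lemma triv_lin_mx k' (h : E -> 'rV[R]_k') m : fibrewise v -> cdom c m ->
  (forall e e', vproj v e = m -> vproj v e' = m -> h (vadd v e e') = h e + h e') ->
  (forall t e, vproj v e = m -> h (vscale v t e) = t *: h e) ->
  exists T : 'M[R]_(k, k'), forall e, vproj v e = m -> h e = tau e *m T.
Proof.
move=> [fa fs] cm hA hS.
pose T : 'M[R]_(k, k') := \matrix_(j < k) h (tsec v tau (delta_mx ord0 j) m).
exists T => e em.
pose s y := tsec v tau y m.
have sP y : vproj v (s y) = m /\ tau (s y) = y by exact: triv_tsec.
have slin t y y' : h (s (t *: y + y')) = t *: h (s y) + h (s y').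
  rewrite -hS ?(sP _).1 // -hA ?fs ?(sP _).1 //; congr h; apply: triv_inj.
  - by rewrite (sP _).1.
  - by rewrite fa ?fs ?(sP _).1.
  - by rewrite (triv_add tv) ?fs ?(sP _).1 // (triv_scale tv) ?(sP _).1 // !(sP _).2.
(* The case t = -1, y = y' = 0 of [slin] reads h (s 0) = - h (s 0) + h (s 0). *)
have s0 : h (s 0) = 0.
  by have := slin (-1) 0 0; rewrite scaler0 add0r scaleN1r addNr.
have -> : h e = h (s (tau e)).
  by congr h; apply: triv_inj; rewrite ?(sP _).1 ?(sP _).2 // em.
rewrite (row_sum_delta (tau e)) mulmx_suml.
elim: (index_enum _) => [|j r IH]; first by rewrite !big_nil.
rewrite !big_cons slin IH; congr (_ + _).
by rewrite -scalemxAl -rowE rowK.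
Qed.

End OneTriv.

(* The local representative of f is only known near one point of the zero section, so the
   matrix is read off from the images of the vectors eps *: delta_mx 0 j for small eps. *)
Lemma vbm_matrix (E M E' M' : mfd R) (v : vb E M) (v' : vb E' M') (f : E -> E') (g : M -> M')
    (c : chart R M) k (tau : E -> 'rV[R]_k) (c' : chart R M') k' (tau' : E' -> 'rV[R]_k') (e0 : E) :
  is_triv v c tau -> is_triv v' c' tau' -> fibrewise v ->
  cdom c (vproj v e0) -> tau e0 = 0 ->
  smooth_in_charts f (vb_chart (vproj v) c tau) (vb_chart (vproj v') c' tau') e0 ->
  (forall e, vproj v' (f e) = g (vproj v e)) ->
  (forall e e', vproj v e = vproj v e' -> f (vadd v e e') = vadd v' (f e) (f e')) ->
  (forall t e, f (vscale v t e) = vscale v' t (f e)) ->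
  exists (W : set 'rV[R]_(cdim c)) (F : 'rV[R]_(cdim c) -> 'M[R]_(k, k')),
    [/\ open W, W (cmap c (vproj v e0)), mxsmooth W F &
     forall e, cdom c (vproj v e) -> W (cmap c (vproj v e)) ->
       cdom c' (g (vproj v e)) /\ tau' (f e) = tau e *m F (cmap c (vproj v e))].
Proof.
move=> tv tv' fv cm te0 [W0 [G [_ [oW0 W0x] sW0 CG GP]]] fg fA fS.
set x0 := cmap c (vproj v e0).
have W0x0 : W0 (row_mx x0 0) by have := W0x; rewrite /= te0.
(* The vectors t *: delta_mx 0 j tend to 0 with t and W0 is open; as j takes finitely many values,
   one eps serves them all. *)
have [eps eps0 epsP] : exists2 eps : R, 0 < eps &
    forall j : 'I_k, W0 (row_mx x0 (eps *: delta_mx ord0 j)).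
  have H (j : 'I_k) : \forall t \near (0 : R), W0 (row_mx x0 (t *: delta_mx ord0 j)).
    have ct : {for (0 : R), continuous (fun t : R => row_mx x0 (t *: delta_mx ord0 j : 'rV[R]_k))}.
      apply/(@continuous_coordP R) => i; case: (split_ordP i) => l ->.
        have -> : (fun t : R => row_mx x0 (t *: delta_mx ord0 j : 'rV[R]_k) ord0 (lshift k l)) =
            fun=> x0 ord0 l by apply/funext => t; rewrite row_mxEl.
        exact: cst_continuous.
      have -> : (fun t : R => row_mx x0 (t *: delta_mx ord0 j : 'rV[R]_k) ord0 (rshift _ l)) =
          fun t => t * (delta_mx ord0 j : 'rV[R]_k) ord0 l.
        by apply/funext => t; rewrite row_mxEr mxE.
      by apply: continuousM => //; exact: cst_continuous.
    have n0 : nbhs (row_mx x0 ((0 : R) *: delta_mx ord0 j)) W0.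
      by rewrite scale0r; apply: open_nbhs_nbhs; split.
    exact: (ct W0 n0).
  have /nbhs_ballP[r /= r0 rP] : \forall t \near (0 : R),
    forall j : 'I_k, W0 (row_mx x0 (t *: delta_mx ord0 j))
      by exact: (@filter_forall _ 'I_k (fun j t => W0 (row_mx x0 (t *: delta_mx ord0 j))) _ _ H).
  exists (r / 2); first by rewrite divr_gt0.
  by apply: rP; rewrite -ball_normE /= sub0r normrN gtr0_norm ?divr_gt0 //
      ltr_pdivrMr // ltr_pMr // ltr1n.
pose W1 (j : 'I_k) := [set x : 'rV[R]_(cdim c) | W0 (row_mx x (eps *: delta_mx ord0 j))].
(* The zero vector is kept besides the multiples of the basis vectors: it yields [cdom c' (g m)]
   even when k = 0. *)
pose W := [set x : 'rV[R]_(cdim c) | W0 (row_mx x (0 : 'rV[R]_k))] `&`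
          \bigcap_(j in [set: 'I_k]) W1 j.
have Crow (y : 'rV[R]_k) V : open V -> Cinfty V (fun x : 'rV[R]_(cdim c) => row_mx x y).
  by move=> oV; apply: Cinfty_row => //; [exact: Cinfty_id|exact: Cinfty_cst].
have orow (y : 'rV[R]_k) : open [set x : 'rV[R]_(cdim c) | W0 (row_mx x y)].
  rewrite -[X in open X]setTI; apply: open_preimage oW0; first exact: openT.
  by move=> x _; apply: (Cinfty_continuous (Crow y _ openT)).
have oW : open W.
  apply: openI; first exact: orow.
  rewrite openE => x Wx; apply: (filterS (P := [set x | forall j, W1 j x])).
    by move=> y Hy j _.
  have H j : nbhs x (W1 j).
    by apply: open_nbhs_nbhs; split; [exact: orow|exact: Wx].
  exact: (@filter_forall _ 'I_k W1 _ _ H).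
pose F x : 'M[R]_(k, k') := \matrix_(j < k, i < k')
  (eps^-1 * rsubmx (G (row_mx x (eps *: delta_mx ord0 j))) ord0 i).
exists W, F; split=> //.
- by split=> // j _; exact: epsP.
- move=> j i.
  have CG' : Cinfty W (fun x => rsubmx (G (row_mx x (eps *: delta_mx ord0 j)))).
    apply: Cinfty_rsub => //.
    apply: (@Cinfty_comp R _ _ _ W W0 (fun x => row_mx x (eps *: delta_mx ord0 j)) G) => //.
      exact: Crow.
    by move=> x [_ /(_ j I)].
  move=> l; apply: (Cks_ext (f := fun x => eps^-1 *
     rsubmx (G (row_mx x (eps *: delta_mx ord0 j))) ord0 i) oW);
    first by move=> x _; rewrite [RHS]mxE.
  apply: CksM => //; first exact: Cks_cst.
  by move/(Cinfty_coordP _ oW): CG'; apply.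
- move=> e ce [We0 We].
  set m := vproj v e in ce We0 We *.
  have secP y : vproj v (tsec v tau y m) = m /\ tau (tsec v tau y m) = y.
    exact: (triv_tsec tv).
  have cgm : cdom c' (g m).
    have [] := GP (tsec v tau 0 m); rewrite /= ?(secP 0).1 ?(secP 0).2 //.
    by rewrite fg (secP 0).1.
  split=> //.
  (* On the fibre over m, f is given by some matrix T; evaluation at eps *: delta_mx 0 j, where G is
     known, shows that row j of T is that of F. *)
  have [T TP] : exists T : 'M[R]_(k, k'), forall e, vproj v e = m -> tau' (f e) = tau e *m T.
    apply: (triv_lin_mx tv fv ce) => [e1 e2 e1m e2m|t e1 e1m].
      by rewrite fA ?e1m // (triv_add tv') ?fg ?e1m ?e2m.
    by rewrite fS (triv_scale tv') ?fg ?e1m.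
  rewrite (TP e erefl); congr (_ *m _); apply/row_matrixP => j.
  have [] := GP (tsec v tau (eps *: delta_mx ord0 j) m).
  - by rewrite /= (secP _).1.
  - by rewrite /= (secP _).1 (secP _).2; exact: We j I.
  rewrite /= (secP _).1 (secP _).2 => _ EG.
  apply/rowP => i; rewrite [RHS]mxE [RHS]mxE -EG row_mxKr TP ?(secP _).1 // (secP _).2.
  by rewrite -scalemxAl -rowE !mxE mulrA mulVf ?mul1r // gt_eqF.
Qed.

(** A change of trivialisation covers the identity of M, so [vb_sic] in both directions compares the
    new chart with a known one. *)
Lemma smooth_chart_of_vb (E M : mfd R) (v : vb E M) (c : chart R M) k (tau : E -> 'rV[R]_k) :
  covered M -> smooth_chart c ->
  (forall m y, cdom c m -> exists! e, vproj v e = m /\ tau e = y) ->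
  (forall m, cdom c m -> exists c1 k1 (tau1 : E -> 'rV[R]_k1) (W : set 'rV[R]_(cdim c))
     (W1 : set 'rV[R]_(cdim c1)) F F1,
     [/\ is_triv v c1 tau1 /\ cdom c1 m,
         [/\ open W, W (cmap c m) & mxsmooth W F],
         [/\ open W1, W1 (cmap c1 m) & mxsmooth W1 F1],
         forall e, cdom c (vproj v e) -> W (cmap c (vproj v e)) -> cdom c1 (vproj v e) ->
           tau1 e = tau e *m F (cmap c (vproj v e)) &
         forall e, cdom c1 (vproj v e) -> W1 (cmap c1 (vproj v e)) -> cdom c (vproj v e) ->
           tau e = tau1 e *m F1 (cmap c1 (vproj v e))]) ->
  smooth_chart (vb_chart (vproj v) c tau).
Proof.
move=> coM sc bij H.
have ex m y : cdom c m -> exists e, vproj v e = m /\ tau e = y.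
  by move=> cm; have [e [? _]] := bij m y cm; exists e.
have [[ic oc] _] := sc.
apply: smooth_chart_of; first split.
- move=> e e'; rewrite !inE /= => ce ce' /eq_row_mx[cee' tee'].
  have mee' : vproj v e = vproj v e' by apply: ic; rewrite ?inE.
  have [e0 [_ u]] := bij _ (tau e) ce.
  by rewrite -(u e) // -(u e').
- by rewrite vb_chart_image //; exact: open_lsub.
move=> e ce; have [c1 [k1 [tau1 [W [W1 [F [F1 [[tv1 c1m] [oW Wm sF] [oW1 W1m sF1] FE F1E]]]]]]]] :=
    H _ ce.
have sc1 := triv_base tv1.
exists (vb_chart (vproj v) c1 tau1); split=> //; first exact: triv_chart tv1.
  apply: (@vb_sic _ _ _ _ _ _ id id _ _ _ _ _ _ _ W F) => //.
  exact: sic_smooth_charts.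
apply: (@vb_sic _ _ _ _ _ _ id id _ _ _ _ _ _ _ W1 F1) => //.
  by move=> m y c1m'; exact: (triv_ex tv1).
exact: sic_smooth_charts.
Qed.

(** Serves both to shrink the domain and to replace the coordinate map by another formula with the
    same values there; the transition matrix is the identity. *)
Lemma triv_rebase (E M : mfd R) (v : vb E M) (c c1 : chart R M) k (tau tau1 : E -> 'rV[R]_k) :
  covered M -> is_triv v c tau -> smooth_chart c1 -> cdom c1 `<=` cdom c ->
  fibrewise v -> (forall e, cdom c1 (vproj v e) -> tau1 e = tau e) ->
  is_triv v c1 tau1.
Proof.
move=> coM tv sc1 sub [fa fs] tE.
have bij m y : cdom c1 m -> exists! e, vproj v e = m /\ tau1 e = y.
  move=> cm; have [e [[em et] u]] := triv_bij tv y (sub m cm).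
  exists e; split; first by rewrite tE ?em.
  by move=> e' [e'm e't]; apply: u; rewrite -tE ?e'm.
split=> //.
- move=> e e' ce ee'; rewrite !tE ?fa -?ee' //.
  by apply: (triv_add tv) => //; exact: sub.
- move=> t e ce; rewrite !tE ?fs //.
  by apply: (triv_scale tv); exact: sub.
apply: smooth_chart_of_vb => // m cm.
exists c, k, tau, setT, setT, (fun=> 1%:M), (fun=> 1%:M); split.
- by split=> //; exact: sub.
- by split=> //; [exact: openT|exact: mxsmooth_cst].
- by split=> //; [exact: openT|exact: mxsmooth_cst].
- by move=> e ce *; rewrite tE ?mulmx1.
- by move=> e ce _ ce1; rewrite tE ?mulmx1.
Qed.

(** P and Q are rectangular in type because they are to be the block swaps between k + k' and k' +
    k. *)
Lemma triv_mx (E M : mfd R) (v : vb E M) (c : chart R M) k k' (tau : E -> 'rV[R]_k)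
    (P : 'M[R]_(k, k')) (Q : 'M[R]_(k', k)) :
  covered M -> is_triv v c tau -> P *m Q = 1%:M -> Q *m P = 1%:M ->
  is_triv v c (fun e => tau e *m P).
Proof.
move=> coM tv PQ QP; have sc := triv_base tv.
have bij m y : cdom c m -> exists! e, vproj v e = m /\ tau e *m P = y.
  move=> cm; have [e [[em et] u]] := triv_bij tv (y *m Q) cm.
  exists e; split; first by rewrite et -mulmxA QP mulmx1.
  by move=> e' [e'm e't]; apply: u; rewrite -e't -mulmxA PQ mulmx1.
split=> //.
- by move=> e e' ce ee'; rewrite (triv_add tv) // mulmxDl.
- by move=> t e ce; rewrite (triv_scale tv) // scalemxAl.
apply: smooth_chart_of_vb => // m cm.
exists c, k, tau, setT, setT, (fun=> Q), (fun=> P); split=> //.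
- by split=> //; [exact: openT|exact: mxsmooth_cst].
- by split=> //; [exact: openT|exact: mxsmooth_cst].
- by move=> e *; rewrite -mulmxA PQ mulmx1.
Qed.

Lemma triv_swap (E M : mfd R) (v : vb E M) (c : chart R M) k k'
    (s : E -> 'rV[R]_k) (t : E -> 'rV[R]_k') :
  covered M -> is_triv v c (fun e => row_mx (s e) (t e)) ->
  is_triv v c (fun e => row_mx (t e) (s e)).
Proof.
move=> coM tv.
pose P a b : 'M[R]_(a + b, b + a) := block_mx 0 1%:M 1%:M 0.
have PP a b : P a b *m P b a = 1%:M.
  by rewrite /P mulmx_block !mulmx0 !mul0mx !mulmx1 !addr0 !add0r -scalar_mx_block.
have PE a b (x : 'rV[R]_a) (y : 'rV[R]_b) : row_mx x y *m P a b = row_mx y x.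
  by rewrite /P mul_row_block !mulmx0 !mulmx1 addr0 add0r.
have := triv_mx coM tv (PP _ _) (PP _ _).
by under eq_fun do rewrite PE.
Qed.

(** The matrix [F0] from tau to a known trivialisation tau1 has the tau1-coordinates of the frame of
    tau as its rows, hence is smooth; the matrix back is its inverse, smooth by [mxsmooth_inv]. *)
Lemma triv_of_frame (E M : mfd R) (v : vb E M) (c : chart R M) k (tau : E -> 'rV[R]_k) :
  covered M -> fibrewise v -> smooth_chart c ->
  (forall e e', cdom c (vproj v e) -> vproj v e = vproj v e' ->
    tau (vadd v e e') = tau e + tau e') ->
  (forall t e, cdom c (vproj v e) -> tau (vscale v t e) = t *: tau e) ->
  (forall m y, cdom c m -> exists! e, vproj v e = m /\ tau e = y) ->
  (forall m, cdom c m -> exists c1 k1 (tau1 : E -> 'rV[R]_k1),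
     [/\ is_triv v c1 tau1, cdom c1 m &
      forall j, smooth_in_charts (tsec v tau (delta_mx ord0 j)) c
         (vb_chart (vproj v) c1 tau1) m]) ->
  is_triv v c tau.
Proof.
move=> coM fv sc tA tS bij H; split=> //.
apply: smooth_chart_of_vb => // m cm.
have [c1 [k1 [tau1 [tv1 c1m sj]]]] := H m cm.
have sc1 := triv_base tv1.
have ex m' y : cdom c m' -> exists e, vproj v e = m' /\ tau e = y.
  by move=> cm'; have [e [? _]] := bij m' y cm'; exists e.
have sP y m' : cdom c m' -> vproj v (tsec v tau y m') = m' /\ tau (tsec v tau y m') = y.
  by move=> cm'; apply: tsecP; exact: ex.
have inj e e' : cdom c (vproj v e) -> vproj v e = vproj v e' -> tau e = tau e' -> e = e'.
  move=> ce ee' te; have [e0 [_ u]] := bij _ (tau e) ce.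
  by rewrite -(u e) // -(u e').
have TP m' : cdom c m' -> cdom c1 m' -> exists T, forall e, vproj v e = m' -> tau e = tau1 e *m T.
  move=> cm' c1m'; apply: (triv_lin_mx tv1 fv c1m') => [e e' em e'm|t e em].
    by rewrite tA ?em ?e'm.
  by rewrite tS ?em.
pose F0 m' : 'M[R]_(k, k1) := \matrix_(j < k) tau1 (tsec v tau (delta_mx ord0 j) m').
have F0P m' : cdom c m' -> cdom c1 m' -> exists T : 'M[R]_(k1, k),
    [/\ forall e, vproj v e = m' -> tau e = tau1 e *m T,
      T *m F0 m' = 1%:M & F0 m' *m T = 1%:M].
  move=> cm' c1m'; have [T TE] := TP m' cm' c1m'.
  have F0T : F0 m' *m T = 1%:M.
    apply/row_matrixP => j; rewrite row_mul rowK -TE ?(sP _ _ cm').1 // (sP _ _ cm').2.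
    by rewrite row1.
  (* T is injective because tau separates the points of a fibre, and (T F0 - 1) T = T (F0 T) - T = 0
     then gives the second one-sided inverse. That T is square is deduced only afterwards, from both
     inverses. *)
  have T0 (u : 'rV[R]_k1) : u *m T = 0 -> u = 0.
    have [e [em eu]] := triv_ex tv1 u c1m'; have [e' [e'm e'u]] := triv_ex tv1 0 c1m'.
    move=> uT; rewrite -eu -[RHS]e'u; congr tau1; apply: inj; rewrite ?em ?e'm //.
    by rewrite !TE // eu e'u uT mul0mx.
  exists T; split=> //; apply/row_matrixP => j; apply/eqP; rewrite -subr_eq0; apply/eqP.
  by apply: T0; rewrite -linearB -row_mul mulmxBl -mulmxA F0T mulmx1 mul1mx subrr row0.
have kk1 : k1 = k.
  have [T [_ TF FT]] := F0P m cm c1m.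
  by apply/eqP; rewrite eqn_leq (mulmx1_min TF) (mulmx1_min FT).
subst k1.
have /choice[WG WGP] j :
    exists WG : set 'rV[R]_(cdim c) * ('rV[R]_(cdim c) -> 'rV[R]_(cdim c1 + k)),
    local_rep (c' := vb_chart (vproj v) c1 tau1) (tsec v tau (delta_mx ord0 j)) m WG.1 WG.2.
  by have [W [G WGP]] := sj j; exists (W, G).
have oWG j : open (WG j).1 by have [_ []] := WGP j.
pose W := \bigcap_(j in [set: 'I_k]) (WG j).1.
have oW : open W.
  rewrite openE => x Wx; apply: (filterS (P := [set x | forall j, (WG j).1 x])).
    by move=> y Hy j _.
  have H' j : nbhs x (WG j).1 by apply: open_nbhs_nbhs; split; [exact: oWG|exact: Wx].
  exact: (@filter_forall _ 'I_k (fun j => (WG j).1) _ _ H').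
pose F x : 'M[R]_(k, k) := \matrix_(j < k, i < k) rsubmx ((WG j).2 x) ord0 i.
have FE m' : cdom c m' -> W (cmap c m') -> F (cmap c m') = F0 m'.
  move=> cm' Wm'; apply/matrixP => j i; rewrite [LHS]mxE [RHS]mxE.
  have [_ _ _ _ /(_ m' cm' (Wm' j I))[_ <-]] := WGP j.
  by rewrite /= row_mxKr.
have sF : mxsmooth W F.
  move=> j i l; have [_ _ _ CG _] := WGP j.
  have CG' : Cinfty W (fun x => rsubmx ((WG j).2 x)).
    apply: Cinfty_rsub => //; apply: Cinfty_subset CG => //.
    by move=> x /(_ j I).
  apply: (Cks_ext (f := fun x => rsubmx ((WG j).2 x) ord0 i) oW).
    by move=> x _; rewrite [RHS]mxE.
  by move/(Cinfty_coordP _ oW): CG'; apply.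
have Wm : W (cmap c m) by move=> j _; have [_ []] := WGP j.
(* The inverse matrix has to be a function of the c1-coordinates, whence the change of charts psi on
   the base. *)
have [W2 [psi [_ [oW2 W2m] sW2 Cpsi psiP]]] := sic_smooth_charts coM sc1 sc c1m cm.
have oW1 : open (W2 `&` psi @^-1` W).
  by apply: open_preimage => // x W2x; exact: (Cinfty_continuous Cpsi).
have Cpsi' : Cinfty (W2 `&` psi @^-1` W) psi by apply: Cinfty_subset Cpsi => // x [].
exists c1, k, tau1, W, (W2 `&` psi @^-1` W), F, (fun x => invmx (F (psi x))); split=> //.
- split=> //; first by split=> //=; have [_ <-] := psiP m c1m W2m.
  apply: mxsmooth_inv => // [x [W2x Wx]|].
    have [m' c1m' em'] := sW2 x W2x.
    have [cm' pm'] : cdom c m' /\ cmap c m' = psi x.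
      by rewrite -em'; apply: psiP => //; rewrite em'.
    rewrite -pm' FE //; last by rewrite pm'.
    by have [T [_ /mulmx1_unit[]]] := F0P m' cm' c1m'.
  by apply: (@mxsmooth_comp R _ _ _ _ _ W psi F) => // x [].
- move=> e ce We c1e; rewrite FE //; have [T [TE TF FT]] := F0P _ ce c1e.
  by rewrite (TE e) // -mulmxA TF mulmx1.
- move=> e c1e [W2e We] ce; have [_ /= pe] := psiP _ c1e W2e.
  rewrite -pe FE //; last by rewrite pe.
  have [T [TE TF FT]] := F0P _ ce c1e; rewrite (TE e) //; congr (_ *m _).
  have [uT uF] := mulmx1_unit TF.
  by rewrite -[LHS]mulmx1 -(mulmxV uF) mulmxA TF mul1mx.
Qed.

End Trivialisations.

(** * Dual bundles *)

Section Dual.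
Context (R : realType).

Definition dot k (a b : 'rV[R]_k) : R := \sum_(i < k) a ord0 i * b ord0 i.

Lemma dotC k (a b : 'rV[R]_k) : dot a b = dot b a.
Proof. by apply: eq_bigr => i _; rewrite mulrC. Qed.

Lemma dotDr k (a b b' : 'rV[R]_k) : dot a (b + b') = dot a b + dot a b'.
Proof. by rewrite -big_split; apply: eq_bigr => i _; rewrite mxE mulrDr. Qed.

Lemma dotDl k (a a' b : 'rV[R]_k) : dot (a + a') b = dot a b + dot a' b.
Proof. by rewrite dotC dotDr !(dotC b). Qed.

Lemma dotZr k t (a b : 'rV[R]_k) : dot a (t *: b) = t * dot a b.
Proof. by rewrite mulr_sumr; apply: eq_bigr => i _; rewrite mxE mulrCA. Qed.

Lemma dotZl k t (a b : 'rV[R]_k) : dot (t *: a) b = t * dot a b.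
Proof. by rewrite dotC dotZr dotC. Qed.

Lemma dot0r k (a : 'rV[R]_k) : dot a 0 = 0.
Proof. by rewrite -(scale0r (0 : 'rV_k)) dotZr mul0r. Qed.

Lemma dot0l k (a : 'rV[R]_k) : dot 0 a = 0.
Proof. by rewrite dotC dot0r. Qed.

Lemma dotNl k (a b : 'rV[R]_k) : dot (- a) b = - dot a b.
Proof. by rewrite -scaleN1r dotZl mulN1r. Qed.

Lemma dot_delta k (a : 'rV[R]_k) i : dot a (delta_mx ord0 i) = a ord0 i.
Proof.
rewrite /dot (bigD1 i) //= big1 ?addr0 => [|j ji]; first by rewrite mxE !eqxx mulr1.
by rewrite mxE (negbTE ji) andbF mulr0.
Qed.

Lemma dot_inj k (a b : 'rV[R]_k) : (forall y, dot a y = dot b y) -> a = b.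
Proof. by move=> H; apply/rowP => i; rewrite -!dot_delta H. Qed.

Lemma dot_row p q (a b : 'rV[R]_p) (a' b' : 'rV[R]_q) :
  dot (row_mx a a') (row_mx b b') = dot a b + dot a' b'.
Proof.
rewrite /dot big_split_ord /=; congr (_ + _).
  by apply: eq_bigr => i _; rewrite !row_mxEl.
by apply: eq_bigr => i _; rewrite !row_mxEr.
Qed.

Lemma dot_mx p q (a : 'rV[R]_p) (b : 'rV[R]_q) (G : 'M[R]_(q, p)) :
  dot a (b *m G) = dot (a *m G^T) b.
Proof.
have dotE k (x y : 'rV[R]_k) : dot x y = (x *m y^T) ord0 ord0.
  by rewrite mxE; apply: eq_bigr => i _; rewrite mxE.
by rewrite !dotE trmx_mul mulmxA.
Qed.

(** [vzero] is an independent field of [vb] which [is_triv] does not mention. The extra clause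
    follows from [is_vb] ([vb_ztriv]) and is proved directly for duals. *)
Definition ztriv (E M : mfd R) (v : vb E M) (c : chart R M) k (tau : E -> 'rV[R]_k) : Prop :=
  is_triv v c tau /\
  forall m, cdom c m -> vproj v (vzero v m) = m /\ tau (vzero v m) = 0.

Section DualPoints.
Context (E M : mfd R) (v : vb E M).

(** Functionals are 0 off their fibre, so agreement on the fibre makes the underlying functions
    equal. *)
Lemma dual_pt_ext (eps eps' : dual_pt v) : dbase eps = dbase eps' ->
  (forall e, vproj v e = dbase eps -> pairing eps e = pairing eps' e) -> eps = eps'.
Proof.
case: eps eps' => [m p hp] [m' p' hp'] /= mm' pp'; subst m'.
have {}pp' : p = p'.
  apply/funext => e; have [em|em] := pselect (vproj v e = m); first exact: pp'.
  by have [_ _ h] := hp; have [_ _ h'] := hp'; rewrite h ?h'.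
by subst p'; congr DualPt; exact: Prop_irrelevance.
Qed.

Lemma dual_ex m (h : E -> R) : fibrewise v ->
  (forall e e', vproj v e = m -> vproj v e' = m -> h (vadd v e e') = h e + h e') ->
  (forall t e, vproj v e = m -> h (vscale v t e) = t * h e) ->
  exists eps : dual_pt v, dbase eps = m /\ forall e, vproj v e = m -> pairing eps e = h e.
Proof.
move=> [fa fs] hA hS.
pose h' e := if pselect (vproj v e = m) then h e else 0.
have h'E e : vproj v e = m -> h' e = h e by rewrite /h'; case: pselect.
have fun_h : is_functional v m h'.
  split=> [e e' em e'm|t e em|e em].
  - by rewrite !h'E ?fa ?em // hA.
  - by rewrite !h'E ?fs // hS.
  - by rewrite /h'; case: pselect.
by exists (DualPt fun_h).
Qed.

Lemma pairing_add (eps : dual_pt v) e e' : vproj v e = dbase eps ->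
  vproj v e' = dbase eps -> pairing eps (vadd v e e') = pairing eps e + pairing eps e'.
Proof. by have [A _ _] := pairing_functional eps; exact: A. Qed.

Lemma pairing_scale (eps : dual_pt v) t e : vproj v e = dbase eps ->
  pairing eps (vscale v t e) = t * pairing eps e.
Proof. by have [_ S _] := pairing_functional eps; exact: S. Qed.

Hypothesis fv : fibrewise v.

Lemma dual_addP (eps eps' : dual_pt v) : dbase eps = dbase eps' ->
  dbase (vadd (dual_vb v) eps eps') = dbase eps /\
  forall e, vproj v e = dbase eps ->
    pairing (vadd (dual_vb v) eps eps') e = pairing eps e + pairing eps' e.
Proof.
move=> ee'; rewrite /=; apply: (@theP _ eps [set eta : dual_pt v | dbase eta = dbase eps /\
       forall e, vproj v e = dbase eps ->
         pairing eta e = pairing eps e + pairing eps' e]).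
apply: dual_ex => // [e e' em e'm|t e em].
  by rewrite !pairing_add -?ee' // addrACA.
by rewrite !pairing_scale -?ee' // mulrDr.
Qed.

Lemma dual_scaleP t (eps : dual_pt v) :
  dbase (vscale (dual_vb v) t eps) = dbase eps /\
  forall e, vproj v e = dbase eps ->
    pairing (vscale (dual_vb v) t eps) e = t * pairing eps e.
Proof.
rewrite /=; apply: (@theP _ eps [set eta : dual_pt v | dbase eta = dbase eps /\
       forall e, vproj v e = dbase eps -> pairing eta e = t * pairing eps e]).
apply: dual_ex => // [e e' em e'm|s e em].
  by rewrite !pairing_add // mulrDr.
by rewrite !pairing_scale // mulrCA.
Qed.

Lemma fibrewise_dual : fibrewise (dual_vb v).
Proof.
split=> [eps eps' ee'|t eps]; first by have [] := dual_addP ee'.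
by have [] := dual_scaleP t eps.
Qed.

Definition dcoord k (tau : E -> 'rV[R]_k) (eps : dual_mfd v) : 'rV[R]_k :=
  \row_i pairing (eps : dual_pt v) (tsec v tau (delta_mx ord0 i) (dbase eps)).

Section DualTriv.
Context (c : chart R M) (k : nat) (tau : E -> 'rV[R]_k).
Hypothesis tv : is_triv v c tau.

Lemma dcoordP (eps : dual_pt v) e : cdom c (dbase eps) -> vproj v e = dbase eps ->
  pairing eps e = dot (dcoord tau eps) (tau e).
Proof.
move=> ce em.
have [T TE] : exists T : 'M[R]_(k, 1), forall e, vproj v e = dbase eps ->
    \row_(i < 1) pairing eps e = tau e *m T.
  apply: (triv_lin_mx tv fv ce) => [e1 e2 e1m e2m|t e1 e1m]; apply/rowP => i.
    by rewrite !mxE pairing_add.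
  by rewrite !mxE pairing_scale.
have pE e1 : vproj v e1 = dbase eps -> pairing eps e1 = (tau e1 *m T) ord0 ord0.
  by move=> /TE <-; rewrite mxE.
rewrite pE // mxE; apply: eq_bigr => i _; rewrite mulrC; congr (_ * _).
have [sm st] := triv_tsec tv (delta_mx ord0 i) ce.
by rewrite mxE pE // st -rowE mxE.
Qed.

Lemma is_dual_coord_dcoord : is_dual_coord c tau (dcoord tau).
Proof. exact: dcoordP. Qed.

Lemma dcoord_uniq (eps : dual_pt v) y : cdom c (dbase eps) ->
  (forall e, vproj v e = dbase eps -> pairing eps e = dot y (tau e)) -> dcoord tau eps = y.
Proof.
move=> ce H; apply: dot_inj => z; have [sm st] := triv_tsec tv z ce.
by rewrite -st -dcoordP // H.
Qed.

Lemma dcoord_ex m y : cdom c m ->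
  exists eps : dual_pt v, dbase eps = m /\ dcoord tau eps = y.
Proof.
move=> cm; have [fa fs] := fv.
have [eps [em eP]] : exists eps : dual_pt v, dbase eps = m /\
    forall e, vproj v e = m -> pairing eps e = dot y (tau e).
  apply: dual_ex => // [e e' em e'm|t e em].
    by rewrite (triv_add tv) ?em // dotDr.
  by rewrite (triv_scale tv) ?em // dotZr.
by exists eps; split=> //; apply: dcoord_uniq; rewrite em.
Qed.

Lemma dcoord_inj (eps eps' : dual_pt v) : cdom c (dbase eps) -> dbase eps = dbase eps' ->
  dcoord tau eps = dcoord tau eps' -> eps = eps'.
Proof.
move=> ce ee' tt'; apply: dual_pt_ext => // e em.
by rewrite !dcoordP -?ee' // tt'.
Qed.

End DualTriv.

(** If tau = tau1 *m G, invariance of the pairing gives rho1 = rho *m G^T, so no inverse enters. G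
    is smooth by [vbm_matrix] applied to the identity of E. *)
Lemma dual_trans (c c1 : chart R M) k k1 (tau : E -> 'rV[R]_k) (tau1 : E -> 'rV[R]_k1)
    (rho : dual_pt v -> 'rV[R]_k) (rho1 : dual_pt v -> 'rV[R]_k1) m :
  covered M -> covered E ->
  is_triv v c tau -> is_triv v c1 tau1 ->
  is_dual_coord c tau rho -> is_dual_coord c1 tau1 rho1 -> cdom c m -> cdom c1 m ->
  exists W F, [/\ open W, W (cmap c m), mxsmooth W F &
    forall eps : dual_pt v, cdom c (dbase eps) -> W (cmap c (dbase eps)) ->
      cdom c1 (dbase eps) -> rho1 eps = rho eps *m F (cmap c (dbase eps))].
Proof.
move=> coM coE tv tv1 rP r1P cm c1m.
have [sc sc1] := (triv_base tv, triv_base tv1).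
have [s0m s0t] := triv_tsec tv1 0 c1m.
have [W1 [G [oW1 W1m sG GE]]] : exists (W : set 'rV[R]_(cdim c1))
    (F : 'rV[R]_(cdim c1) -> 'M[R]_(k1, k)),
    [/\ open W, W (cmap c1 (vproj v (tsec v tau1 0 m))), mxsmooth W F &
     forall e, cdom c1 (vproj v e) -> W (cmap c1 (vproj v e)) ->
       cdom c (id (vproj v e)) /\ tau (id e) = tau1 e *m F (cmap c1 (vproj v e))].
  apply: (@vbm_matrix _ _ _ _ _ v v id id c1 k1 tau1 c k tau (tsec v tau1 0 m) tv1 tv fv) => //.
    by rewrite s0m.
  apply: sic_smooth_charts => //; try exact: triv_chart.
    by rewrite /= s0m.
  by rewrite /= s0m.
rewrite s0m in W1m.
have [W2 [psi [_ [oW2 W2m] sW2 Cpsi psiP]]] := sic_smooth_charts coM sc sc1 cm c1m.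
have oW : open (W2 `&` psi @^-1` W1).
  by apply: open_preimage => // x W2x; exact: (Cinfty_continuous Cpsi).
have Cpsi' : Cinfty (W2 `&` psi @^-1` W1) psi by apply: Cinfty_subset Cpsi => // x [].
exists (W2 `&` psi @^-1` W1), (fun x => (G (psi x))^T); split=> //.
- by split=> //=; have [_ <-] := psiP m cm W2m.
- apply: mxsmooth_tr => //.
  by apply: (@mxsmooth_comp R _ _ _ _ _ W1 psi G) => // x [].
move=> eps ce [W2e W1e] c1e.
have [_ pe] := psiP _ ce W2e; rewrite /= in W1e.
apply: dot_inj => z; have [sm st] := triv_tsec tv1 z c1e.
have [||_] := GE (tsec v tau1 z (dbase eps)); rewrite ?sm //=; first by rewrite pe.
rewrite pe => E1; rewrite -st -dot_mx -E1.
by rewrite -[LHS](r1P eps) // -[RHS](rP eps).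
Qed.

(** The atlas of [dual_mfd] admits every [rho] with [is_dual_coord]; over the domain of c it
    coincides with [dcoord tau]. *)
Lemma dual_chart (c : chart R M) k (tau : E -> 'rV[R]_k) rho : covered M -> covered E ->
  is_triv v c tau -> is_dual_coord c tau rho ->
  smooth_chart (vb_chart (@dbase R E M v) c rho : chart R (dual_mfd v)).
Proof.
move=> coM coE tv rP; have [[ic oc] sc] := triv_base tv.
have rE eps : cdom c (dbase eps) -> rho eps = dcoord tau eps.
  by move=> ce; apply/esym; apply: (dcoord_uniq tv) => // e; exact: rP.
have ex m y : cdom c m -> exists eps : dual_pt v, dbase eps = m /\ rho eps = y.
  move=> cm; have [eps [em et]] := dcoord_ex tv y cm.
  by exists eps; rewrite rE em.
split; first split.
- move=> e e'; rewrite !inE /= => ce ce' /eq_row_mx[cee' tee'].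
  have mee' : dbase e = dbase e' by apply: ic; rewrite ?inE.
  by apply: (dcoord_inj tv) => //; rewrite -!rE.
- by rewrite vb_chart_image //; exact: open_lsub.
move=> _ [c1 [k1 [tau1 [rho1 [tv1 r1P ->]]]]] eps ce c1e.
have [W [F [oW Wm sF FE]]] := dual_trans coM coE tv tv1 rP r1P ce c1e.
have [W1 [F1 [oW1 W1m sF1 F1E]]] := dual_trans coM coE tv1 tv r1P rP c1e ce.
have ex1 m y : cdom c1 m -> exists eps : dual_pt v, dbase eps = m /\ rho1 eps = y.
  move=> cm; have [eps1 [em et]] := dcoord_ex tv1 y cm.
  exists eps1; split=> //; rewrite -et; apply/esym.
  by apply: (dcoord_uniq tv1); rewrite ?em // => e em'; apply: r1P; rewrite ?em.
split.
  apply: (@vb_sic _ _ _ _ _ _ _ id id _ _ _ _ _ _ _ W F) => //.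
  exact: sic_smooth_charts coM (triv_base tv) (triv_base tv1) ce c1e.
apply: (@vb_sic _ _ _ _ _ _ _ id id _ _ _ _ _ _ _ W1 F1) => //.
exact: sic_smooth_charts coM (triv_base tv1) (triv_base tv) c1e ce.
Qed.

Lemma dual_triv (c : chart R M) k (tau : E -> 'rV[R]_k) : covered M -> covered E ->
  is_triv v c tau -> ztriv (dual_vb v) c (dcoord tau).
Proof.
move=> coM coE tv; split; first split.
- exact: triv_base tv.
- move=> eps eps' ce /[dup] ee' /dual_addP[bE pE]; rewrite /= in ce ee'.
  apply: (dcoord_uniq tv); rewrite ?bE // => e em.
  by rewrite pE // dotDl -!(dcoordP tv) -?ee'.
- move=> t eps ce; have [bE pE] := dual_scaleP t eps; rewrite /= in ce.
  apply: (dcoord_uniq tv); rewrite ?bE // => e em.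
  by rewrite pE // dotZl -(dcoordP tv).
- move=> m y cm; have [eps [em et]] := dcoord_ex tv y cm.
  exists eps; split=> // eps' [/= e'm e't].
  by apply: (dcoord_inj tv); rewrite ?em ?et ?e'm ?e't.
- exact: (dual_chart coM coE tv (is_dual_coord_dcoord tv)).
move=> m cm; split=> //=.
by apply: (dcoord_uniq tv) => // e em; rewrite dot0l.
Qed.

Lemma covered_dual :
  (forall m, exists c k (tau : E -> 'rV[R]_k), cdom c m /\ is_triv v c tau) ->
  covered (dual_mfd v).
Proof.
move=> H eps; have [c [k [tau [cm tv]]]] := H (dbase (eps : dual_pt v)).
exists (vb_chart (@dbase R E M v) c (dcoord tau)) => //.
by exists c, k, tau, (dcoord tau); split=> //; exact: is_dual_coord_dcoord.
Qed.

End DualPoints.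
End Dual.

(** * Splittings of double vector bundles and of their duals *)

Section Splitting.
Context (R : realType).

(* Since de is linear on the fibres of both projections and extends ga from the core, the map
   d |-> (al (pA d), be (pB d), de d) identifies D with A x_M B x_M C over the domain of c. *)
Record split (D : dvb R) (c : chart R (dM D)) p q r (al : dA D -> 'rV[R]_p)
    (be : dB D -> 'rV[R]_q) (ga : dC D -> 'rV[R]_r) (de : dD D -> 'rV[R]_r) : Prop := Split {
  sp_bA : ztriv (bA D) c al;
  sp_bB : ztriv (bB D) c be;
  sp_bC : is_triv (bC D) c ga;
  sp_tA : ztriv (tA D) (vb_chart (vproj (bA D)) c al)
            (fun d => row_mx (be (vproj (tB D) d)) (de d));
  sp_tB : ztriv (tB D) (vb_chart (vproj (bB D)) c be)
            (fun d => row_mx (al (vproj (tA D) d)) (de d));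
  sp_core : forall x, cdom c (vproj (bC D) x) ->
    [/\ vproj (tA D) (core x) = vzero (bA D) (vproj (bC D) x),
        vproj (tB D) (core x) = vzero (bB D) (vproj (bC D) x) & de (core x) = ga x]
}.

(** The global facts that accompany local splittings; unlike the full axioms they are transported to
    duals here ([laws_flip], [laws_dualA]). *)
Record dvb_laws (D : dvb R) : Prop := DvbLaws {
  lw_cov : [/\ covered (dM D), covered (dA D), covered (dB D), covered (dC D) & covered (dD D)];
  lw_fib : [/\ fibrewise (bA D), fibrewise (bB D), fibrewise (bC D),
               fibrewise (tA D) & fibrewise (tB D)];
  lw_sq : forall d, vproj (bA D) (vproj (tA D) d) = vproj (bB D) (vproj (tB D) d)
}.

Lemma split_flip (D : dvb R) (c : chart R (dM D)) p q r (al : dA D -> 'rV[R]_p)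
    (be : dB D -> 'rV[R]_q) (ga : dC D -> 'rV[R]_r) (de : dD D -> 'rV[R]_r) :
  split c al be ga de -> @split (flip D) c q p r be al ga de.
Proof. by case=> h1 h2 h3 h4 h5 h6; split=> // x cx; have [] := h6 x cx. Qed.

Lemma laws_flip (D : dvb R) : dvb_laws D -> dvb_laws (flip D).
Proof. by case=> [[? ? ? ? ?] [? ? ? ? ?] ?]; split=> //. Qed.

(** * The operations of D in the coordinates of a splitting *)

Section Algebra.
Context (D : dvb R) (c : chart R (dM D)) (p q r : nat) (al : dA D -> 'rV[R]_p)
  (be : dB D -> 'rV[R]_q) (ga : dC D -> 'rV[R]_r) (de : dD D -> 'rV[R]_r).
Hypotheses (L : dvb_laws D) (S : split c al be ga de).

Local Notation pA := (vproj (tA D)).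
Local Notation pB := (vproj (tB D)).
Local Notation qA := (vproj (bA D)).
Local Notation qB := (vproj (bB D)).

Lemma sp_addA d d' : cdom c (qA (pA d)) -> pA d = pA d' ->
  [/\ pA (vadd (tA D) d d') = pA d,
      be (pB (vadd (tA D) d d')) = be (pB d) + be (pB d') &
      de (vadd (tA D) d d') = de d + de d'].
Proof.
move=> cd dd'; have [_ _ _ [fa _] _] := lw_fib L.
have := triv_add (sp_tA S).1 (cd : cdom (vb_chart _ c al) _) dd'.
by rewrite add_row_mx => /eq_row_mx[? ?]; split=> //; exact: fa.
Qed.

Lemma sp_scaleA t d : cdom c (qA (pA d)) ->
  [/\ pA (vscale (tA D) t d) = pA d,
      be (pB (vscale (tA D) t d)) = t *: be (pB d) & de (vscale (tA D) t d) = t *: de d].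
Proof.
move=> cd; have [_ _ _ [_ fs] _] := lw_fib L.
have := triv_scale (sp_tA S).1 t (cd : cdom (vb_chart _ c al) _).
by rewrite scale_row_mx => /eq_row_mx[? ?]; split=> //; exact: fs.
Qed.

Lemma sp_zeroA a : cdom c (qA a) ->
  [/\ pA (vzero (tA D) a) = a, be (pB (vzero (tA D) a)) = 0 & de (vzero (tA D) a) = 0].
Proof.
move=> ca; have [e] := (sp_tA S).2 a ca.
by rewrite -row_mx0 => /eq_row_mx[? ?].
Qed.

Lemma sp_inj d d' : cdom c (qA (pA d)) -> pA d = pA d' -> be (pB d) = be (pB d') ->
  de d = de d' -> d = d'.
Proof.
by move=> cd dd' bb ee; apply: (triv_inj (sp_tA S).1) => //; rewrite bb ee.
Qed.

Lemma sp_ex a y z : cdom c (qA a) -> exists d, [/\ pA d = a, be (pB d) = y & de d = z].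
Proof.
move=> ca; have [d [da]] := triv_ex (sp_tA S).1 (row_mx y z) (ca : cdom (vb_chart _ c al) _).
by move=> /eq_row_mx[? ?]; exists d.
Qed.

Lemma sp_exAB a b z : cdom c (qA a) -> qA a = qB b ->
  exists d, [/\ pA d = a, pB d = b & de d = z].
Proof.
move=> ca ab; have [d [da db dz]] := sp_ex (be b) z ca; exists d; split=> //.
have sq : qB (pB d) = qA (pA d) by rewrite lw_sq.
by apply: (triv_inj (sp_bB S).1); rewrite ?sq ?da ?ab // -ab.
Qed.

Lemma sp_addB d d' : cdom c (qB (pB d)) -> pB d = pB d' ->
  [/\ pB (vadd (tB D) d d') = pB d,
      al (pA (vadd (tB D) d d')) = al (pA d) + al (pA d') &
      de (vadd (tB D) d d') = de d + de d'].
Proof.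
move=> cd dd'; have [_ _ _ _ [fa _]] := lw_fib L.
have := triv_add (sp_tB S).1 (cd : cdom (vb_chart _ c be) _) dd'.
by rewrite add_row_mx => /eq_row_mx[? ?]; split=> //; exact: fa.
Qed.

Lemma sp_scaleB t d : cdom c (qB (pB d)) ->
  [/\ pB (vscale (tB D) t d) = pB d,
      al (pA (vscale (tB D) t d)) = t *: al (pA d) & de (vscale (tB D) t d) = t *: de d].
Proof.
move=> cd; have [_ _ _ _ [_ fs]] := lw_fib L.
have := triv_scale (sp_tB S).1 t (cd : cdom (vb_chart _ c be) _).
by rewrite scale_row_mx => /eq_row_mx[? ?]; split=> //; exact: fs.
Qed.

Lemma sp_injB d d' : cdom c (qB (pB d)) -> pB d = pB d' -> al (pA d) = al (pA d') ->
  de d = de d' -> d = d'.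
Proof.
by move=> cd dd' aa ee; apply: (triv_inj (sp_tB S).1) => //; rewrite aa ee.
Qed.

End Algebra.

(** * Coordinates on the dual over A and its projection to C^* *)

Section DualA.
Context (D : dvb R) (c : chart R (dM D)) (p q r : nat) (al : dA D -> 'rV[R]_p)
  (be : dB D -> 'rV[R]_q) (ga : dC D -> 'rV[R]_r) (de : dD D -> 'rV[R]_r).
Hypotheses (L : dvb_laws D) (S : split c al be ga de).

Local Notation pA := (vproj (tA D)).
Local Notation pB := (vproj (tB D)).
Local Notation qA := (vproj (bA D)).
Local Notation qB := (vproj (bB D)).

(* <Phi, d>_A = dlt Phi . be (pB d) + kap Phi . de d; kap Phi turns out to be the
   coordinate vector of the projection of Phi to C^*. *)
Definition dlt (Phi : dual_mfd (tA D)) : 'rV[R]_q :=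
  lsubmx (dcoord (v := tA D) (fun d => row_mx (be (vproj (tB D) d)) (de d)) Phi).
Definition kap (Phi : dual_mfd (tA D)) : 'rV[R]_r :=
  rsubmx (dcoord (v := tA D) (fun d => row_mx (be (vproj (tB D) d)) (de d)) Phi).

Lemma pairingA (Phi : dual_pt (tA D)) d : cdom c (qA (dbase Phi)) -> pA d = dbase Phi ->
  pairing Phi d = dot (dlt Phi) (be (pB d)) + dot (kap Phi) (de d).
Proof.
move=> ca da; have [_ _ _ fv _] := lw_fib L.
by rewrite (dcoordP fv (sp_tA S).1) // -dot_row hsubmxK.
Qed.

Lemma dualA_uniq (Phi : dual_pt (tA D)) f k : cdom c (qA (dbase Phi)) ->
  (forall d, pA d = dbase Phi -> pairing Phi d = dot f (be (pB d)) + dot k (de d)) ->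
  dlt Phi = f /\ kap Phi = k.
Proof.
move=> ca H; have [_ _ _ fv _] := lw_fib L.
have E : dcoord (v := tA D) (fun d => row_mx (be (vproj (tB D) d)) (de d)) Phi = row_mx f k.
  by apply: (dcoord_uniq fv (sp_tA S).1) => // d da; rewrite H // dot_row.
by rewrite /dlt /kap E row_mxKl row_mxKr.
Qed.

Lemma dualA_ex a f k : cdom c (qA a) ->
  exists Phi : dual_pt (tA D), [/\ dbase Phi = a, dlt Phi = f & kap Phi = k].
Proof.
move=> ca; have [_ _ _ fv _] := lw_fib L.
have [Phi [da E]] := dcoord_ex fv (sp_tA S).1 (row_mx f k) (ca : cdom (vb_chart _ c al) _).
by exists Phi; rewrite /dlt /kap E row_mxKl row_mxKr.
Qed.

Lemma dualA_inj (Phi Phi' : dual_pt (tA D)) : cdom c (qA (dbase Phi)) ->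
  dbase Phi = dbase Phi' -> dlt Phi = dlt Phi' -> kap Phi = kap Phi' -> Phi = Phi'.
Proof.
move=> ca aa ff kk; apply: dual_pt_ext => // d da.
by rewrite !pairingA -?aa // ff kk.
Qed.

(** These are the elements on which [dualA_proj] tests a functional; as be vanishes on them, only
    the term with [kap] survives in the pairing. *)
Lemma coreB a x : cdom c (qA a) -> vproj (bC D) x = qA a ->
  [/\ pA (vadd (tB D) (vzero (tA D) a) (core x)) = a,
      be (pB (vadd (tB D) (vzero (tA D) a) (core x))) = 0 &
      de (vadd (tB D) (vzero (tA D) a) (core x)) = ga x].
Proof.
move=> ca xa; have [za zb zd] := sp_zeroA S ca.
have cx : cdom c (vproj (bC D) x) by rewrite xa.
have [xA xB xd] := sp_core S cx.
have [qbz bz] : qB (pB (vzero (tA D) a)) = qA a /\ pB (vzero (tA D) a) = pB (core x).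
  have sq : qB (pB (vzero (tA D) a)) = qA a by rewrite -[in RHS]za; apply/esym/lw_sq.
  split=> //; have [h1 h2] := (sp_bB S).2 _ cx.
  by apply: (triv_inj (sp_bB S).1); rewrite ?sq // ?zb xB ?h1 ?h2.
have cb : cdom c (qB (pB (vzero (tA D) a))) by rewrite qbz.
have [hB hal hde] := sp_addB L S cb bz.
have [h1 h2] := (sp_bA S).2 _ cx.
have hA : pA (vadd (tB D) (vzero (tA D) a) (core x)) = a.
  apply: (triv_inj (sp_bA S).1); rewrite ?lw_sq ?hB ?qbz //.
  by rewrite hal za xA h2 addr0.
by split=> //; rewrite ?hB ?zb // hde zd xd add0r.
Qed.

Lemma dualA_projP (Phi : dual_pt (tA D)) : cdom c (qA (dbase Phi)) ->
  dbase (dualA_proj (D := D) Phi : dual_pt (bC D)) = qA (dbase Phi) /\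
  dcoord (v := bC D) ga (dualA_proj (D := D) Phi) = kap Phi.
Proof.
move=> ca; have [_ _ fC fv _] := lw_fib L.
have [em eP] : [set kappa : dual_pt (bC D) | dbase kappa = qA (dbase Phi) /\
       forall c, vproj (bC D) c = qA (dbase Phi) ->
         pairing kappa c =
         pairing Phi (vadd (tB D) (vzero (tA D) (dbase Phi)) (core c))] (dualA_proj (D := D) Phi).
  apply: theP.
  have [kappa [km kE]] := dcoord_ex fC (sp_bC S) (kap Phi) ca.
  exists kappa; split=> // x xm; have [hA hb hd] := coreB ca xm.
  by rewrite pairingA // hb dot0r add0r hd -kE (dcoordP fC (sp_bC S)) ?km.
split=> //; apply: (dcoord_uniq fC (sp_bC S)); rewrite ?em // => x xm.
by have [hA hb hd] := coreB ca xm; rewrite eP // pairingA // hb dot0r add0r hd.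
Qed.

End DualA.

(** No splitting is required, because the default in [dualA_proj] lies over the same point of M. *)
Lemma dualA_sq (D : dvb R) (Phi : dual_pt (tA D)) :
  dbase (dualA_proj (D := D) Phi : dual_pt (bC D)) = vproj (bA D) (dbase Phi).
Proof.
by apply: (@the_ind _ _ _ [set kappa : dual_pt (bC D) | dbase kappa = _]) => // kappa [].
Qed.

(** * The structure of the dual over C^* and its splitting *)

Section DualA2.
Context (D : dvb R) (c : chart R (dM D)) (p q r : nat) (al : dA D -> 'rV[R]_p)
  (be : dB D -> 'rV[R]_q) (ga : dC D -> 'rV[R]_r) (de : dD D -> 'rV[R]_r).
Hypotheses (L : dvb_laws D) (S : split c al be ga de).
Let L' := laws_flip L.
Let S' := split_flip S.
Local Notation pA := (vproj (tA D)).
Local Notation pB := (vproj (tB D)).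
Local Notation qA := (vproj (bA D)).
Local Notation qB := (vproj (bB D)).
Local Notation dlt := (dlt be de).
Local Notation kap := (kap be de).
Local Notation proj := (dualA_proj (D := D)).

Lemma coreA b x : cdom c (qB b) -> vproj (bC D) x = qB b ->
  [/\ pB (vadd (tA D) (vzero (tB D) b) (core x)) = b,
      pA (vadd (tA D) (vzero (tB D) b) (core x)) = vzero (bA D) (qB b) &
      de (vadd (tA D) (vzero (tB D) b) (core x)) = ga x].
Proof.
move=> cb xb; have [h1 h2 h3] := coreB L' S' cb xb; rewrite /= in h1 h2 h3.
split=> //; have [z1 z2] := (sp_bA S).2 _ cb.
by apply: (triv_inj (sp_bA S).1); rewrite ?lw_sq ?h1 ?h2 ?z1 ?z2.
Qed.

(** Every element over a zero of A has the form on which [dualA_zero] and [dualA_core] prescribe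
    values, so these prescriptions determine the functional. *)
Lemma core_ex d m : cdom c m -> pA d = vzero (bA D) m ->
  exists x, vproj (bC D) x = m /\ vadd (tA D) (vzero (tB D) (pB d)) (core x) = d.
Proof.
move=> cm da; have [z1 z2] := (sp_bA S).2 _ cm.
have db : qB (pB d) = m by rewrite -lw_sq // da.
have [x [xm xd]] := triv_ex (sp_bC S) (de d) cm.
have cb : cdom c (qB (pB d)) by rewrite db.
have [|h1 h2 h3] := coreA cb (x := x); first by rewrite db.
exists x; split=> //; apply: (sp_inj S); rewrite ?h2 ?h1 ?h3 ?db ?z1 //.
Qed.

Lemma dualA_zeroP (kappa : dual_pt (bC D)) : cdom c (dbase kappa) ->
  [/\ dbase (dualA_zero (D := D) kappa : dual_pt (tA D)) = vzero (bA D) (dbase kappa),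
      dlt (dualA_zero (D := D) kappa) = 0 &
      kap (dualA_zero (D := D) kappa) = dcoord (v := bC D) ga kappa].
Proof.
move=> cm; have [_ _ fC fv _] := lw_fib L; have [z1 z2] := (sp_bA S).2 _ cm.
have ca : cdom c (qA (vzero (bA D) (dbase kappa))) by rewrite z1.
have [em eP] : [set Phi : dual_pt (tA D) | dbase Phi = vzero (bA D) (dbase kappa) /\
       forall b c, vproj (bB D) b = dbase kappa -> vproj (bC D) c = dbase kappa ->
         pairing Phi (vadd (tA D) (vzero (tB D) b) (core c)) = pairing kappa c]
      (dualA_zero (D := D) kappa).
  apply: theP.
  have [Phi [Pa Pf Pk]] := dualA_ex L S 0 (dcoord (v := bC D) ga kappa) ca.
  exists Phi; split=> // b x bm xm.
  have [||h1 h2 h3] := coreA (b := b) (x := x); rewrite ?bm //.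
  rewrite bm in h2.
  rewrite (pairingA L S) ?Pa // Pf Pk dot0l add0r h3.
  by rewrite (dcoordP fC (sp_bC S)).
rewrite em; suff [-> ->] : dlt (dualA_zero (D := D) kappa) = 0 /\
    kap (dualA_zero (D := D) kappa) = dcoord (v := bC D) ga kappa by [].
apply: (dualA_uniq L S); rewrite em // => d da.
have [x [xm xd]] := core_ex cm da.
have db : qB (pB d) = dbase kappa by rewrite -lw_sq // da.
have [||h1 h2 h3] := coreA (b := pB d) (x := x); rewrite ?db //.
by rewrite -{1}xd eP // (dcoordP fC (sp_bC S)) // dot0l add0r -xd h3.
Qed.

Lemma dualA_coreP (beta : dual_pt (bB D)) : cdom c (dbase beta) ->
  [/\ dbase (dualA_core (D := D) beta : dual_pt (tA D)) = vzero (bA D) (dbase beta),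
      dlt (dualA_core (D := D) beta) = dcoord (v := bB D) be beta &
      kap (dualA_core (D := D) beta) = 0].
Proof.
move=> cm; have [_ fB _ fv _] := lw_fib L; have [z1 z2] := (sp_bA S).2 _ cm.
have ca : cdom c (qA (vzero (bA D) (dbase beta))) by rewrite z1.
have [em eP] : [set Phi : dual_pt (tA D) | dbase Phi = vzero (bA D) (dbase beta) /\
       forall b c, vproj (bB D) b = dbase beta -> vproj (bC D) c = dbase beta ->
         pairing Phi (vadd (tA D) (vzero (tB D) b) (core c)) = pairing beta b]
      (dualA_core (D := D) beta).
  apply: theP.
  have [Phi [Pa Pf Pk]] := dualA_ex L S (dcoord (v := bB D) be beta) 0 ca.
  exists Phi; split=> // b x bm xm.
  have [||h1 h2 h3] := coreA (b := b) (x := x); rewrite ?bm //.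
  rewrite bm in h2.
  rewrite (pairingA L S) ?Pa // Pf Pk dot0l addr0 h1.
  by rewrite (dcoordP fB (sp_bB S).1).
rewrite em; suff [-> ->] : dlt (dualA_core (D := D) beta) = dcoord (v := bB D) be beta /\
    kap (dualA_core (D := D) beta) = 0 by [].
apply: (dualA_uniq L S); rewrite em // => d da.
have [x [xm xd]] := core_ex cm da.
have db : qB (pB d) = dbase beta by rewrite -lw_sq // da.
have [||h1 h2 h3] := coreA (b := pB d) (x := x); rewrite ?db //.
by rewrite -{1}xd eP // (dcoordP fB (sp_bB S).1) // dot0l addr0.
Qed.

Lemma dualA_addP (Phi Phi' : dual_pt (tA D)) : cdom c (qA (dbase Phi)) ->
  proj Phi = proj Phi' ->
  [/\ dbase (dualA_add (D := D) Phi Phi' : dual_pt (tA D)) = vadd (bA D) (dbase Phi) (dbase Phi'),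
      proj (dualA_add (D := D) Phi Phi') = proj Phi &
      dlt (dualA_add (D := D) Phi Phi') = dlt Phi + dlt Phi'].
Proof.
move=> ca pp'; have [fA _ fC fv fw] := lw_fib L.
have [p1 k1] := dualA_projP L S ca.
have aa' : qA (dbase Phi) = qA (dbase Phi') by rewrite -!dualA_sq pp'.
have ca' : cdom c (qA (dbase Phi')) by rewrite -aa'.
have [p1' k1'] := dualA_projP L S ca'.
have kk : kap Phi = kap Phi' by rewrite -k1 -k1' pp'.
have qa : qA (vadd (bA D) (dbase Phi) (dbase Phi')) = qA (dbase Phi) by rewrite fA.1.
have ca2 : cdom c (qA (vadd (bA D) (dbase Phi) (dbase Phi'))) by rewrite qa.
have [em pE eP] : [set Phi2 : dual_pt (tA D) |
      [/\ dbase Phi2 = vadd (bA D) (dbase Phi) (dbase Phi'),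
          proj Phi2 = proj Phi &
          forall d d', pA d = dbase Phi -> pA d' = dbase Phi' -> pB d = pB d' ->
            pairing Phi2 (vadd (tB D) d d') = pairing Phi d + pairing Phi' d']]
      (dualA_add (D := D) Phi Phi').
  apply: theP.
  (* In the required identity be is common to d and d', and kap is common to Phi and Phi', while de
     is additive; hence the values of dlt are added and the common kap is kept. *)
  have [Phi2 [Pa Pf Pk]] := dualA_ex L S (dlt Phi + dlt Phi') (kap Phi) ca2.
  have [|p2 k2] := dualA_projP L S (Phi := Phi2); first by rewrite Pa.
  exists Phi2; split=> //.
    apply: (dcoord_inj fC (sp_bC S)); rewrite ?p2 ?Pa ?qa ?p1 //.
    by rewrite [LHS]k2 Pk -k1.
  move=> d d' da da' bb.
  have cb : cdom c (qB (pB d)) by rewrite -lw_sq // da.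
  have [h1 h2 h3] := sp_addB L S cb bb.
  have ha : pA (vadd (tB D) d d') = vadd (bA D) (dbase Phi) (dbase Phi').
    have hq : qA (pA (vadd (tB D) d d')) = qA (dbase Phi) by rewrite lw_sq // h1 -lw_sq // da.
    apply: (triv_inj (sp_bA S).1); rewrite ?hq ?qa //.
    by rewrite h2 (triv_add (sp_bA S).1) // da da'.
  rewrite !(pairingA L S) ?Pa ?da ?da' // Pf Pk h1 h3 dotDl dotDr -kk -bb.
  by rewrite addrACA.
split=> //.
apply: dot_inj => y.
(* Test elements with de = 0 over a common b leave only the dlt terms, which determines dlt of the
   sum. *)
have [d [da dy dz]] := sp_ex S y 0 ca.
have ab : qA (dbase Phi') = qB (pB d) by rewrite -lw_sq // da.
have [d' [da' db' dz']] := sp_exAB L S 0 ca' ab.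
have cb : cdom c (qB (pB d)) by rewrite -ab.
have [h1 h2 h3] := sp_addB L S cb (esym db').
have ha : pA (vadd (tB D) d d') = vadd (bA D) (dbase Phi) (dbase Phi').
  have hq : qA (pA (vadd (tB D) d d')) = qA (dbase Phi) by rewrite lw_sq // h1 -lw_sq // da.
  apply: (triv_inj (sp_bA S).1); rewrite ?hq ?qa //.
  by rewrite h2 (triv_add (sp_bA S).1) // da da'.
have := eP d d' da da' (esym db').
by rewrite !(pairingA L S) ?em ?da ?da' // h1 h3 db' dz dz' dy addr0 !dot0r !addr0 dotDl.
Qed.

Lemma dualA_scaleP t (Phi : dual_pt (tA D)) : cdom c (qA (dbase Phi)) ->
  [/\ dbase (dualA_scale (D := D) t Phi : dual_pt (tA D)) = vscale (bA D) t (dbase Phi),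
      proj (dualA_scale (D := D) t Phi) = proj Phi &
      dlt (dualA_scale (D := D) t Phi) = t *: dlt Phi].
Proof.
move=> ca; have [fA _ fC fv fw] := lw_fib L.
have [p1 k1] := dualA_projP L S ca.
have qa : qA (vscale (bA D) t (dbase Phi)) = qA (dbase Phi) by rewrite fA.2.
have ca2 : cdom c (qA (vscale (bA D) t (dbase Phi))) by rewrite qa.
have sP d : pA d = dbase Phi -> [/\ pA (vscale (tB D) t d) = vscale (bA D) t (dbase Phi),
    pB (vscale (tB D) t d) = pB d & de (vscale (tB D) t d) = t *: de d].
  move=> da; have cb : cdom c (qB (pB d)) by rewrite -lw_sq // da.
  have [h1 h2 h3] := sp_scaleB L S t cb; split=> //.
  have hq : qA (pA (vscale (tB D) t d)) = qA (dbase Phi) by rewrite lw_sq // h1 -lw_sq // da.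
  apply: (triv_inj (sp_bA S).1); rewrite ?hq ?qa //.
  by rewrite h2 (triv_scale (sp_bA S).1) // da.
have [em pE eP] : [set Phi2 : dual_pt (tA D) |
      [/\ dbase Phi2 = vscale (bA D) t (dbase Phi),
          proj Phi2 = proj Phi &
          forall d, pA d = dbase Phi ->
            pairing Phi2 (vscale (tB D) t d) = t * pairing Phi d]]
      (dualA_scale (D := D) t Phi).
  apply: theP.
  have [Phi2 [Pa Pf Pk]] := dualA_ex L S (t *: dlt Phi) (kap Phi) ca2.
  have [|p2 k2] := dualA_projP L S (Phi := Phi2); first by rewrite Pa.
  exists Phi2; split=> //.
    apply: (dcoord_inj fC (sp_bC S)); rewrite ?p2 ?Pa ?qa ?p1 //.
    by rewrite [LHS]k2 Pk -k1.
  move=> d da; have [h1 h2 h3] := sP d da.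
  by rewrite !(pairingA L S) ?Pa ?da // Pf Pk h2 h3 dotZl dotZr mulrDr.
split=> //; apply: dot_inj => y.
have [d [da dy dz]] := sp_ex S y 0 ca.
have [h1 h2 h3] := sP d da.
have := eP d da.
by rewrite !(pairingA L S) ?em ?da // h2 h3 dz dy scaler0 !dot0r !addr0 dotZl.
Qed.

(* Exchanges the two middle blocks: passes from the chart of D given by D -> A to the one
   given by D -> B. *)
Definition shuffle n a b e (z : 'rV[R]_(n + a + (b + e))) : 'rV[R]_(n + b + (a + e)) :=
  row_mx (row_mx (lsubmx (lsubmx z)) (lsubmx (rsubmx z)))
         (row_mx (rsubmx (lsubmx z)) (rsubmx (rsubmx z))).

Lemma shuffleE n a b e (x : 'rV[R]_n) (y : 'rV[R]_a) (z : 'rV[R]_b) (w : 'rV[R]_e) :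
  shuffle (row_mx (row_mx x y) (row_mx z w)) = row_mx (row_mx x z) (row_mx y w).
Proof. by rewrite /shuffle !(row_mxKl, row_mxKr). Qed.

Lemma shuffleK n a b e : cancel (@shuffle n a b e) (@shuffle n b a e).
Proof. by move=> z; rewrite {2}/shuffle shuffleE !hsubmxK. Qed.

Lemma Cinfty_shuffle n a b e : Cinfty setT (@shuffle n a b e).
Proof.
have oT k : open (setT : set 'rV[R]_k) by exact: openT.
have Cid : Cinfty setT (fun z : 'rV[R]_(n + a + (b + e)) => z) by exact: Cinfty_id.
by apply: Cinfty_row => //; apply: Cinfty_row => //;
  do ?[apply: Cinfty_lsub => // | apply: Cinfty_rsub => //].
Qed.

(** Over A the trivialisation is dual to that of D -> A, with its blocks swapped and [kap] rewritten
    as the coordinates of the projection to C^*. Over C^* the chart is the same up to [shuffle], so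
    only fibrewise algebra remains. *)
Lemma split_dualA :
  split (D := dualA D) c al (dcoord (v := bC D) ga) (dcoord (v := bB D) be) dlt.
Proof.
have [coM coA coB coC coD] := lw_cov L.
have [fA fB fC fv fw] := lw_fib L.
have tC' := dual_triv fC coM coC (sp_bC S).
have tB' := dual_triv fB coM coB (sp_bB S).1.
have tA' := dual_triv fv coA coD (sp_tA S).1.
have projE Phi : cdom c (qA (dbase Phi)) -> dcoord (v := bC D) ga (proj Phi) = kap Phi.
  by move=> ca; have [] := dualA_projP L S ca.
have tAtriv : is_triv (dual_vb (tA D)) (vb_chart qA c al)
    (fun Phi => row_mx (dcoord (v := bC D) ga (proj Phi)) (dlt Phi)).
  have sw : is_triv (dual_vb (tA D)) (vb_chart qA c al) (fun Phi => row_mx (kap Phi) (dlt Phi)).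
    apply: triv_swap => //; apply: (triv_rebase coA tA'.1) => //.
    - exact: triv_base tA'.1.
    - exact: fibrewise_dual.
    - by move=> Phi _; rewrite hsubmxK.
  apply: (triv_rebase coA sw) => //; first exact: triv_base tA'.1.
    exact: fibrewise_dual.
  by move=> Phi ca; rewrite projE.
have zero0 a : cdom c (qA a) -> dlt (dual_zero (tA D) a) = 0 /\ kap (dual_zero (tA D) a) = 0.
  by move=> ca; apply: (dualA_uniq L S) => // d da; rewrite !dot0l addr0.
split.
- exact: sp_bA S.
- exact: tC'.
- exact: tB'.1.
- split=> // a ca; split=> //=.
  have [z1 z2] := zero0 a ca.
  by rewrite projE // z1 z2 row_mx0.
- split; last first.
    move=> kappa ck; have [z1 z2 z3] := dualA_zeroP ck; have [y1 y2] := (sp_bA S).2 _ ck.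
    split; last by rewrite /= z2 z1 y2 row_mx0.
    apply: (dcoord_inj fC (sp_bC S)); rewrite ?[dbase _]dualA_sq ?z1 ?y1 //=.
    by rewrite projE ?z1 ?y1.
  split.
  + exact: triv_chart tC'.1.
  + move=> Phi Phi'; rewrite /= dualA_sq => ca pp'.
    have [a1 a2 a3] := dualA_addP ca pp'.
    rewrite a1 a3 (triv_add (sp_bA S).1) ?add_row_mx //.
    by rewrite -!dualA_sq pp'.
  + move=> t Phi; rewrite /= dualA_sq => ca.
    have [a1 a2 a3] := dualA_scaleP t ca.
    by rewrite a1 a3 (triv_scale (sp_bA S).1) ?scale_row_mx.
  + move=> kappa y /= ck.
    have [a [am ax]] := triv_ex (sp_bA S).1 (lsubmx y) ck.
    have ca : cdom c (qA a) by rewrite am.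
    have [Phi [Pa Pf Pk]] := dualA_ex L S (rsubmx y) (dcoord (v := bC D) ga kappa) ca.
    have pk : proj Phi = kappa.
      apply: (dcoord_inj fC (sp_bC S)); rewrite ?[dbase _]dualA_sq ?Pa ?am //.
      by rewrite projE ?Pa.
    exists Phi; split; first by rewrite Pa Pf ax hsubmxK.
    move=> Phi' [pk' ey].
    have am' : qA (dbase (Phi' : dual_pt (tA D))) = dbase kappa
      by rewrite -dualA_sq [dualA_proj _]pk'.
    move: ey; rewrite -[y]hsubmxK => /eq_row_mx[ax' ef].
    have aa : dbase Phi = dbase (Phi' : dual_pt (tA D)).
      by rewrite Pa; apply: (triv_inj (sp_bA S).1); rewrite ?am ?am' ?ax ?ax'.
    apply: (dualA_inj L S); rewrite ?Pa //; first by rewrite -Pa.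
      by rewrite Pf ef.
    by rewrite Pk -projE ?am' // [dualA_proj _]pk'.
  + have := triv_chart tAtriv.
    set c1 := (X in smooth_chart X -> _); set c2 := (X in _ -> smooth_chart X) => sc.
    apply: (@smooth_chart_repar R (dual_mfd (tA D)) c1 c2 (@shuffle (cdim c) p r q)
        (@shuffle (cdim c) r p q) sc).
    * exact: Cinfty_shuffle.
    * exact: Cinfty_shuffle.
    * exact: shuffleK.
    * exact: shuffleK.
    * by move=> Phi /=; rewrite dualA_sq.
    * by move=> Phi /= ca; rewrite shuffleE dualA_sq.
- move=> beta cm; have [z1 z2 z3] := dualA_coreP cm; have [y1 y2] := (sp_bA S).2 _ cm.
  have ca : cdom c (qA (dbase (dualA_core (D := D) beta : dual_pt (tA D)))) by rewrite z1 y1.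
  split=> //=.
  have tz := tC'.2 _ cm.
  apply: (dcoord_inj fC (sp_bC S)); rewrite ?dualA_sq ?z1 ?y1 //=.
  by rewrite projE // z3 (tz.2).
Qed.

End DualA2.

(** * Passage of local splittings to duals *)

Definition locally_split (D : dvb R) : Prop := forall m : dM D,
  exists (c : chart R (dM D)) (p q r : nat) (al : dA D -> 'rV[R]_p)
    (be : dB D -> 'rV[R]_q) (ga : dC D -> 'rV[R]_r) (de : dD D -> 'rV[R]_r),
    cdom c m /\ split c al be ga de.

Lemma locally_split_flip (D : dvb R) : locally_split D -> locally_split (flip D).
Proof.
move=> H m; have [c [p [q [r [al [be [ga [de [cm S]]]]]]]]] := H m.
by exists c, q, p, r, be, al, ga, de; split=> //; exact: split_flip.
Qed.

Lemma locally_split_dualA (D : dvb R) :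
  dvb_laws D -> locally_split D -> locally_split (dualA D).
Proof.
move=> L H m; have [c [p [q [r [al [be [ga [de [cm S]]]]]]]]] := H m.
exists c, p, r, q, al, (dcoord (v := bC D) ga), (dcoord (v := bB D) be), (dlt be de).
by split=> //; exact: split_dualA.
Qed.

Lemma laws_dualA (D : dvb R) : dvb_laws D -> locally_split D -> dvb_laws (dualA D).
Proof.
move=> L H; have [coM coA coB coC coD] := lw_cov L.
have [fA fB fC fv fw] := lw_fib L.
split.
- split=> //.
  + apply: covered_dual => // m; have [c [p [q [r [al [be [ga [de [cm S]]]]]]]]] := H m.
    by exists c, r, ga; split=> //; exact: sp_bC S.
  + apply: covered_dual => // m; have [c [p [q [r [al [be [ga [de [cm S]]]]]]]]] := H m.
    by exists c, q, be; split=> //; exact: (sp_bB S).1.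
  + apply: covered_dual => // a.
    have [c [p [q [r [al [be [ga [de [cm S]]]]]]]]] := H (vproj (bA D) a).
    by eexists; eexists; eexists; split; last exact: (sp_tA S).1.
- split=> //; try exact: fibrewise_dual.
  (* The default in [dualA_add] and [dualA_scale] is Phi itself, which already has the required
     projection. *)
  split=> [Phi Phi' pp'|t Phi] /=.
    by apply: (@the_ind _ _ _
        [set Phi2 : dual_pt (tA D) | dualA_proj Phi2 = dualA_proj Phi]) => // Phi2 [].
  by apply: (@the_ind _ _ _
      [set Phi2 : dual_pt (tA D) | dualA_proj Phi2 = dualA_proj Phi]) => // Phi2 [].
- by move=> Phi /=; rewrite dualA_sq.
Qed.

End Splitting.

(** * Existence of local splittings *)

Section VectorBundleAlgebra.
Context (R : realType) (E M : mfd R) (v : vb E M).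
Hypothesis hv : is_vb v.

Lemma vb_fibrewise : fibrewise v.
Proof. by split; [exact: vproj_add|exact: vproj_scale]. Qed.

Lemma vb_ztriv (c : chart R M) k (tau : E -> 'rV[R]_k) : is_triv v c tau -> ztriv v c tau.
Proof.
move=> tv; split=> // m cm; have zm := vproj_zero hv m; split=> //.
have vz := vadd_zero hv (vzero v m); rewrite zm in vz.
have := triv_add tv (e := vzero v m) (e' := vzero v m); rewrite zm => /(_ cm erefl).
by rewrite vz => /(congr1 (fun x => x - tau (vzero v m))); rewrite subrr addrK => <-.
Qed.

Lemma vb_triv m : exists (c : chart R M) k (tau : E -> 'rV[R]_k), cdom c m /\ ztriv v c tau.
Proof.
have [c [k [tau [cm tv]]]] := vb_locally_trivial hv m.
by exists c, k, tau; split=> //; exact: vb_ztriv.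
Qed.

Lemma vb_scale0 e : vscale v 0 e = vzero v (vproj v e).
Proof.
have [c [k [tau [cm [tv tz]]]]] := vb_triv (vproj v e).
have [z1 z2] := tz _ cm.
apply: (triv_inj tv); rewrite ?vproj_scale ?z1 //.
by rewrite (triv_scale tv) // scale0r z2.
Qed.

Lemma vb_cancel e e1 e2 : vproj v e = vproj v e1 -> vproj v e = vproj v e2 ->
  vadd v e e1 = vadd v e e2 -> e1 = e2.
Proof.
have [c [k [tau [cm [tv _]]]]] := vb_triv (vproj v e).
move=> ee1 ee2 /(congr1 tau); rewrite !(triv_add tv) // => /addrI.
by move=> t12; apply: (triv_inj tv); rewrite -?ee1.
Qed.

Lemma vb_subK e e' : vproj v e = vproj v e' -> vadd v e' (vadd v e (vscale v (-1) e')) = e.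
Proof.
have [c [k [tau [cm [tv _]]]]] := vb_triv (vproj v e) => ee'.
have p1 : vproj v (vadd v e (vscale v (-1) e')) = vproj v e by rewrite vproj_add ?vproj_scale.
have p2 : vproj v (vadd v e' (vadd v e (vscale v (-1) e'))) = vproj v e by rewrite vproj_add ?p1.
apply: (triv_inj tv); rewrite ?p2 //.
rewrite !(triv_add tv) ?p1 ?vproj_scale -?ee' // (triv_scale tv) -?ee' //.
by rewrite scaleN1r addrC subrK.
Qed.

Lemma vb_addr0 e : vadd v e (vzero v (vproj v e)) = e.
Proof. by rewrite vadd_comm ?vproj_zero // vadd_zero. Qed.

End VectorBundleAlgebra.

Lemma smooth_chart_restr_fin (R : realType) (X : mfd R) (c : chart R X) (I : finType)
    (O : I -> set X) : smooth_chart c ->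
  (forall i x, cdom c x -> O i x -> exists W, [/\ open W, W (cmap c x) &
     forall y, cdom c y -> W (cmap c y) -> O i y]) ->
  smooth_chart (chart_restr c [set x | forall i, O i x]).
Proof.
move=> sc HO; apply: smooth_chart_restr_pt => // x cx Ox.
have /choice[W WP] i := HO i x cx (Ox i).
have oW : open (\bigcap_(i in [set: I]) W i).
  rewrite openE => y Wy; apply: (filterS (P := [set x | forall i, W i x])).
    by move=> z Hz i _.
  have H' i : nbhs y (W i).
    by have [oW _ _] := WP i; apply: open_nbhs_nbhs; split=> //; exact: Wy.
  exact: (@filter_forall _ I W _ _ H').
exists (\bigcap_(i in [set: I]) W i); split=> //.
  by move=> i _; have [] := WP i.
by move=> y cy Wy i; have [_ _] := WP i; apply=> //; exact: Wy.
Qed.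

(** In the chart of a trivialisation the sum keeps the base coordinates of f and adds the fibre
    coordinates. *)
Lemma sic_vadd (R : realType) (X : Type) (E M : mfd R) (v : vb E M) (cX : chart R X)
    (f g : X -> E) (c : chart R M) k (tau : E -> 'rV[R]_k) x :
  is_triv v c tau -> fibrewise v ->
  (forall y, cdom cX y -> vproj v (f y) = vproj v (g y)) ->
  smooth_in_charts f cX (vb_chart (vproj v) c tau) x ->
  smooth_in_charts g cX (vb_chart (vproj v) c tau) x ->
  smooth_in_charts (fun y => vadd v (f y) (g y)) cX (vb_chart (vproj v) c tau) x.
Proof.
move=> tv [fa _] fg [W1 [g1 [cx [oW1 W1x] sW1 C1 P1]]] [W2 [g2 [_ [oW2 W2x] sW2 C2 P2]]].
have oW : open (W1 `&` W2) by exact: openI.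
have C1' : Cinfty (W1 `&` W2) g1 by apply: Cinfty_subset C1 => // z [].
have C2' : Cinfty (W1 `&` W2) g2 by apply: Cinfty_subset C2 => // z [].
exists (W1 `&` W2), (fun z => row_mx (lsubmx (g1 z)) (rsubmx (g1 z) + rsubmx (g2 z))); split=> //.
- by move=> z [/sW1].
- apply: Cinfty_row => //; first exact: Cinfty_lsub.
  by apply: CinftyD => //; exact: Cinfty_rsub.
move=> y cy [W1y W2y]; have [/= c1 <-] := P1 y cy W1y; have [/= c2 <-] := P2 y cy W2y.
by rewrite fa ?fg // !row_mxKl !row_mxKr (triv_add tv) -?fg.
Qed.

(** * Lifting a section of B to fibrewise linear maps A -> D *)

Section Lift.
Context (R : realType) (D : dvb R).
Hypothesis hD : is_dvb D.
Local Notation pA := (vproj (tA D)).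
Local Notation pB := (vproj (tB D)).
Local Notation qA := (vproj (bA D)).
Local Notation qB := (vproj (bB D)).

Lemma dvb_sq d : qA (pA d) = qB (pB d).
Proof. exact: (vbm_proj (dvb_proj_mor (dvb_halfA hD))). Qed.

Lemma dvb_is_laws : dvb_laws D.
Proof.
split; last exact: dvb_sq.
- by split; apply: mfd_cover;
    [exact: dvb_mfdM|exact: dvb_mfdA|exact: dvb_mfdB|exact: dvb_mfdC|exact: dvb_mfdD].
- by split; apply: vb_fibrewise;
    [exact: dvb_bA|exact: dvb_bB|exact: dvb_bC|exact: dvb_tA|exact: dvb_tB].
Qed.

(* Over the values of a frame section b of B, the surjective linear map D_b -> A_m has a
   right inverse depending smoothly on m. *)
Lemma lift_section (c0 : chart R (dM D)) p q (al : dA D -> 'rV[R]_p) (be : dB D -> 'rV[R]_q)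
    (y : 'rV[R]_q) m0 :
  is_triv (bA D) c0 al -> is_triv (bB D) c0 be -> cdom c0 m0 ->
  let b := tsec (bB D) be y in
  exists (O : set (dM D)) (h : dA D -> dD D),
  [/\ O m0,
      forall m, cdom c0 m -> O m -> exists W, [/\ open W, W (cmap c0 m) &
        forall m', cdom c0 m' -> W (cmap c0 m') -> O m'],
      forall a, cdom c0 (qA a) -> O (qA a) -> pA (h a) = a /\ pB (h a) = b (qA a),
      (forall a a', cdom c0 (qA a) -> O (qA a) -> qA a = qA a' ->
         h (vadd (bA D) a a') = vadd (tB D) (h a) (h a')) /\
      (forall t a, cdom c0 (qA a) -> O (qA a) ->
         h (vscale (bA D) t a) = vscale (tB D) t (h a)) &
      forall c, smooth_chart c -> cdom c `<=` cdom c0 -> cdom c `<=` O ->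
        forall a, cdom c (qA a) -> exists2 c1 : chart R (dD D), smooth_chart c1 &
          smooth_in_charts h (vb_chart qA c al) c1 a].
Proof.
move=> tal tbe cm0 b.
have L := dvb_is_laws; have [coM coA coB coC coD] := lw_cov L.
have [fA fB fC fv fw] := lw_fib L.
have bP m : cdom c0 m -> qB (b m) = m /\ be (b m) = y by exact: (triv_tsec tbe).
have [c1 [k [tau [c1b t1]]]] := vb_locally_trivial (dvb_tB hD) (b m0).
have [s0m s0t] := triv_tsec t1 0 c1b.
have pmor := dvb_proj_mor (dvb_halfA hD).
(* [Lm] is the matrix of the projection D -> A, regarded as a morphism from D -> B to A -> M, in the
   coordinates tau and al. *)
have [W1 [Lm [oW1 W1b sL LE]]] : exists (W : set 'rV[R]_(cdim c1))
    (F : 'rV[R]_(cdim c1) -> 'M[R]_(k, p)),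
    [/\ open W, W (cmap c1 (pB (tsec (tB D) tau 0 (b m0)))), mxsmooth W F &
     forall e, cdom c1 (pB e) -> W (cmap c1 (pB e)) ->
       cdom c0 (qB (pB e)) /\ al (pA e) = tau e *m F (cmap c1 (pB e))].
  apply: (@vbm_matrix _ _ _ _ _ (tB D) (bA D) pA qB c1 k tau c0 p al _ t1 tal fw) => //.
  - by rewrite s0m.
  - apply: (smooth_sic (vbm_smooth pmor)); [exact: triv_chart t1|exact: triv_chart tal| |].
      by rewrite /= s0m.
    by rewrite /= dvb_sq s0m (bP _ cm0).1.
  - exact: dvb_sq.
  - exact: (vbm_add pmor).
  - exact: (vbm_scale pmor).
rewrite s0m in W1b.
pose x0 := cmap c1 (b m0).
have [Q0 Q0L] : exists Q0 : 'M[R]_(p, k), Q0 *m Lm x0 = 1%:M.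
  (* Surjectivity of D -> A x_M B, at the pairs formed by a basis vector of A and b m0. *)
  have H j : exists u : 'rV[R]_k, u *m Lm x0 = delta_mx ord0 j.
    have [a [am ax]] := triv_ex tal (delta_mx ord0 j) cm0.
    have [|d [da db]] := dvb_surj hD (a := a) (b := b m0).
      by rewrite am (bP _ cm0).1.
    exists (tau d); have := LE d; rewrite db da => /(_ c1b W1b)[_ <-].
    exact: ax.
  have /choice[u uP] := H.
  exists (\matrix_j u j); apply/row_matrixP => j.
  by rewrite row_mul rowK uP row1.
(* Q0 *m Lm is the identity at x0 and so stays invertible nearby, where Q = (Q0 *m Lm)^-1 *m Q0
   satisfies Q *m Lm = 1 and is smooth. *)
pose W2 := W1 `&` [set x | \det (Q0 *m Lm x) != 0].
have sQL : mxsmooth W1 (fun x => Q0 *m Lm x).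
  by apply: mxsmooth_mul => //; exact: mxsmooth_cst.
have oW2 : open W2.
  apply: (@open_preimage R _ _ W1 (fun x => \det (Q0 *m Lm x)) [set t | t != 0]) => //.
    by move=> x W1x; apply: (csmooth_continuous (csmooth_det oW1 sQL)).
pose Q x := invmx (Q0 *m Lm x) *m Q0.
have sQ : mxsmooth W2 Q.
  apply: mxsmooth_mul => //; last exact: mxsmooth_cst.
  apply: mxsmooth_inv => //.
    by move=> x [_ dx]; rewrite unitmxE unitfE.
  by apply: mxsmooth_subset sQL => x [].
have QL x : W2 x -> Q x *m Lm x = 1%:M.
  by move=> [_ dx]; rewrite /Q -mulmxA mulVmx // unitmxE unitfE.
pose O := [set m | cdom c1 (b m) /\ W2 (cmap c1 (b m))].
pose h a := tsec (tB D) tau (al a *m Q (cmap c1 (b (qA a)))) (b (qA a)).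
have hP a : O (qA a) -> pB (h a) = b (qA a) /\ tau (h a) = al a *m Q (cmap c1 (b (qA a))).
  by move=> [c1a _]; exact: (triv_tsec t1).
have sicb c m : smooth_chart c -> cdom c `<=` cdom c0 -> cdom c m -> cdom c1 (b m) ->
    smooth_in_charts b c c1 m.
  move=> sc sub cm c1m.
  have tbe' : is_triv (bB D) c be by apply: (triv_rebase coM tbe).
  have sb : smooth_in_charts b c (vb_chart qB c be) m.
    have [[_ oc] _] := sc.
    apply: (@sic_of R _ _ b c (vb_chart qB c be) (fun x : 'rV[R]_(cdim c) => row_mx x y)) => //.
      by apply: Cinfty_row => //; [exact: Cinfty_id|exact: Cinfty_cst].
    by move=> m' cm' /=; have [-> ->] := bP _ (sub _ cm').
  apply: (@sic_comp R _ _ _ b id _ _ c1 m sb); apply: sic_smooth_charts => //;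
      [exact: triv_chart tbe'|exact: triv_base t1|].
  by rewrite /= (bP _ (sub _ cm)).1.
exists O, h; split.
- split=> //; split=> //=; rewrite -/x0 Q0L det1; exact: oner_neq0.
- move=> m cm [c1m W2m].
  have [W [g [_ [oW Wm] sW Cg gP]]] := sicb c0 m (triv_base tal) (fun _ => id) cm c1m.
  exists (W `&` g @^-1` W2); split.
  + by apply: open_preimage => // x Wx; exact: (Cinfty_continuous Cg).
  + by split=> //=; have [_ <-] := gP m cm Wm.
  + by move=> m' cm' [Wm' W2m']; have [c1m' e] := gP m' cm' Wm'; split=> //; rewrite e.
- move=> a ca Oa; have [h1 h2] := hP a Oa; split=> //.
  have [c1a W2a] := Oa.
  have hq : qA (pA (h a)) = qA a by rewrite dvb_sq h1 (bP _ ca).1.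
  apply: (triv_inj tal); rewrite ?hq //.
  have [||_ ->] := LE (h a); rewrite ?h1 //; first by case: W2a.
  by rewrite h2 -mulmxA QL // mulmx1.
- split=> [a a' ca Oa aa'|t a ca Oa].
    have [h1 h2] := hP a Oa; have [c1a W2a] := Oa.
    have [|h1' h2'] := hP a'; first by rewrite -aa'.
    have qaa : qA (vadd (bA D) a a') = qA a by exact: fA.1.
    have [|h1'' h2''] := hP (vadd (bA D) a a'); first by rewrite qaa.
    apply: (triv_inj t1); rewrite ?h1'' ?qaa //.
      by rewrite fw.1 ?h1 // h1' -aa'.
    have bb : pB (h a) = pB (h a') by rewrite h1 h1' aa'.
    rewrite h2'' (triv_add t1 _ bb) ?h1 // h2 h2' qaa -aa' -mulmxDl.
    by rewrite (triv_add tal).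
  have [h1 h2] := hP a Oa; have [c1a W2a] := Oa.
  have qaa : qA (vscale (bA D) t a) = qA a by exact: fA.2.
  have [|h1'' h2''] := hP (vscale (bA D) t a); first by rewrite qaa.
  apply: (triv_inj t1); rewrite ?h1'' ?qaa //.
    by rewrite fw.2 ?h1.
  by rewrite h2'' (triv_scale t1) ?h1 // h2 qaa scalemxAl (triv_scale tal).
(* The chart c is left free, because the final domain is an intersection over all frame sections and
   is fixed only later. *)
- move=> c sc sub subO a ca; exists (vb_chart pB c1 tau); first exact: triv_chart t1.
  have [c1a W2a] := subO _ ca.
  have sb := sicb c (qA a) sc sub ca c1a.
  have [W [g [_ [oW Wm] sW Cg gP]]] := sb.
  have oW' : open (W `&` g @^-1` W2).
    by apply: open_preimage => // x Wx; exact: (Cinfty_continuous Cg).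
  have tal' : is_triv (bA D) c al by apply: (triv_rebase coM tal).
  apply: (@vb_sic _ _ _ _ _ _ _ h b c p al c1 k tau a (W `&` g @^-1` W2) (Q \o g)) => //.
  + by move=> m z cm; exact: (triv_ex tal').
  + by move=> a' /subO Oa'; have [] := hP a' Oa'.
  + by split=> //=; have [_ <-] := gP _ ca Wm.
  + apply: (@mxsmooth_comp R _ _ _ _ _ W2 g Q) => // [|x []//].
    by apply: Cinfty_subset Cg => // x [].
  + move=> a' ca' [Wa' _] _; have [_ ge] := gP _ ca' Wa'.
    by have [_ ->] := hP a' (subO _ ca'); rewrite /= -ge.
Qed.

End Lift.

Section MoreVectorBundleAlgebra.
Context (R : realType) (E M : mfd R) (v : vb E M).
Hypothesis hv : is_vb v.

Lemma vb_scale_zero t m : vscale v t (vzero v m) = vzero v m.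
Proof.
have zm := vproj_zero hv m.
by rewrite -{1}zm -(vb_scale0 hv) vscale_scale // mulr0 (vb_scale0 hv) zm.
Qed.

Lemma vb_add_zeroz m : vadd v (vzero v m) (vzero v m) = vzero v m.
Proof. by rewrite -{1}(vproj_zero hv m) vadd_zero. Qed.

Lemma vb_addACA e1 e2 e3 e4 : vproj v e1 = vproj v e2 -> vproj v e1 = vproj v e3 ->
  vproj v e1 = vproj v e4 ->
  vadd v (vadd v e1 e2) (vadd v e3 e4) = vadd v (vadd v e1 e3) (vadd v e2 e4).
Proof.
move=> e12 e13 e14.
have p12 : vproj v (vadd v e1 e2) = vproj v e1 by rewrite vproj_add.
have p13 : vproj v (vadd v e1 e3) = vproj v e1 by rewrite vproj_add.
rewrite !vadd_assoc ?p12 ?p13 //; congr (vadd _ _ _).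
by rewrite -!vadd_assoc //; congr (vadd _ _ _); rewrite vadd_comm // -e12.
Qed.

End MoreVectorBundleAlgebra.

(** * Decomposing D into lifts and translates of the core *)

Section Decomposition.
Context (R : realType) (D : dvb R).
Hypothesis hD : is_dvb D.
Local Notation pA := (vproj (tA D)).
Local Notation pB := (vproj (tB D)).
Local Notation qA := (vproj (bA D)).
Local Notation qB := (vproj (bB D)).
Local Notation qC := (vproj (bC D)).
Local Notation core := (@core R D).
Let HA := dvb_halfA hD.
Let vA := dvb_tA hD.
Let vB := dvb_tB hD.
Let sq := dvb_sq hD.

(** For fixed a, x |-> 0_a +_B x maps the fibre of C onto the kernel of D_a -> B
    ([trans_core_ex]). *)
Definition trans_core a x := vadd (tB D) (vzero (tA D) a) (core x).
Local Notation H := trans_core.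

Lemma zeroA_proj a : pA (vzero (tA D) a) = a /\ pB (vzero (tA D) a) = vzero (bB D) (qA a).
Proof.
by split; [exact: vproj_zero|exact: (vbm_proj (dvb_zero_mor HA))].
Qed.

Lemma zero_core a x : qC x = qA a -> pB (vzero (tA D) a) = pB (core x).
Proof. by move=> xa; rewrite (zeroA_proj a).2 (core_projB (dvb_core hD)) xa. Qed.

Lemma trans_core_proj a x : qC x = qA a -> pA (H a x) = a /\ pB (H a x) = vzero (bB D) (qA a).
Proof.
move=> xa; have bb := zero_core xa; have [z1 z2] := zeroA_proj a; split.
  rewrite /trans_core (vbm_add (dvb_proj_mor HA)) // z1 (core_projA (dvb_core hD)) xa.
  exact: (vb_addr0 (dvb_bA hD)).
by rewrite /trans_core (vproj_add vB).
Qed.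

(** The interchange law turns the sum into (0_a +_A 0_a) +_B (x +_A x'). *)
Lemma trans_core_addA a x x' : qC x = qA a -> qC x' = qA a ->
  vadd (tA D) (H a x) (H a x') = H a (vadd (bC D) x x').
Proof.
move=> xa xa'; rewrite /trans_core (dvb_add_add HA) ?(core_projA (dvb_core hD)) ?xa ?xa' //.
- by rewrite (vb_add_zeroz vA) (core_addA (dvb_core hD)) // xa.
- exact: zero_core.
- exact: zero_core.
Qed.

Lemma trans_core_scaleA t a x : qC x = qA a ->
  vscale (tA D) t (H a x) = H a (vscale (bC D) t x).
Proof.
move=> xa; rewrite /trans_core (vbm_add (dvb_scale_mor HA t)); last exact: zero_core.
by rewrite (vb_scale_zero vA) (core_scaleA (dvb_core hD)).
Qed.

Lemma trans_core_addB a a' x x' : qC x = qA a -> qC x' = qA a -> qA a = qA a' ->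
  vadd (tB D) (H a x) (H a' x') = H (vadd (bA D) a a') (vadd (bC D) x x').
Proof.
move=> xa xa' aa'; have xa2 : qC x' = qA a' by rewrite -aa'.
have b1 := zero_core xa; have b2 := zero_core xa2.
have b3 : pB (vzero (tA D) a) = pB (vzero (tA D) a').
  by rewrite !(zeroA_proj _).2 aa'.
rewrite /trans_core (vb_addACA vB) ?b3 // -?b3 //.
rewrite -(vbm_add (dvb_zero_mor HA)) // (core_addB (dvb_core hD)) // xa xa' //.
Qed.

Lemma trans_core_scaleB t a x : qC x = qA a ->
  vscale (tB D) t (H a x) = H (vscale (bA D) t a) (vscale (bC D) t x).
Proof.
move=> xa; rewrite /trans_core (vscale_addr vB); last exact: zero_core.
by rewrite -(vbm_scale (dvb_zero_mor HA)) (core_scaleB (dvb_core hD)).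
Qed.

(** The zero section A -> D is linear for the structure of D over B, so compatibility with scaling
    by 0 sends the zero of A to a zero of D -> B. *)
Lemma zero_zero m : vzero (tA D) (vzero (bA D) m) = vzero (tB D) (vzero (bB D) m).
Proof.
have [z1 z2] := zeroA_proj (vzero (bA D) m).
rewrite -{1}(vproj_zero (dvb_bA hD) m) -(vb_scale0 (dvb_bA hD)) (vbm_scale (dvb_zero_mor HA)).
by rewrite (vb_scale0 vB) z2 (vproj_zero (dvb_bA hD)).
Qed.

Lemma trans_core0 x : H (vzero (bA D) (qC x)) x = core x.
Proof.
rewrite /trans_core zero_zero -(core_projB (dvb_core hD)).
exact: (vadd_zero vB).
Qed.

Lemma trans_core_zero a : H a (vzero (bC D) (qA a)) = vzero (tA D) a.
Proof.
have z := vproj_zero (dvb_bC hD) (qA a).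
have [h1 _] := trans_core_proj z.
rewrite -{1}z -(vb_scale0 (dvb_bC hD)) -trans_core_scaleA //.
by rewrite (vb_scale0 vA) h1.
Qed.

(** Subtracting 0_a in D -> B leaves an element that projects to zero in A as well as in B, that is,
    a core element. *)
Lemma trans_core_ex d m : qA (pA d) = m -> pB d = vzero (bB D) m ->
  exists x, qC x = m /\ H (pA d) x = d.
Proof.
move=> am db; have [z1 z2] := zeroA_proj (pA d).
have bb : pB d = pB (vzero (tA D) (pA d)) by rewrite db z2 am.
have bb' : pB d = pB (vscale (tB D) (-1) (vzero (tA D) (pA d))) by rewrite (vproj_scale vB).
have [x xE] : exists x, core x = vadd (tB D) d (vscale (tB D) (-1) (vzero (tA D) (pA d))).
  apply: (core_onto (dvb_core hD) (m := m)).
    rewrite (vbm_add (dvb_proj_mor HA)) // (vbm_scale (dvb_proj_mor HA)) z1.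
    rewrite (vadd_comm (dvb_bA hD)) ?(vproj_scale (dvb_bA hD)) //.
    by rewrite (vadd_opp (dvb_bA hD)) am.
  by rewrite (vproj_add vB).
exists x; split.
  have := sq (core x); rewrite (core_projA (dvb_core hD)) (vproj_zero (dvb_bA hD)) => ->.
  by rewrite xE (vproj_add vB) // db (vproj_zero (dvb_bB hD)).
by rewrite /trans_core xE (vb_subK vB).
Qed.

(** * Splitting coordinates from a lifted frame of B *)

Section Frame.
Context (c : chart R (dM D)) (p q r : nat) (al : dA D -> 'rV[R]_p)
  (be : dB D -> 'rV[R]_q) (ga : dC D -> 'rV[R]_r) (h : 'I_q -> dA D -> dD D).
Hypotheses (tal : is_triv (bA D) c al) (tbe : is_triv (bB D) c be) (tga : is_triv (bC D) c ga).
Hypothesis h_proj : forall i a, cdom c (qA a) ->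
  pA (h i a) = a /\ pB (h i a) = tsec (bB D) be (delta_mx ord0 i) (qA a).
Hypothesis h_add : forall i a a', cdom c (qA a) -> qA a = qA a' ->
  h i (vadd (bA D) a a') = vadd (tB D) (h i a) (h i a').
Hypothesis h_scale : forall i t a, cdom c (qA a) ->
  h i (vscale (bA D) t a) = vscale (tB D) t (h i a).
Hypothesis h_smooth : forall i a, cdom c (qA a) ->
  exists2 c1 : chart R (dD D), smooth_chart c1 &
    smooth_in_charts (h i) (vb_chart qA c al) c1 a.

(** The combination of the h i a with coefficients y, taken in the fibre over a; an arbitrary list
    of indices allows induction. *)
Definition hsum (s : seq 'I_q) (a : dA D) (y : 'rV[R]_q) : dD D :=
  foldr (fun i d => vadd (tA D) (vscale (tA D) (y ord0 i) (h i a)) d) (vzero (tA D) a) s.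
Definition hlift := hsum (index_enum 'I_q).
Local Notation S := hlift.

Lemma hsum_proj s a y : cdom c (qA a) -> pA (hsum s a y) = a.
Proof.
move=> ca; elim: s => [|i s IH] /=; first exact: (zeroA_proj a).1.
have [h1 _] := h_proj i ca.
by rewrite (vproj_add vA) (vproj_scale vA) h1 ?IH.
Qed.

Lemma hsum_coord (c1 : chart R (dA D)) k (tau : dD D -> 'rV[R]_k) s a y :
  cdom c (qA a) -> cdom c1 a -> ztriv (tA D) c1 tau ->
  tau (hsum s a y) = \sum_(i <- s) y ord0 i *: tau (h i a).
Proof.
move=> ca c1a [t1 tz]; elim: s => [|i s IH] /=; first by rewrite big_nil (tz _ c1a).2.
have [h1 _] := h_proj i ca.
have h2 : pA (vscale (tA D) (y ord0 i) (h i a)) = a by rewrite (vproj_scale vA).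
by rewrite (triv_add t1) ?h2 ?hsum_proj // (triv_scale t1) ?h1 // IH big_cons.
Qed.

Lemma be_addA d d' : cdom c (qA (pA d)) -> pA d = pA d' ->
  be (pB (vadd (tA D) d d')) = be (pB d) + be (pB d').
Proof.
move=> cd dd'; rewrite (dvb_add_proj HA) // (triv_add tbe) -?sq // dd' //.
Qed.

Lemma be_scaleA t d : cdom c (qA (pA d)) ->
  be (pB (vscale (tA D) t d)) = t *: be (pB d).
Proof.
by move=> cd; rewrite (vbm_proj (dvb_scale_mor HA t)) (triv_scale tbe) -?sq.
Qed.

Lemma hsum_be s a y : cdom c (qA a) ->
  be (pB (hsum s a y)) = \sum_(i <- s) y ord0 i *: delta_mx ord0 i.
Proof.
move=> ca; elim: s => [|i s IH] /=.
  by rewrite big_nil (zeroA_proj a).2 ((vb_ztriv (dvb_bB hD) tbe).2 _ ca).2.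
have [h1 h2] := h_proj i ca.
have h3 : pA (vscale (tA D) (y ord0 i) (h i a)) = a by rewrite (vproj_scale vA).
rewrite be_addA ?h3 ?hsum_proj // be_scaleA ?h1 // IH big_cons h2.
by rewrite (triv_tsec tbe _ ca).2.
Qed.

Lemma hlift_be a y : cdom c (qA a) -> be (pB (S a y)) = y.
Proof. by move=> ca; rewrite /hlift hsum_be // -row_sum_delta. Qed.

(** Identities in the fibre over a are tested in trivialisations of D -> A, where [hsum] becomes an
    ordinary finite sum ([hsum_coord]). *)
Lemma hlift_inj (d d' : dD D) a : cdom c (qA a) -> pA d = a -> pA d' = a ->
  (forall (c1 : chart R (dA D)) k (tau : dD D -> 'rV[R]_k), cdom c1 a -> ztriv (tA D) c1 tau ->
    tau d = tau d') -> d = d'.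
Proof.
move=> ca da da' tE; have [c1 [k [tau [c1a tz]]]] := vb_triv vA a.
by apply: (triv_inj tz.1); rewrite ?da ?da' // (tE _ _ _ c1a tz).
Qed.

Lemma hlift_addA a y y' : cdom c (qA a) -> S a (y + y') = vadd (tA D) (S a y) (S a y').
Proof.
move=> ca; have P z := hsum_proj (index_enum 'I_q) z ca.
apply: (hlift_inj ca); rewrite ?(vproj_add vA) ?P // => c1 k tau c1a tz.
rewrite (triv_add tz.1) ?P // !(hsum_coord _ _ ca c1a tz) -big_split.
by apply: eq_bigr => i _; rewrite mxE scalerDl.
Qed.

Lemma hlift_scaleA t a y : cdom c (qA a) -> S a (t *: y) = vscale (tA D) t (S a y).
Proof.
move=> ca; have P z := hsum_proj (index_enum 'I_q) z ca.
apply: (hlift_inj ca); rewrite ?(vproj_scale vA) ?P // => c1 k tau c1a tz.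
rewrite (triv_scale tz.1) ?P // !(hsum_coord _ _ ca c1a tz) scaler_sumr.
by apply: eq_bigr => i _; rewrite mxE scalerA.
Qed.

Lemma hlift0 a : cdom c (qA a) -> S a 0 = vzero (tA D) a.
Proof.
move=> ca; have P z := hsum_proj (index_enum 'I_q) z ca.
apply: (hlift_inj ca); rewrite ?P ?(zeroA_proj a).1 // => c1 k tau c1a tz.
by rewrite (hsum_coord _ _ ca c1a tz) (tz.2 _ c1a).2 big1 // => i _; rewrite mxE scale0r.
Qed.

Lemma hlift_delta a i : cdom c (qA a) -> S a (delta_mx ord0 i) = h i a.
Proof.
move=> ca; have P z := hsum_proj (index_enum 'I_q) z ca.
apply: (hlift_inj ca); rewrite ?P ?(h_proj i ca).1 // => c1 k tau c1a tz.
rewrite (hsum_coord _ _ ca c1a tz) (bigD1 i) //= mxE !eqxx scale1r big1 ?addr0 // => j ji.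
by rewrite mxE (negbTE ji) andbF scale0r.
Qed.

Lemma hsum_pB s a a' y : cdom c (qA a) -> qA a = qA a' ->
  pB (hsum s a y) = pB (hsum s a' y).
Proof.
move=> ca aa'; have ca' : cdom c (qA a') by rewrite -aa'.
by apply: (triv_inj tbe); rewrite -?sq ?hsum_proj ?hsum_be.
Qed.

(** The combination is formed over A while additivity is meant over B; the interchange law mediates
    at each step of the fold. *)
Lemma hsum_addB s a a' y : cdom c (qA a) -> qA a = qA a' ->
  hsum s (vadd (bA D) a a') y = vadd (tB D) (hsum s a y) (hsum s a' y).
Proof.
move=> ca aa'; have ca' : cdom c (qA a') by rewrite -aa'.
elim: s => [|i s IH] /=; first exact: (vbm_add (dvb_zero_mor HA)).
have [h1 h2] := h_proj i ca; have [h1' h2'] := h_proj i ca'.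
have bb : pB (h i a) = pB (h i a') by rewrite h2 h2' aa'.
rewrite IH h_add // (vbm_add (dvb_scale_mor HA (y ord0 i))) // (dvb_add_add HA) //.
- by rewrite (vproj_scale vA) h1 hsum_proj.
- by rewrite (vproj_scale vA) h1' hsum_proj.
- by rewrite !(vbm_proj (dvb_scale_mor HA (y ord0 i))) bb.
- exact: hsum_pB.
Qed.

Lemma hsum_scaleB s t a y : cdom c (qA a) ->
  hsum s (vscale (bA D) t a) y = vscale (tB D) t (hsum s a y).
Proof.
move=> ca; elim: s => [|i s IH] /=; first exact: (vbm_scale (dvb_zero_mor HA)).
have [h1 h2] := h_proj i ca.
rewrite IH h_scale // (vbm_scale (dvb_scale_mor HA (y ord0 i))) (dvb_add_scale HA) //.
by rewrite (vproj_scale vA) h1 hsum_proj.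
Qed.

(* Every d over (a, b) is uniquely of the form assemble a (be b) x. *)
Definition assemble a y x := vadd (tA D) (S a y) (H a x).
Local Notation G := assemble.

Lemma assemble_proj a y x : cdom c (qA a) -> qC x = qA a ->
  pA (G a y x) = a /\ be (pB (G a y x)) = y.
Proof.
move=> ca xa; have P := hsum_proj (index_enum 'I_q) y ca; have [h1 h2] := trans_core_proj xa.
split; first by rewrite (vproj_add vA) ?P ?h1.
rewrite be_addA ?P ?h1 // hlift_be // h2.
by rewrite ((vb_ztriv (dvb_bB hD) tbe).2 _ ca).2 addr0.
Qed.

Lemma assemble_addA a y y' x x' : cdom c (qA a) -> qC x = qA a -> qC x' = qA a ->
  vadd (tA D) (G a y x) (G a y' x') = G a (y + y') (vadd (bC D) x x').
Proof.
move=> ca xa xa'; have P z := hsum_proj (index_enum 'I_q) z ca.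
have [h1 h2] := trans_core_proj xa; have [h1' h2'] := trans_core_proj xa'.
by rewrite /assemble (vb_addACA vA) ?P ?h1 ?h1' // -hlift_addA // trans_core_addA.
Qed.

Lemma assemble_scaleA t a y x : cdom c (qA a) -> qC x = qA a ->
  vscale (tA D) t (G a y x) = G a (t *: y) (vscale (bC D) t x).
Proof.
move=> ca xa; have P z := hsum_proj (index_enum 'I_q) z ca.
have [h1 h2] := trans_core_proj xa.
by rewrite /assemble (vscale_addr vA) ?P ?h1 // -hlift_scaleA // trans_core_scaleA.
Qed.

Lemma assemble_addB a a' y x x' : cdom c (qA a) -> qA a = qA a' -> qC x = qA a -> qC x' = qA a ->
  vadd (tB D) (G a y x) (G a' y x') = G (vadd (bA D) a a') y (vadd (bC D) x x').
Proof.
move=> ca aa' xa xa'; have ca' : cdom c (qA a') by rewrite -aa'.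
have P z := hsum_proj (index_enum 'I_q) z ca; have P' z := hsum_proj (index_enum 'I_q) z ca'.
have xa2 : qC x' = qA a' by rewrite -aa'.
have [h1 h2] := trans_core_proj xa; have [h1' h2'] := trans_core_proj xa2.
rewrite /assemble -(dvb_add_add HA) ?P ?P' ?h1 ?h1' ?h2 ?h2' ?aa' //; last exact: hsum_pB.
by rewrite -hsum_addB // trans_core_addB.
Qed.

Lemma assemble_scaleB t a y x : cdom c (qA a) -> qC x = qA a ->
  vscale (tB D) t (G a y x) = G (vscale (bA D) t a) y (vscale (bC D) t x).
Proof.
move=> ca xa; have P z := hsum_proj (index_enum 'I_q) z ca.
have [h1 h2] := trans_core_proj xa.
by rewrite /assemble -(dvb_add_scale HA) ?P ?h1 // -hsum_scaleB // trans_core_scaleB.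
Qed.

Lemma assemble_inj a y x x' : cdom c (qA a) -> qC x = qA a -> qC x' = qA a ->
  G a y x = G a y x' -> x = x'.
Proof.
move=> ca xa xa'; have P z := hsum_proj (index_enum 'I_q) z ca.
have [h1 h2] := trans_core_proj xa; have [h1' h2'] := trans_core_proj xa'.
move=> /(vb_cancel vA); rewrite P h1 h1' => /(_ erefl erefl) /(vb_cancel vB).
by move=> /(_ (zero_core xa) (zero_core xa')) /(core_inj (dvb_core hD)).
Qed.

(** Subtracting over A the lift with the same B-coordinates leaves an element over a zero of B,
    which is a translate of the core. *)
Lemma assemble_ex d : cdom c (qA (pA d)) ->
  exists x, qC x = qA (pA d) /\ G (pA d) (be (pB d)) x = d.
Proof.
move=> cd; have P z := hsum_proj (index_enum 'I_q) z cd.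
pose s := S (pA d) (be (pB d)).
have ps : pA d = pA (vscale (tA D) (-1) s) by rewrite (vproj_scale vA) P.
pose d' := vadd (tA D) d (vscale (tA D) (-1) s).
have da' : pA d' = pA d by rewrite (vproj_add vA).
have db' : pB d' = vzero (bB D) (qA (pA d)).
  have [z1 z2] := (vb_ztriv (dvb_bB hD) tbe).2 _ cd.
  apply: (triv_inj tbe); rewrite -?sq ?da' ?z1 // z2.
  by rewrite be_addA // be_scaleA ?P // hlift_be // scaleN1r subrr.
have [|x [xm xE]] := trans_core_ex _ db'; first by rewrite da'.
exists x; split=> //; rewrite da' in xE.
by rewrite /assemble xE /d' (vb_subK vA) // P.
Qed.

Definition core_part (d : dD D) : dC D := the (vzero (bC D) (qA (pA d)))
  [set x | qC x = qA (pA d) /\ G (pA d) (be (pB d)) x = d].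

Lemma core_partP d : cdom c (qA (pA d)) ->
  qC (core_part d) = qA (pA d) /\ G (pA d) (be (pB d)) (core_part d) = d.
Proof.
move=> cd; apply: (@theP _ (vzero (bC D) (qA (pA d)))
  [set x | qC x = qA (pA d) /\ G (pA d) (be (pB d)) x = d]).
exact: assemble_ex.
Qed.

Lemma core_part_assemble a y x : cdom c (qA a) -> qC x = qA a -> core_part (G a y x) = x.
Proof.
move=> ca xa; have [h1 h2] := assemble_proj y ca xa.
have [|g1 g2] := @core_partP (G a y x); first by rewrite h1.
move: g2; rewrite h1 h2; apply: assemble_inj => //; by rewrite g1 h1.
Qed.

Lemma assemble_hlift a y : cdom c (qA a) -> G a y (vzero (bC D) (qA a)) = S a y.
Proof.
move=> ca; have P := hsum_proj (index_enum 'I_q) y ca.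
by rewrite /assemble trans_core_zero -{2}P (vb_addr0 vA).
Qed.

Lemma assemble_trans_core a x : cdom c (qA a) -> qC x = qA a -> G a 0 x = H a x.
Proof.
move=> ca xa; have [h1 h2] := trans_core_proj xa.
by rewrite /assemble hlift0 // -{1}h1 (vadd_zero vA).
Qed.

Local Notation de := (fun d => ga (core_part d)).

Lemma decomp_inj d d' : cdom c (qA (pA d)) -> pA d = pA d' -> be (pB d) = be (pB d') ->
  de d = de d' -> d = d'.
Proof.
move=> cd aa bb gg; have cd' : cdom c (qA (pA d')) by rewrite -aa.
have [x1 <-] := core_partP cd; have [x2 <-] := core_partP cd'.
rewrite aa bb; congr G; apply: (triv_inj tga); rewrite ?x1 ?x2 //.
by rewrite aa.
Qed.

Lemma decomp_ex a y z : cdom c (qA a) -> exists d, [/\ pA d = a, be (pB d) = y & de d = z].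
Proof.
move=> ca; have [x1 x2] := triv_tsec tga z ca.
have [h1 h2] := assemble_proj y ca x1.
by exists (G a y (tsec (bC D) ga z (qA a))); rewrite core_part_assemble.
Qed.

(** The map is the sum, over B, of the zero section of D -> A and of the core inclusion along a
    frame section of C; both are smooth into a chart of D -> B. *)
Lemma decomp_smooth_core j a : cdom c (qA a) ->
  exists2 c1 : chart R (dD D), smooth_chart c1 &
    smooth_in_charts (fun a => H a (tsec (bC D) ga (delta_mx ord0 j) (qA a)))
      (vb_chart qA c al) c1 a.
Proof.
move=> ca; have L := dvb_is_laws hD; have [coM coA coB coC coD] := lw_cov L.
have [c1 [k1 [tau1 [c1b [t1 _]]]]] := vb_triv vB (vzero (bB D) (qA a)).
have secP m : cdom c m -> qC (tsec (bC D) ga (delta_mx ord0 j) m) = m /\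
    ga (tsec (bC D) ga (delta_mx ord0 j) m) = delta_mx ord0 j by exact: (triv_tsec tga).
have [[_ oc] _] := triv_base tal.
have [[_ oca] _] := triv_chart tal.
exists (vb_chart pB c1 tau1); first exact: triv_chart t1.
apply: sic_vadd => //.
- by have [_ _ _ _ ?] := lw_fib L.
- by move=> a' ca'; apply: zero_core; rewrite (secP _ ca').1.
- apply: (smooth_sic (vbm_smooth (dvb_zero_mor HA))) => //.
  + exact: triv_chart tal.
  + exact: triv_chart t1.
  + by rewrite /= (zeroA_proj a).2.
have s1 : smooth_in_charts qA (vb_chart qA c al) c a.
  apply: (@sic_of R _ _ qA (vb_chart qA c al) c (fun z : 'rV[R]_(cdim c + p) => lsubmx z)) => //.
    by apply: Cinfty_lsub => //; exact: Cinfty_id.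
  by move=> a' ca' /=; rewrite row_mxKl.
have s2 : smooth_in_charts (tsec (bC D) ga (delta_mx ord0 j)) c (vb_chart qC c ga) (qA a).
  apply: (@sic_of R _ _ _ c (vb_chart qC c ga)
      (fun x : 'rV[R]_(cdim c) => row_mx x (delta_mx ord0 j))) => //.
    by apply: Cinfty_row => //; [exact: Cinfty_id|exact: Cinfty_cst].
  by move=> m cm /=; have [-> ->] := secP m cm.
apply: (@sic_comp R _ _ _
    (fun a => tsec (bC D) ga (delta_mx ord0 j) (qA a)) core _ _ _ a (sic_comp s1 s2)).
apply: (smooth_sic (core_smooth (dvb_core hD))) => //.
- exact: triv_chart tga.
- exact: triv_chart t1.
- by rewrite /= (secP _ ca).1.
- by rewrite /= (core_projB (dvb_core hD)) (secP _ ca).1.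
Qed.

Lemma decomp_trivA :
  is_triv (tA D) (vb_chart qA c al) (fun d => row_mx (be (pB d)) (de d)).
Proof.
have L := dvb_is_laws hD; have [coM coA coB coC coD] := lw_cov L.
have [fA fB fC fv fw] := lw_fib L.
have bij a y : cdom c (qA a) ->
    exists! d, pA d = a /\ row_mx (be (pB d)) (de d) = y.
  move=> ca; have [d [d1 d2 d3]] := decomp_ex (lsubmx y) (rsubmx y) ca.
  exists d; split; first by rewrite d2 d3 hsubmxK.
  move=> d' [d1' ey]; move: ey; rewrite -[y]hsubmxK => /eq_row_mx[e1 e2].
  by apply: decomp_inj; rewrite ?d1 ?d1' // ?d2 ?d3.
(* Identifies the frame sections, which are chosen by [the], with explicit elements of D. *)
have secE y a d : cdom c (qA a) -> pA d = a -> row_mx (be (pB d)) (de d) = y ->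
    tsec (tA D) (fun d => row_mx (be (pB d)) (de d)) y a = d.
  move=> ca da dy; have [d0 [_ u]] := bij a y ca.
  have [|s1 s2] := @tsecP R _ _ (tA D) _ (fun d => row_mx (be (pB d)) (de d)) y a;
      first by exists d.
  by rewrite -(u _ (conj s1 s2)) -(u d).
apply: (triv_of_frame coA fv) => //.
- exact: triv_chart tal.
- move=> d d' cd aa; have cd' : cdom c (qA (pA d')) by rewrite -aa.
  have [x1 g1] := core_partP cd; have [x2 g2] := core_partP cd'.
  have x2' : qC (core_part d') = qA (pA d) by rewrite x2 aa.
  have E : vadd (tA D) d d' = G (pA d) (be (pB d) + be (pB d'))
      (vadd (bC D) (core_part d) (core_part d')).
    by rewrite -assemble_addA // g1 aa g2.
  have xx : qC (vadd (bC D) (core_part d) (core_part d')) = qA (pA d).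
    by rewrite fC.1 ?x1 ?x2'.
  have [h1 h2] := assemble_proj (be (pB d) + be (pB d')) cd xx.
  by rewrite add_row_mx E h2 core_part_assemble // (triv_add tga) ?x1 ?x2'.
- move=> t d cd; have [x1 g1] := core_partP cd.
  have E : vscale (tA D) t d = G (pA d) (t *: be (pB d)) (vscale (bC D) t (core_part d)).
    by rewrite -assemble_scaleA // g1.
  have xx : qC (vscale (bC D) t (core_part d)) = qA (pA d) by rewrite fC.2.
  have [h1 h2] := assemble_proj (t *: be (pB d)) cd xx.
  by rewrite scale_row_mx E h2 core_part_assemble // (triv_scale tga) ?x1.
move=> a ca; have [c1 [k1 [tau1 [c1a [t1 _]]]]] := vb_triv vA a.
exists c1, k1, tau1; split=> // j.
have [f [fE [c2 sc2 sf]]] : exists f : dA D -> dD D,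
    (forall a, cdom c (qA a) -> f a = tsec (tA D)
        (fun d => row_mx (be (pB d)) (de d)) (delta_mx ord0 j) a) /\
    exists2 c1 : chart R (dD D), smooth_chart c1 & smooth_in_charts f (vb_chart qA c al) c1 a.
  (* The first q frame sections are the [h i]; the remaining r are the translates of the frame of
     the core. *)
  case: (split_ordP j) => i ->.
    exists (h i); split; last exact: h_smooth.
    move=> a' ca'; apply/esym; apply: secE => //; first exact: (h_proj i ca').1.
    have z := vproj_zero (dvb_bC hD) (qA a').
    rewrite -hlift_delta // -assemble_hlift // (assemble_proj _ ca' z).2 core_part_assemble //.
    rewrite ((vb_ztriv (dvb_bC hD) tga).2 _ ca').2.
    apply/rowP => l; case: (split_ordP l) => l' ->;
        first by rewrite row_mxEl !mxE (inj_eq (@lshift_inj _ _)).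
    by rewrite row_mxEr !mxE eq_rlshift andbF.
  exists (fun a => H a (tsec (bC D) ga (delta_mx ord0 i) (qA a))); split;
      last exact: decomp_smooth_core.
  move=> a' ca'; have [x1 x2] := triv_tsec tga (delta_mx ord0 i) ca'.
  apply/esym; apply: secE => //; first exact: (trans_core_proj x1).1.
  rewrite -assemble_trans_core // (assemble_proj _ ca' x1).2 core_part_assemble // x2.
  apply/rowP => l; case: (split_ordP l) => l' ->; first by rewrite row_mxEl !mxE eq_lrshift andbF.
  by rewrite row_mxEr !mxE (inj_eq (@rshift_inj _ _)).
apply: (@sic_ext R _ _ f _ (vb_chart qA c al) _ a fE); apply: (@sic_comp R _ _ _ f id _ c2 _ a sf).
have [_ c2a] := sic_dom sf.
apply: sic_smooth_charts => //; first exact: triv_chart t1.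
have [|s1 s2] := @tsecP R _ _ (tA D) _ (fun d => row_mx (be (pB d)) (de d)) (delta_mx ord0 j) a.
  by have [d [? _]] := bij a (delta_mx ord0 j) ca; exists d.
by rewrite /= fE // s1.
Qed.

Lemma split_frame : split c al be ga de.
Proof.
have L := dvb_is_laws hD; have [coM coA coB coC coD] := lw_cov L.
have [fA fB fC fv fw] := lw_fib L.
split.
- exact: vb_ztriv (dvb_bA hD) _ _ _ tal.
- exact: vb_ztriv (dvb_bB hD) _ _ _ tbe.
- exact: tga.
- exact: vb_ztriv vA _ _ _ decomp_trivA.
- apply: (vb_ztriv vB); split.
  + exact: triv_chart tbe.
  + move=> d d'; rewrite /= -sq => cd bb.
    have aa : qA (pA d) = qA (pA d') by rewrite !sq bb.
    have cd' : cdom c (qA (pA d')) by rewrite -aa.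
    have [x1 g1] := core_partP cd; have [x2 g2] := core_partP cd'.
    have x2' : qC (core_part d') = qA (pA d) by rewrite x2 aa.
    have E : vadd (tB D) d d' = G (vadd (bA D) (pA d) (pA d')) (be (pB d))
        (vadd (bC D) (core_part d) (core_part d')).
      by rewrite -assemble_addB // g1 bb g2.
    have qq : qA (vadd (bA D) (pA d) (pA d')) = qA (pA d) by rewrite fA.1.
    have xx : qC (vadd (bC D) (core_part d) (core_part d')) = qA (vadd (bA D) (pA d) (pA d')).
      by rewrite qq fC.1 ?x1 ?x2'.
    have cc : cdom c (qA (vadd (bA D) (pA d) (pA d'))) by rewrite qq.
    have [h1 h2] := assemble_proj (be (pB d)) cc xx.
    by rewrite add_row_mx E h1 core_part_assemble // (triv_add tga) ?x1 ?x2' // (triv_add tal).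
  + move=> t d; rewrite /= -sq => cd; have [x1 g1] := core_partP cd.
    have E : vscale (tB D) t d = G (vscale (bA D) t (pA d)) (be (pB d))
        (vscale (bC D) t (core_part d)).
      by rewrite -assemble_scaleB // g1.
    have qq : qA (vscale (bA D) t (pA d)) = qA (pA d) by rewrite fA.2.
    have xx : qC (vscale (bC D) t (core_part d)) = qA (vscale (bA D) t (pA d)) by rewrite qq fC.2.
    have cc : cdom c (qA (vscale (bA D) t (pA d))) by rewrite qq.
    have [h1 h2] := assemble_proj (be (pB d)) cc xx.
    by rewrite scale_row_mx E h1 core_part_assemble // (triv_scale tga) ?x1 // (triv_scale tal).
  + move=> b y /= cb; have [a1 a2] := triv_tsec tal (lsubmx y) cb.
    have [|d [d1 d2 d3]] := @decomp_ex (tsec (bA D) al (lsubmx y) (qB b)) (be b) (rsubmx y).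
      by rewrite a1.
    have db : pB d = b by apply: (triv_inj tbe); rewrite -?sq ?d1 ?a1.
    exists d; split; first by rewrite d1 a2 d3 hsubmxK.
    move=> d' [db' ey]; move: ey; rewrite -[y]hsubmxK => /eq_row_mx[e1 e2].
    have aa : pA d = pA d' by apply: (triv_inj tal); rewrite ?sq ?db ?db' // e1 d1 a2.
    by apply: decomp_inj; rewrite ?d1 ?a1 // -?d1 ?db ?db' ?d3.
  (* The chart for D -> B is the one for D -> A with its middle blocks exchanged, so no second frame
     argument is required. *)
  + move: (triv_chart decomp_trivA).
    set c1 := (X in smooth_chart X -> _); set c2 := (X in _ -> smooth_chart X) => sc.
    apply: (@smooth_chart_repar R (dD D) c1 c2 (@shuffle R (cdim c) p q r)
        (@shuffle R (cdim c) q p r) sc).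
    * exact: Cinfty_shuffle.
    * exact: Cinfty_shuffle.
    * exact: shuffleK.
    * exact: shuffleK.
    * by move=> d /=; rewrite sq.
    * by move=> d /= cd; rewrite shuffleE sq.
- move=> x cx; split; [exact: core_projA (dvb_core hD) _|exact: core_projB (dvb_core hD) _|].
  have z := vproj_zero (dvb_bA hD) (qC x).
  rewrite -{1}trans_core0 -assemble_trans_core ?z // core_part_assemble ?z //.
Qed.

End Frame.

Lemma locally_split_dvb : locally_split D.
Proof.
move=> m0; have L := dvb_is_laws hD; have [coM coA coB coC coD] := lw_cov L.
have [fA fB fC fv fw] := lw_fib L.
have [cA [p [al [cAm tA0]]]] := vb_locally_trivial (dvb_bA hD) m0.
have [cB [q [be [cBm tB0]]]] := vb_locally_trivial (dvb_bB hD) m0.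
have [cC [r [ga [cCm tC0]]]] := vb_locally_trivial (dvb_bC hD) m0.
pose c0 := chart_restr (chart_restr cA (cdom cB)) (cdom cC).
have sc0 : smooth_chart c0.
  apply: smooth_chart_cap => //; last exact: triv_base tC0.
  by apply: smooth_chart_cap => //; [exact: triv_base tA0|exact: triv_base tB0].
have c0m : cdom c0 m0 by [].
have tal : is_triv (bA D) c0 al by apply: (triv_rebase coM tA0) => // m [[]].
have tbe : is_triv (bB D) c0 be by apply: (triv_rebase coM tB0) => // m [[]].
have tga : is_triv (bC D) c0 ga by apply: (triv_rebase coM tC0) => // m [[]].
have /choice[Oh OhP] i : exists Oh : set (dM D) * (dA D -> dD D),
  [/\ Oh.1 m0,
      forall m, cdom c0 m -> Oh.1 m -> exists W, [/\ open W, W (cmap c0 m) &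
        forall m', cdom c0 m' -> W (cmap c0 m') -> Oh.1 m'],
      forall a, cdom c0 (qA a) -> Oh.1 (qA a) ->
        pA (Oh.2 a) = a /\ pB (Oh.2 a) = tsec (bB D) be (delta_mx ord0 i) (qA a),
      (forall a a', cdom c0 (qA a) -> Oh.1 (qA a) -> qA a = qA a' ->
         Oh.2 (vadd (bA D) a a') = vadd (tB D) (Oh.2 a) (Oh.2 a')) /\
      (forall t a, cdom c0 (qA a) -> Oh.1 (qA a) ->
         Oh.2 (vscale (bA D) t a) = vscale (tB D) t (Oh.2 a)) &
      forall c, smooth_chart c -> cdom c `<=` cdom c0 -> cdom c `<=` Oh.1 ->
        forall a, cdom c (qA a) -> exists2 c1 : chart R (dD D), smooth_chart c1 &
          smooth_in_charts Oh.2 (vb_chart qA c al) c1 a].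
  by have [U0 [h0 Hh]] := lift_section hD (delta_mx ord0 i) tal tbe c0m; exists (U0, h0).
(* Only finitely many frame sections are lifted, so the intersection of their domains is still
   open. *)
pose c := chart_restr c0 [set m | forall i : 'I_q, (Oh i).1 m].
have sc : smooth_chart c.
  by apply: smooth_chart_restr_fin => // i m cm; have [_ hO _ _ _] := OhP i; exact: hO.
have sub : cdom c `<=` cdom c0 by move=> m [].
have sub' i : cdom c `<=` (Oh i).1 by move=> m [].
exists c, p, q, r, al, be, ga; eexists; split.
  by split=> // i; have [] := OhP i.
apply: (@split_frame c p q r al be ga (fun i => (Oh i).2)).
- by apply: (triv_rebase coM tal).
- by apply: (triv_rebase coM tbe).
- by apply: (triv_rebase coM tga).
- by move=> i a ca; have [_ _ hO _ _] := OhP i; apply: hO; [exact: sub|exact: sub'].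
- by move=> i a a' ca; have [_ _ _ [hO _] _] := OhP i; apply: hO => //; [exact: sub|exact: sub'].
- by move=> i t a ca; have [_ _ _ [_ hO] _] := OhP i; apply: hO; [exact: sub|exact: sub'].
- by move=> i a ca; have [_ _ _ _ hO] := OhP i; apply: hO => //; exact: sub'.
Qed.

End Decomposition.

(** * The reversal isomorphism *)

Section Reversal.
Context (R : realType) (D : dvb R).
Hypotheses (L : dvb_laws D) (LS : locally_split D).

Let Lf : dvb_laws (flip D) := laws_flip L.
Let LSf : locally_split (flip D) := locally_split_flip LS.
Let LB : dvb_laws (dualB D) := laws_flip (laws_dualA Lf LSf).

Local Notation qA := (vproj (bA D)).
Local Notation qB := (vproj (bB D)).
Local Notation pA := (vproj (tA D)).
Local Notation pB := (vproj (tB D)).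
Local Notation base calB := (dbase (dbase (calB : dual_pt (tA (dualB D))) : dual_pt (bC D))).

(** * The defining equation in coordinates *)

Section Coordinates.
Context (c : chart R (dM D)) (p q r : nat) (al : dA D -> 'rV[R]_p)
  (be : dB D -> 'rV[R]_q) (ga : dC D -> 'rV[R]_r) (de : dD D -> 'rV[R]_r).
Hypothesis S : split c al be ga de.

Let Sf := split_flip S.
(** In the coordinate form of the equation, [deB] gives w, [deBC] gives s and [alBC] gives t. *)
Definition deB : dD (dualB D) -> 'rV[R]_p := @dlt R (flip D) p r al de.
Let SB : @split R (dualB D) c r q p (dcoord (v := bC D) ga) be (dcoord (v := bA D) al) deB :=
  split_flip (split_dualA Lf Sf).
Definition deBC : dD (dualBC D) -> 'rV[R]_q := @dlt R (dualB D) q p be deB.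
Definition alBC : dA (dualBC D) -> 'rV[R]_p := dcoord (v := dual_vb (bA D)) (dcoord (v := bA D) al).

Lemma split_dualBC :
  @split R (dualBC D) c p r q alBC (dcoord (v := bC D) ga) (dcoord (v := bB D) be) deBC.
Proof. exact: split_flip (split_dualA LB SB). Qed.

Lemma pairingB (Psi : dD (dualB D)) d :
  cdom c (qB (dbase (Psi : dual_pt (tB D)))) -> pB d = dbase (Psi : dual_pt (tB D)) ->
  pairing Psi d = dot (deB Psi) (al (pA d)) +
    dot (dcoord (v := bC D) ga (vproj (tA (dualB D)) Psi)) (de d).
Proof.
move=> cb db; rewrite [LHS](pairingA Lf Sf cb db).
by have [_ <-] := dualA_projP Lf Sf cb.
Qed.

Lemma pairingBC (calB : dD (dualBC D)) (Psi : dD (dualB D)) :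
  cdom c (base calB) -> vproj (tA (dualB D)) Psi = dbase (calB : dual_pt (tA (dualB D))) ->
  pairing calB Psi = dot (deBC calB) (be (vproj (tB (dualB D)) Psi)) +
    dot (alBC (vproj (tA (dualBC D)) calB)) (deB Psi).
Proof.
move=> cb db; rewrite [LHS](pairingA LB SB cb db).
by have [_ <-] := dualA_projP LB SB cb.
Qed.

(** Equality of the projections to C^* is not imposed by [reversal_graph]; it results from varying
    de d, just as the sign in the last clause results from varying be d. *)
Lemma graph_coords (calB : dD (dualBC D)) (Phi : dD (dualA D)) : cdom c (base calB) ->
  reversal_graph calB Phi <->
  [/\ qA (dbase (Phi : dual_pt (tA D))) = base calB,
      al (dbase (Phi : dual_pt (tA D))) = alBC (vproj (tA (dualBC D)) calB),
      dualA_proj (D := D) Phi = vproj (tB (dualBC D)) calB &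
      dlt be de Phi = - deBC calB].
Proof.
move=> cm; split=> [[qE eqn]|[qE alE pE dE]]; last first.
  split=> // Psi d [c1 c2 c3].
  have cPhi : cdom c (qA (dbase (Phi : dual_pt (tA D)))) by rewrite qE.
  have cP : cdom c (qB (dbase (Psi : dual_pt (tB D)))).
    by move: cPhi; rewrite -[dbase _]c2 (lw_sq L) c3.
  rewrite (pairingBC cm c1) (pairingA L S cPhi c2) (pairingB cP c3).
  have [_ kE] := dualA_projP L S cPhi; rewrite -kE pE.
  rewrite dE c2 alE dotNl c1 c3 (dotC _ (deB Psi)).
  by rewrite addrACA subrr add0r.
have cPhi : cdom c (qA (dbase (Phi : dual_pt (tA D)))) by rewrite qE.
have [pE kE] := dualA_projP L S cPhi.
have [_ _ fC _ _] := lw_fib L.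
set a := dbase (Phi : dual_pt (tA D)) in qE cPhi pE.
set kappa : dual_pt (bC D) := dbase (calB : dual_pt (tA (dualB D))) in cm qE.
(* The three vectors are arbitrary: y and z determine a d over a, and w then determines a Psi over
   [pB d] that projects to kappa. *)
have key y z w : dot (deBC calB) y + dot (alBC (vproj (tA (dualBC D)) calB)) w +
    (dot (dlt be de Phi) y + dot (kap be de Phi) z) =
    dot w (al a) + dot (dcoord (v := bC D) ga kappa) z.
  have [d [da dy dz]] := sp_ex S y z cPhi.
  have cb : cdom c (qB (pB d)) by rewrite -(lw_sq L) da.
  have [Psi [Pb Pf Pk]] := dualA_ex Lf Sf w (dcoord (v := bC D) ga kappa) cb.
  have pk : vproj (tA (dualB D)) Psi = kappa.
    have [|q1 q2] := dualA_projP Lf Sf (Phi := Psi); first by rewrite Pb.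
    apply: (dcoord_inj fC (sp_bC S)).
    - by rewrite [dbase _]q1 Pb.
    - by rewrite [LHS]q1 Pb -(lw_sq L) da; exact: qE.
    - by rewrite [LHS]q2.
  have := eqn Psi d (And3 pk da (esym Pb)).
  rewrite (pairingBC cm pk) (pairingA L S cPhi da) (pairingB (Psi := Psi)) ?Pb // pk.
  by rewrite [vproj (tB (dualB D)) Psi]Pb dy dz da [deB Psi]Pf.
(* Coefficients are compared by keeping one of w, y, z and setting the other two to 0. *)
have E1 : al a = alBC (vproj (tA (dualBC D)) calB).
  apply: dot_inj => w; have := key 0 0 w; rewrite !dot0r !addr0 add0r => ->.
  by rewrite dotC.
have E2 : dlt be de Phi = - deBC calB.
  apply: dot_inj => y; have := key y 0 0; rewrite !dot0r !dot0l !addr0 dotNl => /eqP.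
  by rewrite addrC addr_eq0 => /eqP.
have E3 : kap be de Phi = dcoord (v := bC D) ga kappa.
  by apply: dot_inj => z; have := key 0 z 0; rewrite !dot0r !dot0l !add0r.
split=> //; apply: (dcoord_inj fC (sp_bC S)).
- by rewrite [dbase _]pE.
- by rewrite [LHS]pE; exact: qE.
- by rewrite kE E3.
Qed.

Lemma graph_ex (calB : dD (dualBC D)) : cdom c (base calB) ->
  exists! Phi : dD (dualA D), reversal_graph calB Phi.
Proof.
move=> cm; have [_ _ fC _ _] := lw_fib L.
have [a [am ax]] := triv_ex (sp_bA S).1 (alBC (vproj (tA (dualBC D)) calB)) cm.
have ca : cdom c (qA a) by rewrite am.
have [Phi [Pa Pf Pk]] := dualA_ex L S (- deBC calB)
  (dcoord (v := bC D) ga (vproj (tB (dualBC D)) calB)) ca.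
have cP : cdom c (qA (dbase Phi)) by rewrite Pa.
exists Phi; split.
  apply/(graph_coords _ cm); split=> //; rewrite ?Pa //.
  have [p1 p2] := dualA_projP L S cP.
  apply: (dcoord_inj fC (sp_bC S)).
  - by rewrite [dbase _]p1.
  - by rewrite [LHS]p1 Pa am.
  - by rewrite p2 Pk.
move=> Phi' /(graph_coords _ cm) [q1 q2 q3 q4].
have aa : dbase Phi = dbase (Phi' : dual_pt (tA D)).
  by rewrite Pa; apply: (triv_inj (sp_bA S).1); rewrite ?am ?q1 // ax q2.
have cP' : cdom c (qA (dbase (Phi' : dual_pt (tA D)))) by rewrite -aa.
have [_ k'] := dualA_projP L S cP'.
by apply: (dualA_inj L S); rewrite ?Pf ?q4 // Pk -k' q3.
Qed.

End Coordinates.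

(** Inverse of the evaluation map [bidual]. The first side of [dualBC D] is the double dual of A, so
    to preserve A means to cover this map. *)
Definition undual (xi : dA (dualBC D)) : dA D :=
  the (vzero (bA D) (dbase (xi : dual_pt (dual_vb (bA D)))))
    [set a | qA a = dbase (xi : dual_pt (dual_vb (bA D))) /\
       forall eps : dual_pt (bA D), dbase eps = qA a -> pairing xi eps = pairing eps a].

(** Dualising coordinates twice gives back those of A, since the pairing is one sum read in two
    orders ([dotC]). *)
Lemma undualP (c : chart R (dM D)) p (al : dA D -> 'rV[R]_p) (xi : dual_pt (dual_vb (bA D))) :
  is_triv (bA D) c al -> cdom c (dbase xi) ->
  qA (undual xi) = dbase xi /\ al (undual xi) = alBC al xi.
Proof.
move=> tal cm; have [fA _ _ _ _] := lw_fib L; have [coM coA _ _ _] := lw_cov L.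
have tal' := (dual_triv fA coM coA tal).1.
have [am aP] : [set a | qA a = dbase xi /\
    forall eps : dual_pt (bA D), dbase eps = qA a -> pairing xi eps = pairing eps a] (undual xi).
  apply: theP.
  have [a [am ax]] := triv_ex tal (alBC al xi) cm.
  exists a; split=> // eps em.
  rewrite (dcoordP (fibrewise_dual fA) tal') ?[vproj _ _]em //.
  by rewrite (dcoordP fA tal) ?em ?am // ax dotC.
split=> //; apply: dot_inj => y.
have [eps [em ey]] := dcoord_ex fA tal y cm.
have := aP eps; rewrite am em => /(_ erefl).
rewrite (dcoordP (fibrewise_dual fA) tal') ?[vproj _ _]em //.
by rewrite (dcoordP fA tal) ?em ?am // ey => E1; rewrite dotC -E1.
Qed.

Lemma bidualP (c : chart R (dM D)) p (al : dA D -> 'rV[R]_p) a :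
  is_triv (bA D) c al -> cdom c (qA a) ->
  dbase (bidual (bA D) a : dual_pt (dual_vb (bA D))) = qA a /\ alBC al (bidual (bA D) a) = al a.
Proof.
move=> tal cm; have [fA _ _ _ _] := lw_fib L; have [coM coA _ _ _] := lw_cov L.
have tal' := (dual_triv fA coM coA tal).1.
have [xm xP] : [set xi : dual_pt (dual_vb (bA D)) | dbase xi = qA a /\
       forall eps : dual_pt (bA D), dbase eps = qA a ->
         pairing xi eps = pairing eps a] (bidual (bA D) a).
  apply: theP.
  have [xi [xm xE]] := dcoord_ex (fibrewise_dual fA) tal' (al a) cm.
  exists xi; split=> // eps em.
  rewrite (dcoordP (fibrewise_dual fA) tal') ?xm ?[vproj _ _]em //.
  by rewrite (dcoordP fA tal) ?em // xE dotC.
split=> //; apply: (dcoord_uniq (fibrewise_dual fA) tal'); rewrite ?xm // => eps em.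
by rewrite xP ?(dcoordP fA tal) -?em // ?[dbase _]em // dotC.
Qed.

Lemma bidualK a : undual (bidual (bA D) a) = a.
Proof.
have [c [p [q [r [al [be [ga [de [cm S]]]]]]]]] := LS (qA a).
have [b1 b2] := bidualP (sp_bA S).1 cm.
have [|u1 u2] := undualP (xi := bidual (bA D) a) (sp_bA S).1; first by rewrite b1.
by apply: (triv_inj (sp_bA S).1); rewrite ?u1 ?b1 // u2.
Qed.

Lemma undualK xi : bidual (bA D) (undual xi) = xi.
Proof.
have [fA _ _ _ _] := lw_fib L; have [coM coA _ _ _] := lw_cov L.
have [c [p [q [r [al [be [ga [de [cm S]]]]]]]]] := LS (dbase (xi : dual_pt (dual_vb (bA D)))).
have [u1 u2] := undualP (sp_bA S).1 cm.
have [|b1 b2] := bidualP (a := undual xi) (sp_bA S).1; first by rewrite u1.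
apply: (dcoord_inj (fibrewise_dual fA) (dual_triv fA coM coA (sp_bA S).1).1).
- by rewrite b1 u1.
- by rewrite b1 u1.
- by rewrite [LHS]b2 u2.
Qed.

(* The reversal in coordinates: (m, kappa; s, t) |-> (m, t; - s, kappa). *)
Definition revmap n a b e (z : 'rV[R]_(n + a + (b + e))) : 'rV[R]_(n + e + (b + a)) :=
  row_mx (row_mx (lsubmx (lsubmx z)) (rsubmx (rsubmx z)))
         (row_mx (- lsubmx (rsubmx z)) (rsubmx (lsubmx z))).

Lemma revmapE n a b e (x : 'rV[R]_n) (y : 'rV[R]_a) (z : 'rV[R]_b) (w : 'rV[R]_e) :
  revmap (row_mx (row_mx x y) (row_mx z w)) = row_mx (row_mx x w) (row_mx (- z) y).
Proof. by rewrite /revmap !(row_mxKl, row_mxKr). Qed.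

Lemma Cinfty_revmap n a b e (W : set 'rV[R]_(n + a + (b + e))) : open W ->
  Cinfty W (@revmap n a b e).
Proof.
move=> oW; have Cid : Cinfty W (fun z => z) by exact: Cinfty_id.
by apply: Cinfty_row => //; apply: Cinfty_row => //; try apply: CinftyN => //;
  do ?[apply: Cinfty_lsub => // | apply: Cinfty_rsub => //].
Qed.

(** [is_mfd] is not established for the duals, so even the identity is shown smooth from one smooth
    chart around each point. *)
Lemma smooth_id_of (X : mfd R) : covered X ->
  (forall x : X, exists c : chart R X, smooth_chart c /\ cdom c x) -> smooth (@id X).
Proof.
move=> coX H; apply: smooth_of_sic => // x; have [c [sc cx]] := H x.
by exists c, c; split=> //; exact: sic_smooth_charts.
Qed.

End Reversal.

(** * The reversal as an isomorphism of double vector bundles *)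

Section ReversalIso.
Context (R : realType) (D : dvb R).
Hypotheses (L : dvb_laws D) (LS : locally_split D).

Let Lf : dvb_laws (flip D) := laws_flip L.
Let LSf : locally_split (flip D) := locally_split_flip LS.
Let LB : dvb_laws (dualB D) := laws_flip (laws_dualA Lf LSf).
Let LSB : locally_split (dualB D) := locally_split_flip (locally_split_dualA Lf LSf).
Let LBC : dvb_laws (dualBC D) := laws_flip (laws_dualA LB LSB).
Let LA : dvb_laws (dualA D) := laws_dualA L LS.

Local Notation qA := (vproj (bA D)).
Local Notation base calB := (dbase (dbase (calB : dual_pt (tA (dualB D))) : dual_pt (bC D))).
Local Notation pA1 := (vproj (tA (dualBC D))).
Local Notation pB1 := (vproj (tB (dualBC D))).
Local Notation pA2 := (vproj (tA (dualA D))).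
Local Notation pB2 := (vproj (tB (dualA D))).

Section ChartValues.
Context (c : chart R (dM D)) (p q r : nat) (al : dA D -> 'rV[R]_p)
  (be : dB D -> 'rV[R]_q) (ga : dC D -> 'rV[R]_r) (de : dD D -> 'rV[R]_r).
Hypothesis S : split c al be ga de.

Definition chartBC : chart R (dD (dualBC D)) :=
  vb_chart (@dbase R _ _ (tA (dualB D)))
    (vb_chart (@dbase R _ _ (bC D)) c (dcoord (v := bC D) ga))
    (dcoord (v := tA (dualB D)) (fun Psi =>
        row_mx (be (vproj (tB (dualB D)) Psi)) (deB al de Psi))).

Definition chartA : chart R (dD (dualA D)) :=
  vb_chart (@dbase R _ _ (tA D)) (vb_chart qA c al)
    (dcoord (v := tA D) (fun d => row_mx (be (vproj (tB D) d)) (de d))).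

Lemma chartBC_smooth : smooth_chart chartBC.
Proof.
have [_ coA _ _ coD] := lw_cov LB; have [_ _ _ fv _] := lw_fib LB.
exact: triv_chart (dual_triv fv coA coD
  (sp_tA (split_flip (split_dualA Lf (split_flip S)))).1).1.
Qed.

Lemma chartA_smooth : smooth_chart chartA.
Proof.
have [_ coA _ _ coD] := lw_cov L; have [_ _ _ fv _] := lw_fib L.
exact: triv_chart (dual_triv fv coA coD (sp_tA S).1).1.
Qed.

Lemma chartBC_val (calB : dD (dualBC D)) : cdom c (base calB) ->
  cmap chartBC calB =
  row_mx (row_mx (cmap c (base calB)) (dcoord (v := bC D) ga (pB1 calB)))
    (row_mx (deBC al be de calB) (alBC al (pA1 calB))).
Proof.
move=> cm.
have [_ E] := dualA_projP LB (split_flip (split_dualA Lf (split_flip S))) cm.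
by congr row_mx; rewrite [alBC _ _]E hsubmxK.
Qed.

Lemma chartA_val (Phi : dD (dualA D)) : cdom c (qA (pA2 Phi)) ->
  cmap chartA Phi =
  row_mx (row_mx (cmap c (qA (pA2 Phi))) (al (pA2 Phi)))
    (row_mx (dlt be de Phi) (dcoord (v := bC D) ga (pB2 Phi))).
Proof.
move=> cm; have [_ E] := dualA_projP L S cm.
by congr row_mx; rewrite [dcoord ga _]E hsubmxK.
Qed.

End ChartValues.

Context (f : dD (dualBC D) -> dD (dualA D)).
Hypothesis f_graph : forall calB, reversal_graph calB (f calB).

Lemma rev_coord (c : chart R (dM D)) p q r (al : dA D -> 'rV[R]_p) (be : dB D -> 'rV[R]_q)
    (ga : dC D -> 'rV[R]_r) (de : dD D -> 'rV[R]_r) calB :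
  split c al be ga de -> cdom c (base calB) -> dlt be de (f calB) = - deBC al be de calB.
Proof. by move=> S cm; have [] := (graph_coords L LS S (f calB) cm).1 (f_graph calB). Qed.

Lemma rev_coordA (c : chart R (dM D)) p q r (al : dA D -> 'rV[R]_p) (be : dB D -> 'rV[R]_q)
    (ga : dC D -> 'rV[R]_r) (de : dD D -> 'rV[R]_r) calB :
  split c al be ga de -> cdom c (base calB) -> al (pA2 (f calB)) = alBC al (pA1 calB).
Proof. by move=> S cm; have [] := (graph_coords L LS S (f calB) cm).1 (f_graph calB). Qed.

Lemma rev_projA calB : pA2 (f calB) = undual (pA1 calB).
Proof.
have [c [p [q [r [al [be [ga [de [cm S]]]]]]]]] := LS (base calB).
have [g1 g2 g3 g4] := (graph_coords L LS S (f calB) cm).1 (f_graph calB).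
have sq : dbase (pA1 calB : dual_pt (dual_vb (bA D))) = base calB by exact: lw_sq LBC calB.
have [|u1 u2] := undualP (xi := pA1 calB) L (sp_bA S).1; first by rewrite sq.
by apply: (triv_inj (sp_bA S).1); rewrite ?u1 ?[qA _]g1 ?sq // u2 -g2.
Qed.

Lemma rev_projB calB : pB2 (f calB) = pB1 calB.
Proof.
have [c [p [q [r [al [be [ga [de [cm S]]]]]]]]] := LS (base calB).
by have [] := (graph_coords L LS S (f calB) cm).1 (f_graph calB).
Qed.

Lemma rev_base calB : qA (pA2 (f calB)) = base calB.
Proof.
by rewrite (lw_sq LA) rev_projB.
Qed.

(** In a splitting an element is given by its two projections and its last coordinate. On these f
    acts by [undual], the identity and negation, each of which is bijective. *)
Lemma rev_bij : exists g, cancel f g /\ cancel g f.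
Proof.
have finj : injective f.
  move=> x y fxy; have [c [p [q [r [al [be [ga [de [cm S]]]]]]]]] := LS (base x).
  have pBxy : pB1 x = pB1 y by rewrite -!rev_projB fxy.
  have cmy : cdom c (base y) by rewrite -[dbase y]pBxy.
  have pAxy : pA1 x = pA1 y.
    by rewrite -[pA1 x](undualK L LS) -rev_projA fxy rev_projA (undualK L LS).
  apply: (sp_inj (split_dualBC L LS S)) => //.
  - by rewrite (lw_sq LBC).
  - by rewrite pBxy.
  - by apply: oppr_inj; rewrite -(rev_coord S cm) -(rev_coord S cmy) fxy.
have fsurj y : exists x, f x = y.
  have [c [p [q [r [al [be [ga [de [cm S]]]]]]]]] := LS (qA (pA2 y)).
  have [b1 b2] := bidualP L (sp_bA S).1 cm.
  have [||x [x1 x2 x3]] := sp_exAB (a := bidual (bA D) (pA2 y)) (b := pB2 y)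
    LBC (split_dualBC L LS S) (- dlt be de y).
  - by rewrite [vproj _ _]b1.
  - by rewrite [LHS]b1 (lw_sq LA).
  have cx : cdom c (base x) by rewrite [dbase x]x2; move: cm; rewrite (lw_sq LA).
  exists x; apply: (sp_inj (split_dualA L S)).
  - by rewrite rev_base.
  - by rewrite rev_projA x1 (bidualK L LS).
  - by rewrite rev_projB x2.
  - by rewrite (rev_coord S cx) [deBC _ _ _ _]x3 opprK.
have /choice[g gP] := fsurj.
by exists g; split=> // x; apply: finj; rewrite gP.
Qed.

Lemma rev_smooth : smooth f.
Proof.
have [_ _ _ _ co1] := lw_cov LBC; have [_ _ _ _ co2] := lw_cov LA.
apply: smooth_of_sic => // x.
have [c [p [q [r [al [be [ga [de [cm S]]]]]]]]] := LS (base x).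
exists (chartBC c al be ga de), (chartA c al be de).
have sc := chartBC_smooth S; split=> //; first exact: chartA_smooth S.
have [[_ oc] _] := sc.
apply: (@sic_of R _ _ f (chartBC c al be ga de) (chartA c al be de) (@revmap R (cdim c) r q p))
    => //.
  exact: Cinfty_revmap.
move=> y cy; have cy' : cdom c (qA (pA2 (f y))) by rewrite rev_base.
split=> //; rewrite (chartA_val S) // (chartBC_val S) // revmapE.
have [g1 g2 g3 g4] := (graph_coords L LS S (f y) cy).1 (f_graph y).
by rewrite g4 [al _]g2 rev_projB rev_base.
Qed.

(** The inverse has the same shape, (m, t; phi, kappa) |-> (m, kappa; - phi, t), so [revmap]
    represents it too. *)
Lemma rev_inv_smooth g : cancel f g -> cancel g f -> smooth g.
Proof.
move=> fK gK; have [_ _ _ _ co1] := lw_cov LBC; have [_ _ _ _ co2] := lw_cov LA.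
apply: smooth_of_sic => // x.
have [c [p [q [r [al [be [ga [de [cm S]]]]]]]]] := LS (qA (pA2 x)).
exists (chartA c al be de), (chartBC c al be ga de).
have sc := chartA_smooth S; split=> //; first exact: chartBC_smooth S.
have [[_ oc] _] := sc.
apply: (@sic_of R _ _ g (chartA c al be de) (chartBC c al be ga de) (@revmap R (cdim c) p q r))
    => //.
  exact: Cinfty_revmap.
move=> y cy; have cy' : cdom c (base (g y)) by rewrite -rev_base gK.
split=> //; rewrite (chartA_val S) // (chartBC_val S) // revmapE.
have [g1 g2 g3 g4] := (graph_coords L LS S (f (g y)) cy').1 (f_graph (g y)).
rewrite gK in g1 g2 g3 g4.
by rewrite g4 opprK -[alBC _ _]g2 -g3 -g1.
Qed.

(** By [undualP] the local representative is the identity. *)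
Lemma undual_smooth : smooth (@undual R D : dA (dualBC D) -> dA D).
Proof.
have [_ co1 _ _ _] := lw_cov LBC; have [coM co2 _ _ _] := lw_cov L.
have [fA _ _ _ _] := lw_fib L.
apply: smooth_of_sic => // x.
have [c [p [q [r [al [be [ga [de [cm S]]]]]]]]] := LS (dbase (x : dual_pt (dual_vb (bA D)))).
have tal' := (sp_bA (split_dualBC L LS S)).1.
exists (vb_chart (@dbase R _ _ (dual_vb (bA D))) c (alBC al)), (vb_chart qA c al).
have sc := triv_chart tal'; split=> //; first exact: triv_chart (sp_bA S).1.
have [[_ oc] _] := sc.
apply: (@sic_of R _ _ _ (vb_chart (@dbase R _ _ (dual_vb (bA D))) c (alBC al))
  (vb_chart qA c al) (fun z : 'rV[R]_(cdim c + p) => z)) => //; first exact: Cinfty_id.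
move=> y cy; have [u1 u2] := undualP L (sp_bA S).1 cy.
by rewrite /= u1 u2.
Qed.

Lemma bidual_smooth : smooth (bidual (bA D) : dA D -> dA (dualBC D)).
Proof.
have [_ co1 _ _ _] := lw_cov LBC; have [coM co2 _ _ _] := lw_cov L.
apply: smooth_of_sic => // x.
have [c [p [q [r [al [be [ga [de [cm S]]]]]]]]] := LS (qA x).
have tal' := (sp_bA (split_dualBC L LS S)).1.
exists (vb_chart qA c al), (vb_chart (@dbase R _ _ (dual_vb (bA D))) c (alBC al)).
have sc := triv_chart (sp_bA S).1; split=> //; first exact: triv_chart tal'.
have [[_ oc] _] := sc.
apply: (@sic_of R _ _ _ (vb_chart qA c al) (vb_chart (@dbase R _ _ (dual_vb (bA D))) c (alBC al))
  (fun z : 'rV[R]_(cdim c + p) => z)) => //; first exact: Cinfty_id.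
move=> y cy; have [u1 u2] := bidualP L (sp_bA S).1 cy.
by rewrite /= u1 u2.
Qed.

Lemma id_diffeo (X : mfd R) : smooth (@id X) -> diffeo (@id X).
Proof. by move=> s; split=> //; exists id; split. Qed.

Lemma smooth_id_M : smooth (@id (dM D)).
Proof.
have [coM _ _ _ _] := lw_cov L; apply: smooth_id_of => // m.
have [c [p [q [r [al [be [ga [de [cm S]]]]]]]]] := LS m.
by exists c; split=> //; exact: triv_base (sp_bA S).1.
Qed.

Lemma smooth_id_dualC : smooth (@id (dual_mfd (bC D))).
Proof.
have [_ _ co _ _] := lw_cov LA; apply: smooth_id_of => // kappa.
have [c [p [q [r [al [be [ga [de [cm S]]]]]]]]] := LS (dbase (kappa : dual_pt (bC D))).
by eexists; split; first exact: triv_chart (sp_bB (split_dualA L S)).1.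
Qed.

Lemma rev_diffeo : diffeo f.
Proof.
have [g [fK gK]] := rev_bij; split; first exact: rev_smooth.
by exists g; split=> //; exact: rev_inv_smooth.
Qed.

Lemma undual_diffeo : diffeo (@undual R D : dA (dualBC D) -> dA D).
Proof.
split; first exact: undual_smooth.
exists (bidual (bA D)); split; [exact: undualK L LS|exact: bidualK L LS|exact: bidual_smooth].
Qed.

Lemma undual_base xi : qA (undual xi) = vproj (bA (dualBC D)) xi.
Proof.
have [c [p [q [r [al [be [ga [de [cm S]]]]]]]]] := LS (dbase (xi : dual_pt (dual_vb (bA D)))).
by have [] := undualP L (sp_bA S).1 cm.
Qed.

Lemma undual_morphism : is_vb_morphism (bA (dualBC D)) (bA D) (@undual R D) id.
Proof.
have [fA1 _ _ _ _] := lw_fib LBC; have [fA _ _ _ _] := lw_fib L.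
split; [exact: undual_smooth|exact: smooth_id_M|exact: undual_base| |].
- move=> x y xy; have [c [p [q [r [al [be [ga [de [cm S]]]]]]]]] :=
    LS (dbase (x : dual_pt (dual_vb (bA D)))).
  have tal' := (sp_bA (split_dualBC L LS S)).1.
  have cy : cdom c (dbase (y : dual_pt (dual_vb (bA D)))) by rewrite -[dbase y]xy.
  have sxy : vproj (bA (dualBC D)) (vadd (bA (dualBC D)) x y)
      = vproj (bA (dualBC D)) x by exact: fA1.1.
  have cs : cdom c (vproj (bA (dualBC D)) (vadd (bA (dualBC D)) x y)) by rewrite sxy.
  have [u1 u2] := undualP L (sp_bA S).1 cm; have [v1 v2] := undualP L (sp_bA S).1 cy.
  have [w1 w2] := undualP L (sp_bA S).1 cs.
  have uv : qA (undual x) = qA (undual y) by rewrite !undual_base.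
  apply: (triv_inj (sp_bA S).1).
  + by rewrite undual_base.
  + by rewrite fA.1 // !undual_base.
  + rewrite (triv_add (sp_bA S).1) // ?u1 // u2 v2 [LHS]w2.
    by rewrite [LHS](triv_add tal').
- move=> t x; have [c [p [q [r [al [be [ga [de [cm S]]]]]]]]] :=
    LS (dbase (x : dual_pt (dual_vb (bA D)))).
  have tal' := (sp_bA (split_dualBC L LS S)).1.
  have sx : vproj (bA (dualBC D)) (vscale (bA (dualBC D)) t x)
      = vproj (bA (dualBC D)) x by exact: fA1.2.
  have cs : cdom c (vproj (bA (dualBC D)) (vscale (bA (dualBC D)) t x)) by rewrite sx.
  have [u1 u2] := undualP L (sp_bA S).1 cm; have [w1 w2] := undualP L (sp_bA S).1 cs.
  apply: (triv_inj (sp_bA S).1).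
  + by rewrite undual_base.
  + by rewrite fA.2 !undual_base.
  + rewrite (triv_scale (sp_bA S).1) // ?u1 // u2 [LHS]w2.
    by rewrite [LHS](triv_scale tal').
Qed.

(** Linearity is tested on both projections and the last coordinate; [sp_addA] and [sp_scaleA]
    compute these on either side from the splittings. *)
Lemma rev_morphismA : is_vb_morphism (tA (dualBC D)) (tA (dualA D)) f (@undual R D).
Proof.
have [_ _ _ fv1 _] := lw_fib LBC; have [_ _ _ fv2 _] := lw_fib LA.
split; [exact: rev_smooth|exact: undual_smooth|exact: rev_projA| |].
- move=> x y xy; have [c [p [q [r [al [be [ga [de [cm S]]]]]]]]] := LS (base x).
  have S1 := split_dualBC L LS S; have S2 := split_dualA L S.
  have cx : cdom c (vproj (bA (dualBC D)) (pA1 x)) by rewrite (lw_sq LBC).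
  have cy : cdom c (base y) by move: cx; rewrite xy (lw_sq LBC).
  have fxy : pA2 (f x) = pA2 (f y) by rewrite !rev_projA xy.
  have cfx : cdom c (qA (pA2 (f x))) by rewrite rev_base.
  have [h1 h2 h3] := sp_addA LBC S1 cx xy.
  have [k1 k2 k3] := sp_addA LA S2 cfx fxy.
  have cs : cdom c (base (vadd (tA (dualBC D)) x y)).
    by have := lw_sq LBC (vadd (tA (dualBC D)) x y); rewrite h1 => e; rewrite -[dbase _]e.
  apply: (sp_inj S2).
  + by rewrite rev_base.
  + by rewrite k1 !rev_projA h1.
  + by rewrite k2 !rev_projB h2.
  + rewrite k3 (rev_coord S cs) (rev_coord S cm) (rev_coord S cy).
    by rewrite [deBC _ _ _ _]h3 opprD.
- move=> t x; have [c [p [q [r [al [be [ga [de [cm S]]]]]]]]] := LS (base x).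
  have S1 := split_dualBC L LS S; have S2 := split_dualA L S.
  have cx : cdom c (vproj (bA (dualBC D)) (pA1 x)) by rewrite (lw_sq LBC).
  have cfx : cdom c (qA (pA2 (f x))) by rewrite rev_base.
  have [h1 h2 h3] := sp_scaleA LBC S1 t cx.
  have [k1 k2 k3] := sp_scaleA LA S2 t cfx.
  have cs : cdom c (base (vscale (tA (dualBC D)) t x)).
    by have := lw_sq LBC (vscale (tA (dualBC D)) t x); rewrite h1 => e; rewrite -[dbase _]e.
  apply: (sp_inj S2).
  + by rewrite rev_base.
  + by rewrite k1 !rev_projA h1.
  + by rewrite k2 !rev_projB h2.
  + rewrite k3 (rev_coord S cs) (rev_coord S cm).
    by rewrite [deBC _ _ _ _]h3 scalerN.
Qed.

Lemma rev_morphismB : is_vb_morphism (tB (dualBC D)) (tB (dualA D)) f id.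
Proof.
split; [exact: rev_smooth|exact: smooth_id_dualC|exact: rev_projB| |].
- move=> x y xy; have [c [p [q [r [al [be [ga [de [cm S]]]]]]]]] := LS (base x).
  have S1 := split_dualBC L LS S; have S2 := split_dualA L S.
  have cy : cdom c (base y) by rewrite -[dbase y]xy.
  have fxy : pB2 (f x) = pB2 (f y) by rewrite !rev_projB.
  have cfx : cdom c (vproj (bB (dualA D)) (pB2 (f x))) by rewrite rev_projB.
  have [h1 h2 h3] := sp_addB LBC S1 cm xy.
  have [k1 k2 k3] := sp_addB LA S2 cfx fxy.
  have cs : cdom c (base (vadd (tB (dualBC D)) x y)) by rewrite [X in dbase X]h1.
  apply: (sp_injB S2).
  + by rewrite rev_projB.
  + by rewrite k1 !rev_projB h1.
  + by rewrite k2 (rev_coordA S cs) (rev_coordA S cm) (rev_coordA S cy).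
  + rewrite k3 (rev_coord S cs) (rev_coord S cm) (rev_coord S cy).
    by rewrite [deBC _ _ _ _]h3 opprD.
- move=> t x; have [c [p [q [r [al [be [ga [de [cm S]]]]]]]]] := LS (base x).
  have S1 := split_dualBC L LS S; have S2 := split_dualA L S.
  have cfx : cdom c (vproj (bB (dualA D)) (pB2 (f x))) by rewrite rev_projB.
  have [h1 h2 h3] := sp_scaleB LBC S1 t cm.
  have [k1 k2 k3] := sp_scaleB LA S2 t cfx.
  have cs : cdom c (base (vscale (tB (dualBC D)) t x)) by rewrite [X in dbase X]h1.
  apply: (sp_injB S2).
  + by rewrite rev_projB.
  + by rewrite k1 !rev_projB h1.
  + by rewrite k2 (rev_coordA S cs) (rev_coordA S cm).
  + rewrite k3 (rev_coord S cs) (rev_coord S cm).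
    by rewrite [deBC _ _ _ _]h3 scalerN.
Qed.

(** A core element lies over zeros and its last coordinate is the coordinate vector of beta, which
    the reversal negates. *)
Lemma rev_core (beta : dC (dualBC D)) :
  f (core beta) = @core R (dualA D) (vscale (bC (dualA D)) (-1) beta).
Proof.
have [_ _ fC _ _] := lw_fib LA.
have [c [p [q [r [al [be [ga [de [cm S]]]]]]]]] := LS (vproj (bC (dualBC D)) beta).
have S1 := split_dualBC L LS S; have S2 := split_dualA L S.
have mE : vproj (bC (dualA D)) (vscale (bC (dualA D)) (-1) beta) = vproj (bC (dualBC D)) beta.
  exact: fC.2.
have [h1 h2 h3] := sp_core S1 cm.
have [|k1 k2 k3] := sp_core S2 (x := vscale (bC (dualA D)) (-1) beta); first by rewrite mE.
have [z1 z2] := (sp_bA S1).2 _ cm; have [y1 y2] := (sp_bA S2).2 _ cm.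
have cx : cdom c (base (core beta)).
  by have [e _] := (sp_bB S1).2 _ cm; rewrite [X in dbase X]h2 [X in cdom c X]e.
have [|u1 u2] := undualP L (sp_bA S).1 (xi := vzero (bA (dualBC D)) (vproj (bC (dualBC D)) beta)).
  by rewrite [dbase _]z1.
have aE : pA2 (f (core beta)) = vzero (bA D) (vproj (bC (dualBC D)) beta).
  rewrite rev_projA h1; apply: (triv_inj (sp_bA S).1).
  - by rewrite u1 [dbase _]z1.
  - by rewrite u1 [dbase _]z1 [RHS]y1.
  - by rewrite u2 [LHS]z2 [RHS]y2.
apply: (sp_inj S2).
- by rewrite rev_base.
- by rewrite aE [RHS]k1 mE.
- by rewrite rev_projB h2 k2 mE.
- rewrite (rev_coord S cx) [deBC _ _ _ _]h3 k3 (triv_scale (sp_bC S2)) //.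
  by rewrite scaleN1r.
Qed.

End ReversalIso.

Theorem theorem3p1 (R : realType) (D : dvb R) (hD : is_dvb D) :
  (forall calB : dD (dualBC D), exists! Phi : dD (dualA D),
     reversal_graph calB Phi) /\
  (exists (RDA : dD (dualBC D) -> dD (dualA D))
          (iA : dA (dualBC D) -> dA (dualA D)),
     [/\ forall calB Phi, RDA calB = Phi <-> reversal_graph calB Phi,
         (* iA is the canonical identification of the double dual of A with A *)
         forall a : dA D, iA (bidual (bA D) a) = a,
         is_dvb_iso (D := dualBC D) (D' := dualA D) RDA iA id id,
         forall beta : dC (dualBC D),
           RDA (core beta) =
           @core R (dualA D) (vscale (bC (dualA D)) (-1) beta) &
         forall calB Psi d, compatible calB (RDA calB) Psi d ->
           pairing calB Psi + pairing (RDA calB) d = pairing Psi d]).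
Proof.
have L := dvb_is_laws hD; have LS := locally_split_dvb hD.
have ex calB : exists! Phi : dD (dualA D), reversal_graph calB Phi.
  have [c [p [q [r [al [be [ga [de [cm S]]]]]]]]] :=
    LS (vproj (bB (dualBC D)) (vproj (tB (dualBC D)) calB)).
  exact: (graph_ex L LS S cm).
split=> //.
have /choice[f fP] calB : exists Phi : dD (dualA D), reversal_graph calB Phi.
  by have [Phi [gPhi _]] := ex calB; exists Phi.
have df := rev_diffeo L LS fP; have du := undual_diffeo L LS.
have dM0 := id_diffeo (smooth_id_M L LS); have dC0 := id_diffeo (smooth_id_dualC L LS).
(* The double dual of A is identified with A by [undual]; on C^* and M the reversal covers
   identities. *)
exists f, (@undual R D); split.
- move=> calB Phi; split=> [<- //|gPhi].
  by have [Phi0 [_ u]] := ex calB; rewrite -(u _ gPhi) -(u _ (fP calB)).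
- exact: bidualK L LS.
- split; split=> //.
  + exact: rev_morphismA.
  + exact: rev_morphismB.
  + exact: undual_morphism.
  + by split=> //; [exact: dC0.1|exact: dM0.1].
- exact: rev_core.
- by move=> calB Psi d; case: (fP calB) => _; apply.
Qed.
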